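(* Let $N\ge1$ and $k\ge 0$ be integers. Let $F$ be a $\mathbb{C}$-vector space of dimension $k+1$ equipped with a nilpotent endomorphism $J$ of maximal index (i.e. $J^k\ne 0$), and consider the induced linear action of $\mathbb{C}[J]^\times\simeq(\mathbb{C}[T]/(T^{k+1}))^\times$ on $F$. Under this action, the algebra of quasi-invariant polynomials in $(N+1)$ copies of $F$ is finitely generated by the explicit generators $\mathcal{G}_1,\dots,\mathcal{G}_{k+1}$. Furthermore, this is a minimal set of generators (no proper subset of $\mathcal{G}_1\cup\dots\cup\mathcal{G}_{k+1}$ generates the algebra), and they satisfy $|\mathcal{G}_1|=N+1$ and $|\mathcal{G}_i|=\frac{N(N+1)}{2}(N+1)^{i-2}$ for every $2\le i\le k+1$.
   Context: The algebra of polynomials in $(N+1)$ copies of $F$ is the symmetric algebra $S^{\bullet}(F^{\oplus(N+1)})$, on which $\mathbb{C}[J]^\times$ acts by the algebra automorphisms induced by its diagonal action on $F^{\oplus(N+1)}$. An element $v$ is quasi-invariant (of degree $d$) if there is $d\in\mathbb{N}$ such that $P(J)\cdot v=P(0)^dv$ for every $P\in\mathbb{C}[T]$ with $P(0)\ne 0$. The algebra of quasi-invariants is the direct sum over $d\in\mathbb{N}$ of the spaces of quasi-invariants of degree $d$. Explicit generators. Choose a basis $(f_j)_{0\le j\le k}$ of $F$ with $Jf_j=j f_{j-1}$ for $j\geq 1$ and $Jf_0=0$ (such a basis exists), and let $X_i^{(j)}$, $0\le j\le k$, denote the copy of $f_j$ in the $(i+1)$-th copy of $F$ ($0\le i\le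 N$), so that $S^\bullet(F^{\oplus(N+1)})=\mathbb{C}[X_i^{(j)}:0\le i\le N,0\le j\le k]$. For $1\le d\le k+1$, let $\overline{\Sigma_d}$ be the set of sequences $\boldsymbol\alpha=(\boldsymbol\alpha_0,\dots,\boldsymbol\alpha_N)$ such that: (1) each $\boldsymbol\alpha_i=(\alpha_{i,1},\dots,\alpha_{i,r_i})$ is a finite (possibly empty, $r_i=0$) sequence of natural numbers; (2) whenever $r_i\ge 1$, $0\le\alpha_{i,1}<\dots<\alpha_{i,r_i}<r_0+\dots+r_i$; (3) $r_0+\dots+r_N=d$; (4) there is an index $0\le i\le N$ with $r_i\ge1$ such that $\alpha_{i,1}=0$; if $r_i>1$ then $\alpha_{i,r_i}<r_0+\dots+r_i-1$; and for every $j>i$ with $r_j\ge1$, $\alpha_{j,r_j}<r_0+\dots+r_j-1$. For $\boldsymbol\alpha\in\overline{\Sigma_d}$, let $W_{\boldsymbol\alpha}^{\mathrm{subs}}$ be the determinant of the $d\times d$ matrix whose columns are, in this order, $c_0(\alpha_{0,1}),\dots,c_0(\alpha_{0,r_0}),\dots,c_N(\alpha_{N,1}),\dots,c_N(\alpha_{N,r_N})$, where $c_i(a)$ is the column with entries, for $j=0,\dots,d-1$, equal to $\frac{j!}{(j-a)!}X_i^{(j-a)}$ if $j\ge a$ and $0$ if $j<a$. Set $\mathcal{G}_d=\{W^{\mathrm{subs}}_{\boldsymbol\alpha}:\boldsymbol\alpha\in\overline{\Sigma_d}\}$. *)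

(* Defs.v *)
From HB Require Import structures.
From mathcomp Require Import all_boot all_order all_algebra.
From mathcomp Require Import boolp classical_sets functions cardinality reals.
From mathcomp Require Import complex mpoly zify.

Set Implicit Arguments.
Unset Strict Implicit.
Unset Printing Implicit Defensive.

Import Order.TTheory GRing.Theory Num.Theory.
Local Open Scope ring_scope.
Local Open Scope classical_set_scope.

(* The symmetric algebra of a finite dimensional space V, realised as the     *)
(* polynomial ring in the vectors of the basis [vbasis fullv]; [sym_in] is    *)
(* the canonical map V -> S(V), cf. [sym_universal] and [sym_map_in].         *)
Notation sym_alg K V := {mpoly K[\dim {: V}]}.

Definition sym_in (K : fieldType) (V : vectType K) (v : V) :
    sym_alg K V :=
  \sum_(l < \dim {:V}) coord (vbasis {:V}) l v *: 'X_l.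

(* The algebra endomorphism of S(V) induced by a linear endomorphism g of V.  *)
Definition sym_map (K : fieldType) (V : vectType K) (g : V -> V)
    (p : sym_alg K V) : sym_alg K V :=
  p \mPo [tuple sym_in (g (vbasis {:V})`_l) | l < \dim {:V}].

Section SymUniversal.
Variables (K : fieldType) (V : vectType K) (A : comAlgType K).
Variable phi : {linear V -> A}.

Let ext (p : sym_alg K V) : A :=
  mmap (in_alg A) (fun l : 'I_(\dim {:V}) => phi (vbasis {:V})`_l) p.

Let ext_additive : additive ext. Proof. by move=> p q; rewrite /ext mmapB. Qed.
Let ext_multiplicative : multiplicative ext.
Proof. exact: mmap_is_multiplicative. Qed.
Let ext_scalable : scalable ext.
Proof. by move=> c p; rewrite /ext mmapZ /= mulr_algl. Qed.

HB.instance Definition _ :=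
  GRing.isAdditive.Build (sym_alg K V) A ext ext_additive.
HB.instance Definition _ :=
  GRing.isMultiplicative.Build (sym_alg K V) A ext ext_multiplicative.
HB.instance Definition _ :=
  GRing.isScalable.Build K (sym_alg K V) A _ ext ext_scalable.

Lemma sym_universal :
  exists2 Phi : {lrmorphism sym_alg K V -> A},
    (forall v, Phi (sym_in v) = phi v) &
    forall Psi : {lrmorphism sym_alg K V -> A},
      (forall v, Psi (sym_in v) = phi v) -> Psi =1 Phi.
Proof.
have extX (l : 'I_(\dim {:V})) : ext 'X_l = phi (vbasis {:V})`_l.
  by rewrite /ext mmapX mmap1U.
exists (ext : {lrmorphism sym_alg K V -> A}) => [v | Psi PsiE p] /=.
  rewrite /sym_in linear_sum {2}(coord_vbasis (memvf v)) linear_sum.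
  by apply: eq_bigr => l _; rewrite !linearZ /= extX.
have PsiX (l : 'I_(\dim {:V})) : Psi 'X_l = phi (vbasis {:V})`_l.
  rewrite -PsiE /sym_in (bigD1 l) //= coord_free ?(basis_free (vbasisP _)) //.
  rewrite eqxx scale1r big1 ?addr0 // => l' /negPf ll'.
  rewrite coord_free ?(basis_free (vbasisP _)) //.
  by rewrite (_ : (_ == _) = false) ?scale0r // eq_sym.
rewrite [p]mpolyE !linear_sum; apply: eq_bigr => m _.
rewrite !linearZ /= mpolyXE_id !rmorph_prod; congr (_ *: _).
by apply: eq_bigr => l _; rewrite !rmorphXn /= PsiX extX.
Qed.

End SymUniversal.

Lemma sym_in_is_linear (K : fieldType) (V : vectType K) :
  linear (@sym_in K V).
Proof.
move=> a u v; rewrite /sym_in scaler_sumr -big_split; apply: eq_bigr => l _.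
by rewrite linearP scalerDl scalerA.
Qed.

HB.instance Definition _ (K : fieldType) (V : vectType K) :=
  GRing.isLinear.Build K V (sym_alg K V) _ (@sym_in K V)
    (@sym_in_is_linear K V).

Lemma sym_map_in (K : fieldType) (V : vectType K) (g : {linear V -> V}) v :
  sym_map g (sym_in v) = sym_in (g v).
Proof.
rewrite [in RHS](coord_vbasis (memvf v)) /sym_map {1}/sym_in !linear_sum.
apply: eq_bigr => l _.
by rewrite !linearZ /= comp_mpolyXU nth_mktuple.
Qed.

Definition copies (K : fieldType) (F : vectType K) (N : nat) : vectType K :=
  {ffun 'I_N.+1 -> F}.

Definition poly_end (K : fieldType) (F : vectType K) (J : 'End(F))
    (P : {poly K}) (v : F) : F :=
  \sum_(l < size P) P`_l *: iter l J v.

Definition diag_act (K : fieldType) (F : vectType K) (N : nat) (g : F -> F)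
    (v : copies F N) : copies F N :=
  [ffun i => g (v i)].

Definition quasi_invariant (K : fieldType) (F : vectType K) (J : 'End(F))
    (N d : nat) : set (sym_alg K (copies F N)) :=
  [set p | forall P : {poly K}, P.[0] != 0 ->
     sym_map (diag_act (poly_end J P)) p = P.[0] ^+ d *: p].

(* The sum is automatically direct, see [quasi_invariant_direct].             *)
Definition quasi_invariants (K : fieldType) (F : vectType K) (J : 'End(F))
    (N : nat) : set (sym_alg K (copies F N)) :=
  [set p | exists n (q : 'I_n -> sym_alg K (copies F N)),
     (forall d : 'I_n, quasi_invariant J d (q d)) /\ p = \sum_(d < n) q d].

Definition gen_subalg (K : fieldType) (A : algType K) (G : set A) : set A :=
  smallest (fun B : set A => GRing.subalg_closed (fun x => x \in B)) G.

Definition adapted_basis (K : fieldType) (F : vectType K) (J : 'End(F))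
    (k : nat) (f : k.+1.-tuple F) : Prop :=
  [/\ basis_of {:F} f, J f`_0 = 0 &
      forall j, (1 <= j <= k)%N -> J f`_j = j%:R *: f`_j.-1].

Definition X_ (K : fieldType) (F : vectType K) (N : nat) (f : seq F)
    (i : 'I_N.+1) (j : nat) : sym_alg K (copies F N) :=
  sym_in ([ffun l => if l == i then f`_j else 0] : copies F N).

Definition in_Sigma (N d : nat) (a : 'I_N.+1 -> seq nat) : Prop :=
  let r i := size (a i) in
  let s i := (\sum_(l < N.+1 | l <= i) r l)%N in
  [/\ forall i, (1 <= r i)%N -> sorted ltn (a i) /\ (last 0 (a i) < s i)%N,
      (\sum_(i < N.+1) r i)%N = d &
      exists i : 'I_N.+1,
        [/\ (1 <= r i)%N, head 0%N (a i) = 0%N,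
            (1 < r i)%N -> (last 0 (a i) < s i - 1)%N &
            forall j : 'I_N.+1, (i < j)%N -> (1 <= r j)%N ->
              (last 0 (a j) < s j - 1)%N]].

(* [j ^_ b] is the falling factorial j! / (j - b)!.                           *)
Definition wronsk_entry (K : fieldType) (F : vectType K) (N : nat) (f : seq F)
    (c : 'I_N.+1 * nat) (j : nat) : sym_alg K (copies F N) :=
  if (c.2 <= j)%N then (j ^_ c.2)%:R * X_ f c.1 (j - c.2) else 0.

Definition wronsk_cols (N : nat) (a : 'I_N.+1 -> seq nat) :
    seq ('I_N.+1 * nat) :=
  [seq (i, b) | i <- enum 'I_N.+1, b <- a i].

Definition wronsk (K : fieldType) (F : vectType K) (N : nat) (f : seq F)
    (d : nat) (a : 'I_N.+1 -> seq nat) : sym_alg K (copies F N) :=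
  \det (\matrix_(j < d, l < d)
          wronsk_entry f (nth (ord0, 0%N) (wronsk_cols a) l) j).

Definition gens (K : fieldType) (F : vectType K) (N : nat) (f : seq F)
    (d : nat) : set (sym_alg K (copies F N)) :=
  [set wronsk f d a | a in [set a | in_Sigma d a]].

Arguments quasi_invariant {K F} J N d p.
Arguments quasi_invariants {K F} J N p.
Arguments gens {K F} N f d p.

Lemma quasi_invariant_direct (K : numFieldType) (F : vectType K) (J : 'End(F))
    (N n : nat) (q : 'I_n -> sym_alg K (copies F N)) :
  (forall d : 'I_n, quasi_invariant J N d (q d)) ->
  \sum_(d < n) q d = 0 -> forall d, q d = 0.
Proof.
have QZ d c p : quasi_invariant J N d p -> quasi_invariant J N d (c *: p).
  move=> Hp P P0; have := Hp P P0; rewrite /sym_map linearZ /= => ->.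
  by rewrite !scalerA mulrC.
pose T := sym_map (@diag_act K F N (poly_end J 2%:P)).
have TE d p : quasi_invariant J N d p -> T p = 2 ^+ d *: p.
  by move=> /(_ 2%:P); rewrite hornerC pnatr_eq0 => /(_ isT).
elim: n q => [|n IHn] q Hq; first by move=> _ [].
rewrite big_ord_recr /= => sum0.
have q0 (d : 'I_n) : q (widen_ord (leqnSn n) d) = 0.
  have Hq' (e : 'I_n) : quasi_invariant J N e
      ((2 ^+ e - 2 ^+ n) *: q (widen_ord (leqnSn n) e)).
    exact/QZ/(Hq (widen_ord (leqnSn n) e)).
  have := IHn _ Hq' _ d; rewrite (_ : \sum_(_ < _) _ = 0); last first.
    under eq_bigr => e _ do rewrite scalerBl -(TE e _ (Hq (widen_ord _ e))).
    rewrite sumrB -scaler_sumr /T /sym_map -linear_sum /=.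
    move/eqP: (sum0); rewrite addr_eq0 => /eqP ->.
    rewrite linearN /= -/(sym_map _ _) -/(T _) (TE _ _ (Hq ord_max)) /=.
    by rewrite scalerN subrr.
  move=> /(_ erefl)/eqP; rewrite scaler_eq0 subr_eq0 => /orP[|/eqP //].
  by rewrite (inj_eq (ieexprIn _ _)) ?ltr0n // ?pnatr_eq1 // ltn_eqF.
move=> d; have [j ->|->] := unliftP ord_max d.
  by rewrite -(q0 j); congr q; apply: val_inj; rewrite /= /bump leqNgt ltn_ord.
by move: sum0; rewrite big1 ?add0r.
Qed.

Lemma adapted_basis_exists (K : numFieldType) (F : vectType K) (J : 'End(F))
    (k : nat) :
  \dim {:F} = k.+1 -> (exists m, forall v, iter m J v = 0) ->
  (exists v, iter k J v != 0) -> exists f, @adapted_basis K F J k f.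
Proof.
move=> dimF [m Jm] [v0 Jv0].
have iter0 n : iter n J 0 = 0 by elim: n => //= n ->; rewrite linear0.
pose g t : 'End(F) := iter t (comp_lfun J) \1%VF.
have gE t x : g t x = iter t J x.
  by elim: t => [|t IHt]; rewrite /g /= lfunE //= -IHt.
pose fs n v := mkseq (fun j => j`!%:R *: iter (n - j) J v) n.+1.
have fs_free n v : iter n.+1 J v = 0 -> iter n J v != 0 -> free (fs n v).
  move=> J0 Jn.
  have H t : (t <= n.+1)%N ->
      free (mkseq (fun j => j`!%:R *: iter (n - j) J v) t).
    elim: t => [|t IHt] tn; first exact: nil_free.
    rewrite mkseqS (perm_free (Y := (t`!%:R *: iter (n - t) J v) ::
      mkseq (fun j => j`!%:R *: iter (n - j) J v) t)); last first.
      by rewrite perm_rcons.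
    rewrite free_cons IHt ?(ltnW tn) // andbT; apply/negP => /coord_span.
    move=> /(congr1 (g t)); rewrite linear_sum big1 /=.
      rewrite linearZ /= gE -iterD subnKC // => /eqP.
      by rewrite scaler_eq0 (negPf Jn) pnatr_eq0 -leqn0 leqNgt fact_gt0.
    move=> [j jt] _ /=.
    rewrite linearZ /= -/(mkseq _ t) (nth_mkseq _ _ jt).
    rewrite linearZ /= gE -(gE t) linearZ /= gE -iterD.
    rewrite (_ : (t + (n - j) = (t - j).-1 + n.+1)%N); last by clear -jt tn; lia.
    by rewrite iterD J0 iter0 !scaler0.
  exact: H.
have Jk1 v : iter k.+1 J v = 0.
  elim: m Jm v => [|m IHm] Jm v.
    by rewrite (_ : v = 0) ?iter0 //; exact: (Jm v).
  have [mk|km] := leqP m.+1 k.+1.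
    by rewrite -(subnK mk) iterD Jm iter0.
  apply: IHm => u; apply/eqP/negPn/negP => Ju.
  have /eqP := fs_free _ _ (Jm u) Ju; rewrite size_mkseq => dimfs.
  have := dimvS (subvf <<fs m u>>%VS); rewrite dimF dimfs ltnS.
  by rewrite leqNgt -ltnS km.
have sz : size (fs k v0) == k.+1 by rewrite size_mkseq.
have fsE j : (j <= k)%N -> (fs k v0)`_j = j`!%:R *: iter (k - j) J v0.
  by move=> jk; rewrite (nth_mkseq 0 _ (n := k.+1)).
exists (Tuple sz); rewrite /adapted_basis [tval _]/(fs k v0).
split => [||j /andP[j0 jk]].
- by rewrite basisEfree (fs_free _ _ (Jk1 v0) Jv0) subvf dimF (eqP sz) leqnn.
- by rewrite fsE // fact0 scale1r subn0 -iterS Jk1.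
- rewrite !fsE //; last by rewrite (leq_trans (leq_pred j)).
  rewrite linearZ /= -iterS scalerA -natrM; congr (_ *: iter _ _ _); last lia.
  by congr (_%:R); case: j j0 {jk} => // j _; rewrite factS.
Qed.

(* Main.v *)
(* Letter after letter, send X_i^(0) to 0 and X_i^(j) to j X_i^(j-1). This    *)
(* commutes with the action and kills every quasi-invariant of positive       *)
(* degree after the last letter; hence, just before being killed, it is       *)
(* divisible by some X_i^(0), with a quotient of smaller degree. By induction *)
(* the quasi-invariants of degree d <= k+1 are spanned by linearly            *)
(* independent Wronskians W_w indexed by the words w of length d.             *)
(* Differentiating the action of 1 + eps J^(d-1) at eps = 0 gives a syzygy    *)
(* between the derivatives by the variables of order d-1, which reduces such  *)
(* a quasi-invariant to the explicit generators modulo elements of order <    *)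
(* d-1; the same derivatives show that these generators are independent       *)
(* modulo decomposable elements.                                              *)
(*                                                                            *)
(* To see that a quasi-invariant of order at most m is a polynomial in        *)
(* Wronskians of size at most m+1, polarise it to a multilinear one.          *)
(* Invariance and the bound on the order imply the Tanisaki conditions for    *)
(* the partition with parts m+1, ..., m+1, r, and the space cut out by        *)
(* these conditions is spanned by products of Wronskians whose sizes          *)
(* are the parts, by the Garsia-Procesi induction on the number of letters.   *)

Require Import Defs.
From HB Require Import structures.
From mathcomp Require Import all_boot all_order all_algebra.
From mathcomp Require Import boolp classical_sets functions cardinality reals.
From mathcomp Require Import perm complex mpoly zify.

Set Implicit Arguments.
Unset Strict Implicit.
Unset Printing Implicit Defensive.

Import Order.TTheory GRing.Theory Num.Theory.
Local Open Scope ring_scope.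

(** In the polynomial ring in the X_i^(j), a unit P(J) multiplies the matrix of a Wronskian of size
    n <= k+1 on the left by a triangular matrix with diagonal P(0), so this Wronskian is
    quasi-invariant of degree n ([jW_inv]). The proof plays the degree against the order.

    Low degree: for d <= k+1 the Wronskians [wordW w], with w a word of length d, form a basis of
    the quasi-invariants of degree d ([jinv_span], [wordW_free]). All of them have order < d. For 0
    < d <= k, an element of degree d+1 is determined modulo order < d by its derivatives D_i by
    X_i^(d). These are quasi-invariants of degree d with sum of the X_i^(0) D_i equal to 0
    ([jinv_top_deriv], [jinv_syzygy]). If m is the last letter with D_m nonzero, the syzygy forces
    D_m to be a combination of words starting before m. The generators [wordG m w], with w starting
    before m, have D_m proportional to [wordW w] and D_j = 0 for j > m. So they realise all possible
    derivatives, and do so independently ([jinv_top_reduce], [wordG_free]).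

    Generation: a quasi-invariant of order at most m is a polynomial in Wronskians of size at most
    m+1 ([jinv_galg], from [tanisaki_span] by polarisation). Subtracting generators from a Wronskian
    of size n >= 2 leaves order < n-1, hence a polynomial in smaller Wronskians. Induction shows
    that the generators generate all Wronskians ([wronskian_galg]). The case m = k gives all
    quasi-invariants.

    Minimality: a product of two quasi-invariants of positive degrees with sum d+1 <= k+1 has order
    < d. So a relation expressing one generator through the others would contradict [wordG_indep]
    ([galg_minimal]).

    Counting: [in_SigmaP] identifies the index sets with the pairs (i, w) where w is empty or starts
    before i. *)

Lemma mpoly_ring_ind (K : comNzRingType) n (P : {mpoly K[n]} -> Prop) :
  (forall c, P c%:MP) -> (forall i, P 'X_i) ->
  (forall p q, P p -> P q -> P (p + q)) ->
  (forall p q, P p -> P q -> P (p * q)) -> forall p, P p.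
Proof.
move=> PC PX PD PM p; rewrite [p]mpolyE.
elim/big_ind: _ => [||m _]; [by rewrite -mpolyC0|exact: PD|].
rewrite -mul_mpolyC; apply: (PM _ _ (PC _)); rewrite mpolyXE_id.
elim/big_ind: _ => [||i _]; [by rewrite -mpolyC1|exact: PM|].
elim: (m i) => [|e IHe]; first by rewrite expr0 -mpolyC1.
by rewrite exprS; apply: PM.
Qed.

(* [jX i j] is the variable X_i^(j) if [j <= k], and [0] otherwise; the       *)
(* indices [i] are called letters, and the order of a polynomial is the       *)
(* largest [j] such that it involves some [jX i j].                           *)
Definition jet_dim L k := #|{: 'I_L.+1 * 'I_k.+1}|.
Notation jet K L k := {mpoly K[jet_dim L k]}.

Definition jvar L k (v : 'I_(jet_dim L k)) : 'I_L.+1 * 'I_k.+1 := enum_val v.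

HB.lock Definition jsub (K : numFieldType) L k (S : comNzRingType)
    (f : {rmorphism K -> S}) (F : 'I_L.+1 -> nat -> S) (p : jet K L k) : S :=
  mmap f (fun v => F (jvar v).1 (jvar v).2) p.

(** * Jet variables, their derivations and substitutions *)

Section Jets.
Variables (K : numFieldType) (L k : nat).

Local Notation jet := (jet K L k).

Definition jX (i : 'I_L.+1) (j : nat) : jet :=
  if (j <= k)%N then 'X_(enum_rank (i, inord j : 'I_k.+1)) else 0.

Definition jD (i : 'I_L.+1) (j : nat) (p : jet) : jet :=
  if (j <= k)%N then p^`M(enum_rank (i, inord j : 'I_k.+1)) else 0.

Lemma jX_big i j : (k < j)%N -> jX i j = 0.
Proof. by rewrite /jX ltnNge => /negPf ->. Qed.

Lemma jet_ind (P : jet -> Prop) :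
  (forall c, P c%:MP) -> (forall i j, (j <= k)%N -> P (jX i j)) ->
  (forall p q, P p -> P q -> P (p + q)) ->
  (forall p q, P p -> P q -> P (p * q)) -> forall p, P p.
Proof.
move=> PC PX; apply: mpoly_ring_ind => // v.
have jk : ((jvar v).2 <= k)%N by rewrite -ltnS ltn_ord.
have := PX (jvar v).1 _ jk.
by rewrite /jX jk inord_val -surjective_pairing enum_valK.
Qed.

Lemma jX_neq0 i j : (j <= k)%N -> jX i j != 0.
Proof.
move=> jk; rewrite /jX jk; apply/eqP => /(congr1 (mcoeff U_(enum_rank (i, inord j : 'I_k.+1)))).
by rewrite mcoeffX eqxx mcoeff0 => /eqP; rewrite oner_eq0.
Qed.

Lemma jD_is_linear i j : linear (jD i j).
Proof.
move=> a p q; rewrite /jD; case: ifP => _; first by rewrite mderivD mderivZ.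
by rewrite scaler0 addr0.
Qed.
HB.instance Definition _ i j :=
  GRing.isLinear.Build K jet jet _ (jD i j) (jD_is_linear i j).

Lemma jDM i j p q : jD i j (p * q) = jD i j p * q + p * jD i j q.
Proof. by rewrite /jD; case: ifP => _; rewrite ?mderivM // mul0r mulr0 addr0. Qed.

Lemma jDC i j c : jD i j c%:MP = 0.
Proof. by rewrite /jD mderivC if_same. Qed.

Lemma jDX i j i' j' : (j' <= k)%N ->
  jD i j (jX i' j') = ((i == i') && (j == j'))%:R.
Proof.
move=> j'k; rewrite /jD /jX j'k; case: ifPn => [jk|].
  rewrite mderivX mnm1E (inj_eq enum_rank_inj) xpair_eqE eq_sym.
  rewrite -[_ == inord j]val_eqE /= !inordK // [j' == _]eq_sym.
  case: (boolP (_ && _)) => [/andP[/eqP -> /eqP ->]|_]; last by rewrite scale0r.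
  rewrite scale1r -[RHS]mpolyX0; congr 'X_[_].
  by apply/mnmP => v; rewrite mnmBE subnn mnm0E.
by rewrite -ltnNge => kj; rewrite gtn_eqF ?andbF // (leq_ltn_trans j'k).
Qed.

Lemma jD_comm i j i' j' p : jD i j (jD i' j' p) = jD i' j' (jD i j p).
Proof. by rewrite /jD; do 2![case: ifP => // _]; rewrite ?mderiv0 // mderiv_comm. Qed.

Lemma jsub_zmod_morphism (S : comNzRingType) (f : {rmorphism K -> S}) F :
  zmod_morphism (@jsub K L k S f F).
Proof. by move=> p q; rewrite jsub.unlock mmapB. Qed.

Lemma jsub_monoid_morphism (S : comNzRingType) (f : {rmorphism K -> S}) F :
  monoid_morphism (@jsub K L k S f F).
Proof.
pose h (v : 'I_(jet_dim L k)) := F (jvar v).1 (jvar v).2.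
have [fM f1] := mmap_is_multiplicative h f.
by rewrite jsub.unlock; split => [|p q]; [exact: f1|exact: fM].
Qed.

HB.instance Definition _ (S : comNzRingType) (f : {rmorphism K -> S}) F :=
  GRing.isZmodMorphism.Build jet S (@jsub K L k S f F) (@jsub_zmod_morphism S f F).
HB.instance Definition _ (S : comNzRingType) (f : {rmorphism K -> S}) F :=
  GRing.isMonoidMorphism.Build jet S (@jsub K L k S f F) (@jsub_monoid_morphism S f F).

Lemma jsubC (S : comNzRingType) (f : {rmorphism K -> S}) F c :
  jsub f F (c%:MP : jet) = f c.
Proof. by rewrite jsub.unlock mmapC. Qed.

Lemma jsubX (S : comNzRingType) (f : {rmorphism K -> S}) F i j : (j <= k)%N ->
  jsub f F (jX i j) = F i j.
Proof.
by move=> jk; rewrite jsub.unlock /jX jk mmapX mmap1U /jvar enum_rankK /= inordK.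
Qed.

Lemma jet_hom_ext (S : pzRingType) (f g : {rmorphism jet -> S}) :
  (forall c, f c%:MP = g c%:MP) ->
  (forall i j, (j <= k)%N -> f (jX i j) = g (jX i j)) -> f =1 g.
Proof.
move=> fgC fgX; apply: jet_ind => // p q; first by rewrite !rmorphD => -> ->.
by rewrite !rmorphM => -> ->.
Qed.

(** A derivation along [f] is determined by its values on the variables. Taking for [f] a
    substitution and for [D] a partial derivative or the derivative by a parameter yields all the
    commutation rules below. *)
Lemma chain_rule (S : comNzRingType) (f : {rmorphism jet -> S}) (D : S -> S) :
  (forall x y, D (x + y) = D x + D y) ->
  (forall x y, D (x * y) = D x * y + x * D y) ->
  (forall c, D (f c%:MP) = 0) ->
  forall p, D (f p) = \sum_i \sum_(j < k.+1) f (jD i j p) * D (f (jX i j)).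
Proof.
move=> DD DM DC; apply: jet_ind => [c|i j jk|p q IHp IHq|p q IHp IHq].
- rewrite DC big1 // => i _; rewrite big1 // => j _.
  by rewrite jDC rmorph0 mul0r.
- rewrite (bigD1 i) //= (bigD1 (Ordinal (jk : j < k.+1)%N)) //=.
  rewrite jDX // !eqxx rmorph1 mul1r big1 => [|j']; last first.
    by rewrite jDX // -val_eqE => /= /negPf ->; rewrite andbF rmorph0 mul0r.
  rewrite addr0 big1 ?addr0 // => i' /negPf ii'; rewrite big1 // => j' _.
  by rewrite jDX // ii' rmorph0 mul0r.
- rewrite rmorphD DD IHp IHq -big_split; apply: eq_bigr => i _ /=.
  rewrite -big_split; apply: eq_bigr => j _ /=.
  by rewrite linearD rmorphD mulrDl.
- rewrite rmorphM DM IHp IHq mulr_suml mulr_sumr -big_split.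
  apply: eq_bigr => i _ /=; rewrite mulr_suml mulr_sumr -big_split.
  apply: eq_bigr => j _ /=; rewrite jDM rmorphD !rmorphM /= mulrDl.
  by congr (_ + _); [rewrite mulrAC|rewrite mulrA].
Qed.

End Jets.

(** Otherwise the difference would have the infinitely many roots 1, 2, 3, ... *)
Lemma poly_eq_nonzero (K : numFieldType) n (p q : {poly {mpoly K[n]}}) :
  (forall c : K, c != 0 -> p.[c%:MP] = q.[c%:MP]) -> p = q.
Proof.
move=> pq; apply/eqP; rewrite -subr_eq0; apply/negPn/negP => nz.
pose s := [seq (i.+1%:R : K)%:MP_[n] | i <- iota 0 (size (p - q))].
have s_root : all (root (p - q)) s.
  apply/allP => _ /mapP[i _ ->]; rewrite rootE hornerD hornerN pq ?subrr //.
  by rewrite pnatr_eq0.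
have s_uniq : uniq s.
  rewrite map_inj_uniq ?iota_uniq // => i j /eqP.
  by rewrite mpolyC_eq eqr_nat eqSS => /eqP.
have := max_poly_roots nz s_root s_uniq.
by rewrite size_map size_iota ltnn.
Qed.

Lemma ffactnD n a b : (n ^_ (a + b) = n ^_ a * (n - a) ^_ b)%N.
Proof.
elim: a n => [|a IHa] n; first by rewrite mul1n subn0.
case: n => [|n]; first by rewrite addSn !ffact0n.
by rewrite addSn !ffactSS subSS IHa mulnA.
Qed.

(** * Wronskians *)

Lemma derivation_det_eq0 (S : comNzRingType) (D : S -> S) n (A : 'M[S]_n) :
  (forall x y, D (x + y) = D x + D y) ->
  (forall x y, D (x * y) = D x * y + x * D y) ->
  (forall i j, D (A i j) = 0) -> D (\det A) = 0.
Proof.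
move=> DD DM DA.
have D0 : D 0 = 0 by apply: (addrI (D 0)); rewrite -DD !addr0.
have D1 : D 1 = 0.
  by apply: (addrI (D 1)); rewrite addr0 -[in RHS](mulr1 1) DM mulr1 mul1r.
have DN x : D (- x) = - D x.
  by apply: (addrI (D x)); rewrite -DD !subrr D0.
apply: (big_ind (fun x => D x = 0)) => [//|x y Dx Dy|s _].
  by rewrite DD Dx Dy addr0.
set p := \prod_(i < n) _; have Dp : D p = 0.
  apply: (big_ind (fun x => D x = 0)) => [//|x y Dx Dy|i _]; last exact: DA.
  by rewrite DM Dx Dy mul0r mulr0 addr0.
by rewrite mulr_sign; case: ifP; rewrite ?DN Dp ?oppr0.
Qed.

(** The falling factorial vanishes whenever the truncated subtraction cuts off, which replaces the
    case distinction of [wronsk_entry]. *)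
Definition jE (K : numFieldType) L k (c : 'I_L.+1 * nat) r : jet K L k :=
  (r ^_ c.2)%:R * jX K k c.1 (r - c.2).

Definition jMx (K : numFieldType) L k n (s : seq ('I_L.+1 * nat)) :
    'M[jet K L k]_n :=
  \matrix_(r, l) jE K k (nth (ord0, 0%N) s l) r.

HB.lock Definition jW (K : numFieldType) L k n (s : seq ('I_L.+1 * nat)) :
    jet K L k := \det (jMx K k n s).

Section Wronskian.
Variables (K : numFieldType) (L k : nat).
Local Notation jE := (@jE K L k).
Local Notation jMx := (@jMx K L k).
Local Notation jW := (@jW K L k).
Implicit Types (c : 'I_L.+1 * nat) (s : seq ('I_L.+1 * nat)).

(** The identity [ffactnD] lets the falling factorials of the column offsets commute with those of
    the substitution. Hence the substitution acts on every column by the same lower triangular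
    matrix [T], with [a 0] on the diagonal. *)
Lemma jW_transform (S : comNzRingType) (f g : {rmorphism jet K L k -> S})
    (a : nat -> S) n s :
  (n <= k.+1)%N -> size s = n ->
  (forall c, c \in s -> forall j, (j <= k)%N ->
     f (jX K k c.1 j) =
       \sum_(l < k.+1) (j ^_ l)%:R * a l * g (jX K k c.1 (j - l))) ->
  f (jW n s) = a 0%N ^+ n * g (jW n s).
Proof.
move=> nk ss fE; rewrite jW.unlock -!det_map_mx.
pose T : 'M[S]_n := \matrix_(r, r')
  if (r' <= r)%N then (r ^_ (r - r'))%:R * a (r - r')%N else 0.
have -> : a 0%N ^+ n = \det T.
  rewrite det_trig; last first.
    by apply/is_trig_mxP => r r' rr'; rewrite mxE leqNgt rr'.
  transitivity (\prod_(r < n) a 0%N); first by rewrite prodr_const card_ord.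
  apply: eq_bigr => r _.
  by rewrite mxE leqnn subnn mul1r.
rewrite -det_mulmx; congr (\det _); apply/matrixP => r l; rewrite !mxE.
set c := nth _ _ _.
have cs : c \in s by rewrite mem_nth ?ss.
have rk : (r <= k)%N by rewrite -ltnS (leq_trans (ltn_ord r)).
rewrite rmorphM rmorph_nat fE ?(leq_trans (leq_subr _ _)) // mulr_sumr.
transitivity (\sum_(r' < r.+1) (r ^_ (r - r'))%:R * a (r - r')%N * g (jE c r')).
  transitivity (\sum_(l < r.+1) (r ^_ l)%:R * a l * g (jE c (r - l))); last first.
    rewrite [RHS](reindex_inj rev_ord_inj); apply: eq_bigr => j _ /=.
    by rewrite subSS subKn // -ltnS.
  rewrite (big_ord_widen k.+1 (fun l => (r ^_ l)%:R * a l * g (jE c (r - l)))) ?ltnS //.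
  rewrite [RHS]big_mkcond; apply: eq_bigr => j _; case: ifPn => [jr|]; last first.
    rewrite -leqNgt => rj; rewrite [((r - c.2) ^_ j)%N]ffact_small ?mul0r ?mulr0 //.
    by rewrite (leq_ltn_trans (leq_subr _ _)).
  rewrite rmorphM rmorph_nat !mulrA -natrM.
  rewrite -[(r - j - c.2)%N]subnDA [(j + _)%N]addnC subnDA; congr (_ * _).
  rewrite -ffactnD addnC ffactnD natrM -!mulrA; congr (_ * _).
  by rewrite mulrC.
rewrite (big_ord_widen n (fun r' => (r ^_ (r - r'))%:R * a (r - r')%N * g (jE c r'))) //.
rewrite big_mkcond; apply: eq_bigr => r' _; rewrite !mxE ltnS.
by case: ifP => _; rewrite ?mul0r.
Qed.

Lemma jMx_minor n s1 c s2 (r : 'I_n.+1) (l : 'I_n.+1) : l = size s1 :> nat ->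
  row' r (col' l (jMx n.+1 (s1 ++ c :: s2))) =
  \matrix_(i < n, j < n) jE (nth (ord0, 0%N) (s1 ++ s2) j) (lift r i).
Proof.
move=> ls; apply/matrixP => i j; rewrite !mxE /=; congr (jE _ _).
rewrite !nth_cat /bump ls; case: (leqP (size s1) j) => sj /=.
  by rewrite add1n ltnNge leqW //= subSn.
by rewrite add0n sj.
Qed.

Lemma jW_expand_col n s1 c s2 (l : 'I_n.+1) : l = size s1 :> nat ->
  jW n.+1 (s1 ++ c :: s2) =
  \sum_(r < n.+1) jE c r * ((-1) ^+ (r + l) *
    \det (\matrix_(i < n, j < n) jE (nth (ord0, 0%N) (s1 ++ s2) j) (lift r i))).
Proof.
move=> ls; rewrite jW.unlock (expand_det_col _ l); apply: eq_bigr => r _.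
by rewrite /cofactor (jMx_minor _ _ _ ls) mxE nth_cat ls ltnn subnn.
Qed.

Lemma minor_last n s :
  \matrix_(i < n, j < n) jE (nth (ord0, 0%N) s j) (lift ord_max i) = jMx n s.
Proof. by apply/matrixP => i j; rewrite !mxE lift_max. Qed.

Lemma jD_nat i e m : jD i e (m%:R : jet K L k) = 0.
Proof. by rewrite -mpolyC_nat jDC. Qed.

Lemma jD_jE i e c r : (r <= k)%N ->
  jD i e (jE c r) =
  ((c.1 == i) && (r == e + c.2)%N)%:R * (r ^_ c.2)%:R.
Proof.
move=> rk; rewrite /jE jDM jD_nat mul0r add0r jDX; last first.
  by rewrite (leq_trans (leq_subr _ _)).
have [cr|rc] := leqP c.2 r.
  rewrite mulrC [i == _]eq_sym; congr ((nat_of_bool (_ && _))%:R * _).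
  by rewrite -{2}(subnK cr) eqn_add2r eq_sym.
by rewrite ffact_small // mul0r mulr0.
Qed.

(* Only the last row of the matrix contains variables of order [n]. *)
Lemma jD_jW_top n i s1 s2 : (n <= k)%N -> size (s1 ++ s2) = n ->
  (i, 0%N) \notin s1 ++ s2 ->
  jD i n (jW n.+1 (s1 ++ (i, 0%N) :: s2)) = (-1) ^+ (n + size s1) * jW n (s1 ++ s2).
Proof.
move=> nk sn nin.
have sl : (size s1 < n.+1)%N by rewrite ltnS -sn size_cat leq_addr.
pose cof (r : 'I_n.+1) := (-1) ^+ (r + size s1) * \det (\matrix_(a < n, b < n)
  jE (nth (ord0, 0%N) (s1 ++ s2) b) (lift r a)).
have cofD r : jD i n (cof r) = 0.
  rewrite /cof -signr_odd mulr_sign; set d := \det _.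
  have d0 : jD i n d = 0.
    apply: derivation_det_eq0 => [x y|x y|a b]; rewrite ?linearD ?jDM //= mxE.
    have rk : (lift r a <= k)%N by rewrite (leq_trans _ nk) // -ltnS ltn_ord.
    rewrite jD_jE //; case: eqP => [cE|_]; rewrite ?mul0r //=.
    have cs : nth (ord0, 0%N) (s1 ++ s2) b \in s1 ++ s2 by rewrite mem_nth ?sn.
    case: eqP => [rE|_]; rewrite ?mul0r //; case/negP: nin.
    suff <- : nth (ord0, 0%N) (s1 ++ s2) b = (i, 0%N) by [].
    rewrite [LHS]surjective_pairing cE; congr (_, _).
    have := ltn_ord (lift r a); rewrite /= rE; clear; lia.
  by case: ifP; rewrite ?linearN /= d0 ?oppr0.
have cofM : cof ord_max = (-1) ^+ (n + size s1) * jW n (s1 ++ s2).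
  by rewrite jW.unlock /cof minor_last.
rewrite (@jW_expand_col n s1 _ s2 (Ordinal sl)) // -cofM -/(cof _).
under eq_bigr => r _ do rewrite -/(cof r).
clearbody cof; rewrite linear_sum (bigD1 ord_max) //= big1 ?addr0 => [|r rmax].
  by rewrite jDM cofD jD_jE //= eqxx addn0 eqxx ffactn0 !mul1r mulr0 addr0.
have rn : (r <= n)%N by rewrite -ltnS.
rewrite -val_eqE /= in rmax.
rewrite jDM cofD mulr0 addr0 jD_jE ?(leq_trans rn) //= addn0.
by rewrite (negPf rmax) andbF !mul0r.
Qed.

Lemma jD_jW_eq0 n i e s : (n <= k.+1)%N -> size s = n ->
  (forall r c, (r < n)%N -> c \in s -> c.1 = i -> (r != e + c.2)%N) ->
  jD i e (jW n s) = 0.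
Proof.
move=> nk sn ne; rewrite jW.unlock; apply: derivation_det_eq0 => [x y|x y|a b].
- by rewrite linearD.
- by rewrite jDM.
rewrite mxE jD_jE; last by rewrite -ltnS (leq_trans (ltn_ord a)).
case: eqP => [cE|_]; rewrite ?mul0r //=.
by rewrite (negPf (ne _ _ (ltn_ord a) _ cE)) ?mul0r // mem_nth ?sn.
Qed.

Lemma jD_jW_order n i e s : (n <= k.+1)%N -> size s = n -> (n <= e)%N ->
  jD i e (jW n s) = 0.
Proof.
move=> nk sn ne; apply: jD_jW_eq0 => // r c rn _ _.
by rewrite ltn_eqF // (leq_trans rn) // (leq_trans ne) ?leq_addr.
Qed.

Lemma jD_jW_top0 n i s : (n <= k)%N -> size s = n.+1 -> (i, 0%N) \notin s ->
  jD i n (jW n.+1 s) = 0.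
Proof.
move=> nk sn i0s; apply: jD_jW_eq0 => // r c rn cs ci.
apply: contra i0s => /eqP rE; suff <- : c = (i, 0%N) by [].
by rewrite [LHS]surjective_pairing ci; congr (_, _); move: rn; rewrite rE; lia.
Qed.

(* A letter occurring in a single column enters the determinant linearly. *)
Lemma jD_jW_head n x b e s : (n <= k)%N -> size s = n ->
  (forall c, c \in s -> c.1 != x) ->
  jD x e (jW n.+1 ((x, b) :: s)) =
  if insub (e + b)%N is Some r then ((r : 'I_n.+1) ^_ b)%:R * ((-1) ^+ r *
    \det (\matrix_(i < n, j < n) jE (nth (ord0, 0%N) s j) (lift r i))) else 0.
Proof.
move=> nk sn sx.
pose cof (r : 'I_n.+1) := (-1) ^+ r * \det (\matrix_(i < n, j < n)
  jE (nth (ord0, 0%N) s j) (lift r i)).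
have cofD r : jD x e (cof r) = 0.
  rewrite /cof -signr_odd mulr_sign; set d := \det _.
  have d0 : jD x e d = 0.
    apply: derivation_det_eq0 => [y z|y z|i j]; rewrite ?linearD ?jDM //= mxE.
    have rk : (lift r i <= k)%N by rewrite (leq_trans _ nk) // -ltnS ltn_ord.
    by rewrite jD_jE // (negPf (sx _ _)) ?mul0r // mem_nth ?sn.
  by case: ifP; rewrite ?linearN /= d0 ?oppr0.
rewrite (@jW_expand_col n [::] _ s ord0) //.
under eq_bigr => r _ do rewrite addn0 -/(cof r).
transitivity (if insub (e + b)%N is Some r then ((r : 'I_n.+1) ^_ b)%:R * cof r
  else 0); last by [].
clearbody cof; rewrite linear_sum /=.
have E (r : 'I_n.+1) : jD x e (jE (x, b) r * cof r) =
    (nat_of_ord r == e + b)%N%:R * ((r ^_ b)%:R * cof r).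
  rewrite jDM cofD mulr0 addr0 jD_jE /= ?eqxx ?mulrA //.
  by rewrite (leq_trans _ nk) // -ltnS.
under eq_bigr do rewrite E.
case: insubP => [r _ rE|nlt].
  rewrite (bigD1 r) //= rE eqxx mul1r big1 ?addr0 // => r' r'r.
  by rewrite -rE val_eqE (negPf r'r) mul0r.
rewrite big1 // => r _; case: eqP => [rE|_]; rewrite ?mul0r //.
by rewrite -rE ltn_ord in nlt.
Qed.

Lemma jE_row0 c : jE c 0 = (c.2 == 0%N)%:R * jX K k c.1 0.
Proof. by rewrite /jE ffact0n sub0n. Qed.

(** Only the column [(J, 0)] has a nonzero entry in row 0. In the remaining minor, (r+1)^_(b+1) =
    (r+1) r^_b, so row r yields a factor r+1 and leaves the Wronskian of the unshifted columns. *)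
Lemma jW_row0 n J s1 s2 : size (s1 ++ s2) = n ->
  jW n.+1 (map (fun c => (c.1, c.2.+1)) s1 ++ (J, 0%N) ::
           map (fun c => (c.1, c.2.+1)) s2) =
  (-1) ^+ size s1 * n`!%:R * (jX K k J 0 * jW n (s1 ++ s2)).
Proof.
move=> sn; set f := fun c : _ => _; set s := _ ++ _.
have sl : (size s1 < n.+1)%N by rewrite ltnS -sn size_cat leq_addr.
have ls : Ordinal sl = size (map f s1) :> nat by rewrite size_map.
rewrite jW.unlock (expand_det_row _ ord0) (bigD1 (Ordinal sl)) //= big1 ?addr0 => [|l ll].
  rewrite mxE jE_row0 /s nth_cat size_map ltnn subnn eqxx mul1r.
  rewrite /cofactor (jMx_minor _ _ _ ls) /= add0n.
  have -> : \matrix_(i < n, j < n)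
      jE (nth (ord0, 0%N) (map f s1 ++ map f s2) j) (lift ord0 i) =
      diag_mx (\row_(i < n) i.+1%:R) *m jMx n (s1 ++ s2).
    apply/matrixP => i j; rewrite mul_diag_mx !mxE -map_cat.
    rewrite (nth_map (ord0, 0%N)) ?sn // /jE /= /bump add1n ffactSS subSS.
    by rewrite natrM mulrA.
  rewrite det_mulmx det_diag; under eq_bigr do rewrite mxE.
  have -> : n`! = (\prod_(i < n) i.+1)%N by rewrite fact_prod big_add1 big_mkord.
  by rewrite natr_prod mulrCA -!mulrA; congr (_ * _); rewrite mulrCA.
rewrite mxE jE_row0; set c := nth _ _ _.
suff /negPf -> : c.2 != 0%N by rewrite !mul0r.
rewrite /c /s nth_cat size_map; case: ltnP => l1.
  by rewrite (nth_map (ord0, 0%N)).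
have {l1} : (size s1 < l)%N by rewrite ltn_neqAle l1 andbT eq_sym.
rewrite -subn_gt0; case lE : (l - size s1)%N => [|m] //= _.
rewrite (nth_map (ord0, 0%N)) //.
move: sn (ltn_ord l); rewrite size_cat; lia.
Qed.

Lemma jW_row0_eq0 n s : size s = n.+1 -> (forall c, c \in s -> c.2 != 0%N) ->
  jW n.+1 s = 0.
Proof.
move=> sn s0; rewrite jW.unlock (expand_det_row _ ord0) big1 // => l _.
by rewrite mxE jE_row0 (negPf (s0 _ _)) ?mul0r // mem_nth ?sn.
Qed.

End Wronskian.

(** * The action of the units *)

Section Actions.
Variables (K : numFieldType) (L k : nat).
Local Notation J := (jet K L k).
Local Notation X := (@jX K L k).
Local Notation C := (@mpolyC (jet_dim L k) K).
Implicit Types (p q : J) (P : {poly K}) (A : pred 'I_L.+1) (i : 'I_L.+1).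

(** Since J f_j = j f_(j-1), the power J^l sends f_j to j^_l f_(j-l): this is the action of P(J). *)
Definition jact P : J -> J :=
  jsub C (fun i j => \sum_(l < k.+1) (j ^_ l)%:R * (P`_l)%:MP * X i (j - l)).
HB.instance Definition _ P := GRing.RMorphism.on (jact P).

Definition jinv d p := forall P, P.[0] != 0 -> jact P p = P.[0] ^+ d *: p.

(** The letters in [A] undergo J itself: not a unit, but it commutes with the action. *)
Definition jshift A : J -> J :=
  jsub C (fun i j => if A i then j%:R * X i j.-1 else X i j).
HB.instance Definition _ A := GRing.RMorphism.on (jshift A).

Definition jpoly (F : 'I_L.+1 -> nat -> {poly J}) : J -> {poly J} :=
  jsub (polyC \o C) F.
HB.instance Definition _ F := GRing.RMorphism.on (jpoly F).

(** The letters in [A] undergo 1 + t J, where t is the polynomial variable. *)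
Definition jtheta A := jpoly (fun i j =>
  (X i j)%:P + 'X * ((A i)%:R * (j%:R * X i j.-1))%:P).
HB.instance Definition _ A := GRing.RMorphism.on (jtheta A).

Lemma jactC P c : jact P c%:MP = c%:MP. Proof. exact: jsubC. Qed.
Lemma jshiftC A c : jshift A c%:MP = c%:MP. Proof. exact: jsubC. Qed.
Lemma jpolyC F c : jpoly F c%:MP = c%:MP%:P. Proof. exact: jsubC. Qed.
Lemma jthetaC A c : jtheta A c%:MP = c%:MP%:P. Proof. exact: jsubC. Qed.

Lemma jactZ P c p : jact P (c *: p) = c *: jact P p.
Proof. by rewrite -!mul_mpolyC rmorphM /= jactC. Qed.
Lemma jshiftZ A c p : jshift A (c *: p) = c *: jshift A p.
Proof. by rewrite -!mul_mpolyC rmorphM /= jshiftC. Qed.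

Lemma jactX P i j : (j <= k)%N ->
  jact P (X i j) = \sum_(l < k.+1) (j ^_ l)%:R * (P`_l)%:MP * X i (j - l).
Proof. exact: jsubX. Qed.
Lemma jshiftX A i j : (j <= k)%N ->
  jshift A (X i j) = if A i then j%:R * X i j.-1 else X i j.
Proof. exact: jsubX. Qed.
Lemma jthetaX A i j : (j <= k)%N ->
  jtheta A (X i j) = (X i j)%:P + 'X * ((A i)%:R * (j%:R * X i j.-1))%:P.
Proof. exact: jsubX. Qed.

Lemma jactX0 P i : jact P (X i 0) = P.[0] *: X i 0.
Proof.
rewrite jactX // big_ord_recl big1 ?addr0 => [|l _]; last first.
  by rewrite ffact0n mul0r mul0r.
by rewrite ffactn0 mul1r horner_coef0 mul_mpolyC.
Qed.

Lemma jinvD d p q : jinv d p -> jinv d q -> jinv d (p + q).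
Proof. by move=> Hp Hq P P0; rewrite rmorphD /= Hp // Hq // scalerDr. Qed.
Lemma jinvZ d c p : jinv d p -> jinv d (c *: p).
Proof. by move=> Hp P P0; rewrite jactZ Hp // !scalerA mulrC. Qed.
Lemma jinv0 d : jinv d 0.
Proof. by move=> P P0; rewrite rmorph0 scaler0. Qed.
Lemma jinvB d p q : jinv d p -> jinv d q -> jinv d (p - q).
Proof. by move=> Hp Hq; rewrite -scaleN1r; apply/jinvD/jinvZ. Qed.
Lemma jinvM d e p q : jinv d p -> jinv e q -> jinv (d + e) (p * q).
Proof.
move=> Hp Hq P P0; rewrite rmorphM /= Hp // Hq // -scalerAl -scalerAr scalerA.
by rewrite exprD.
Qed.
Lemma jinvC c : jinv 0 c%:MP.
Proof. by move=> P P0; rewrite jactC expr0 scale1r. Qed.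

Lemma jW_inv n s : (n <= k.+1)%N -> size s = n -> jinv n (jW K k n s).
Proof.
move=> nk sn P P0; rewrite (@jW_transform K L k J (jact P) idfun (fun l => (P`_l)%:MP)) //.
  by rewrite horner_coef0 -rmorphXn mul_mpolyC.
by move=> c _ j jk; rewrite [LHS]jactX.
Qed.

Lemma jshift_jW A n s : (n <= k.+1)%N -> size s = n ->
  jshift A (jW K k n s) = jW K k n [seq (c.1, (c.2 + A c.1)%N) | c <- s].
Proof.
move=> nk sn; rewrite !jW.unlock -det_map_mx; congr (\det _).
apply/matrixP => r l; rewrite !mxE (nth_map (ord0, 0%N)) ?sn // /jE /=.
set c := nth _ _ _; have rk : (r <= k)%N by rewrite -ltnS (leq_trans (ltn_ord r)).
rewrite rmorphM rmorph_nat /= jshiftX ?(leq_trans (leq_subr _ _)) //.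
case: (A c.1); rewrite ?addn0 // addn1 mulrA -natrM -ffactnSr.
by rewrite -subn1 -subnDA addn1.
Qed.

Lemma jact_jshift P A p : jact P (jshift A p) = jshift A (jact P p).
Proof.
move: p; apply: jet_ind => [c|i j jk|p q Hp Hq|p q Hp Hq].
- by rewrite !jshiftC jactC jshiftC.
- rewrite (jshiftX A i jk) (jactX P i jk) rmorph_sum /=.
  case Ai: (A i); last first.
    rewrite jactX //; apply: eq_bigr => l _.
    rewrite !rmorphM rmorph_nat /= jshiftC jshiftX ?Ai //.
    by rewrite (leq_trans (leq_subr _ _)).
  rewrite rmorphM rmorph_nat /= jactX; last by rewrite (leq_trans (leq_pred _)).
  rewrite mulr_sumr; apply: eq_bigr => l _.
  rewrite !rmorphM rmorph_nat /= jshiftC jshiftX ?Ai; last first.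
    by rewrite (leq_trans (leq_subr _ _)).
  have E : (j * j.-1 ^_ l = j ^_ l * (j - l))%N by rewrite -ffactnS ffactnSr.
  have -> : (j.-1 - l = (j - l).-1)%N by clear; lia.
  transitivity ((j * j.-1 ^_ l)%:R * C P`_l * X i (j - l).-1).
    by rewrite natrM -!mulrA.
  by rewrite E natrM -!mulrA; congr (_ * _); rewrite mulrCA.
- by rewrite !rmorphD /= Hp Hq.
- by rewrite !rmorphM /= Hp Hq.
Qed.

Lemma jinv_shift d A p : jinv d p -> jinv d (jshift A p).
Proof. by move=> Hp P P0; rewrite jact_jshift Hp // jshiftZ. Qed.

(* One-parameter families of units of [C[J]] act by polynomial maps in the    *)
(* parameter; an identity at all nonzero parameters is an identity of         *)
(* polynomials.                                                               *)
Lemma jpoly_act F (Pc : K -> {poly K}) p (q : {poly J}) :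
  (forall c, c != 0 -> forall i j, (j <= k)%N ->
     (F i j).[C c] = \sum_(l < k.+1) (j ^_ l)%:R * ((Pc c)`_l)%:MP * X i (j - l)) ->
  (forall c, c != 0 -> jact (Pc c) p = q.[C c]) -> jpoly F p = q.
Proof.
move=> FE pE; apply: poly_eq_nonzero => c c0; rewrite -pE //.
pose f := horner_eval (C c) \o jpoly F.
rewrite -[LHS]/(f p); apply: jet_hom_ext => [a|i j jk].
  by rewrite /= jpolyC /horner_eval hornerC jactC.
by rewrite /= /jpoly jsubX // /horner_eval FE // jactX.
Qed.

Lemma sum_coef_CXn i j (a b : K) e : (j <= k)%N -> (0 < e <= k)%N ->
  \sum_(l < k.+1) (j ^_ l)%:R * ((a%:P + b *: 'X^e)`_l)%:MP * X i (j - l) =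
  a *: X i j + b *: ((j ^_ e)%:R * X i (j - e)).
Proof.
move=> jk /andP[e0 ek]; set P := _ + _.
have P0 : P`_0 = a.
  by rewrite coefD coefC coefZ coefXn eqxx (ltn_eqF e0) mulr0 addr0.
have Pe : P`_e = b.
  by rewrite coefD coefC coefZ coefXn eqxx (gtn_eqF e0) mulr1 add0r.
have Pl l : l != 0%N -> l != e -> P`_l = 0.
  by move=> l0 le; rewrite coefD coefC coefZ coefXn (negPf l0) (negPf le) mulr0 addr0.
clearbody P; rewrite (bigD1 ord0) //= (bigD1 (Ordinal (ek : e < k.+1)%N)) /=.
  rewrite P0 Pe subn0 ffactn0 mul1r mul_mpolyC big1 ?addr0 => [|l /andP[l0 le]].
    by rewrite [_ * C _]mulrC -mulrA mul_mpolyC.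
  by rewrite Pl ?mulr0 ?mul0r.
by rewrite -val_eqE /= -lt0n.
Qed.

Lemma horner0_CXn (a b : K) e : (0 < e)%N -> (a%:P + b *: 'X^e).[0] = a.
Proof. by move=> e0; rewrite hornerD hornerZ hornerC hornerXn expr0n gtn_eqF // mulr0 addr0. Qed.

Lemma jinv_theta d p : jinv d p -> jtheta predT p = p%:P.
Proof.
move=> Hp; apply: (jpoly_act (Pc := fun c => 1%:P + c *: 'X^1)).
  (* For k = 0 the exponent 1 exceeds k, outside the range of [sum_coef_CXn]; then all variables
     have order 0 and J acts by 0. *)
  move=> c _ i j jk; have [k0|k0] := posnP k.
    have /eqP j0 : j == 0%N by rewrite -leqn0 -k0.
    rewrite j0 mul0r mulr0 mulr0 addr0 hornerC.
    rewrite big_ord_recl big1 ?addr0 => [|l _]; last by rewrite ffact0n mul0r mul0r.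
    by rewrite ffactn0 mul1r coefD coefC coefZ coefXn mulr0 addr0 mul1r.
  rewrite sum_coef_CXn // scale1r hornerD hornerM hornerX !hornerC mul1r.
  by rewrite ffactn1 subn1 mul_mpolyC.
move=> c c0; rewrite Hp horner0_CXn ?oner_eq0 //.
by rewrite expr1n scale1r hornerC.
Qed.

Lemma jinv_eps d p : jinv d p ->
  jpoly (fun i j => 'X * (X i j)%:P + (j%:R * X i j.-1)%:P) p = p%:P * 'X^d.
Proof.
move=> Hp; apply: (jpoly_act (Pc := fun c => c%:P + 1 *: 'X^1)).
  move=> c _ i j jk; have [k0|k0] := posnP k.
    have /eqP j0 : j == 0%N by rewrite -leqn0 -k0.
    rewrite j0 mul0r addr0 hornerM hornerX hornerC.
    rewrite big_ord_recl big1 ?addr0 => [|l _]; last by rewrite ffact0n mul0r mul0r.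
    by rewrite ffactn0 mul1r coefD coefC coefZ coefXn mulr0 addr0.
  rewrite sum_coef_CXn // scale1r hornerD hornerM hornerX !hornerC.
  by rewrite ffactn1 subn1 mul_mpolyC.
move=> c c0; rewrite Hp horner0_CXn //.
by rewrite hornerM hornerC hornerXn mulrC -rmorphXn mul_mpolyC.
Qed.

(** Constant units act by dilations: this is homogeneity of degree [d]. *)
Lemma jinv_scale d p : jinv d p -> jpoly (fun i j => 'X * (X i j)%:P) p = p%:P * 'X^d.
Proof.
move=> Hp; apply: (jpoly_act (Pc := fun c => c%:P)) => [c _ i j jk|c c0].
  rewrite hornerM hornerX hornerC.
  rewrite big_ord_recl big1 ?addr0 => [|l _]; last by rewrite coefC mulr0 mul0r.
  by rewrite ffactn0 mul1r coefC subn0.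
by rewrite Hp hornerC // hornerM hornerC hornerXn mulrC -rmorphXn mul_mpolyC.
Qed.

Lemma jinv0_const p : jinv 0 p -> exists c, p = c%:MP.
Proof.
move=> /jinv_scale; rewrite expr0 mulr1 => E.
have: exists c, (jpoly (fun i j => 'X * (X i j)%:P) p).[0] = c%:MP.
  move: p {E}; apply: jet_ind => [c|i j jk|p q [a pa] [b qb]|p q [a pa] [b qb]].
  - by exists c; rewrite jpolyC hornerC.
  - by exists 0; rewrite /jpoly jsubX // hornerM hornerX mul0r mpolyC0.
  - by exists (a + b); rewrite rmorphD hornerD /= pa qb mpolyCD.
  - by exists (a * b); rewrite rmorphM hornerM /= pa qb mpolyCM.
by rewrite E hornerC.
Qed.

(* Letting [eps] tend to [0] in the action of [eps + J]: a quasi-invariant of *)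
(* positive degree vanishes where all the variables of order 0 do.            *)
Lemma jinv_shift_all d p : (0 < d)%N -> jinv d p -> jshift predT p = 0.
Proof.
move=> d0 /jinv_eps E.
transitivity (p%:P * 'X^d).[0]; last first.
  by rewrite hornerM hornerXn expr0n gtn_eqF // mulr0.
rewrite -E -[RHS]/((horner_eval 0 \o jpoly _) p); apply: jet_hom_ext => [c|i j jk].
  by rewrite /= jpolyC /horner_eval hornerC jshiftC.
rewrite /= jshiftX // /jpoly jsubX // /horner_eval.
by rewrite hornerD hornerM hornerX mul0r add0r hornerC.
Qed.

(** Differentiate the invariance under 1 + t J^e at t = 0. The terms with j < e vanish by the
    falling factorial, those with j > e by the bound on the order, and e! times the stated sum
    remains. *)
Lemma jinv_syzygy d p e : (0 < e <= k)%N -> jinv d p ->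
  (forall i j, (e < j)%N -> jD i j p = 0) -> \sum_i jD i e p * X i 0 = 0.
Proof.
move=> /[dup] e0k /andP[e0 ek] Hp pe.
pose F i j := (X i j)%:P + 'X * ((j ^_ e)%:R * X i (j - e))%:P.
have Fp : jpoly F p = p%:P.
  apply: (jpoly_act (Pc := fun c => 1%:P + c *: 'X^e)) => [c _ i j jk|c c0].
    by rewrite sum_coef_CXn // scale1r /F hornerD hornerM hornerX !hornerC mul_mpolyC.
  by rewrite Hp horner0_CXn ?oner_eq0 // expr1n scale1r hornerC.
have F0 q : (jpoly F q).[0] = q.
  rewrite -[LHS]/((horner_eval 0 \o jpoly F) q) -[RHS]/(idfun q).
  apply: jet_hom_ext => [c|i j jk] /=; first by rewrite jpolyC /horner_eval hornerC.
  by rewrite /jpoly jsubX // /F /horner_eval hornerD hornerM hornerX mul0r addr0 hornerC.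
have DC c : (jpoly F c%:MP)^`() = 0 by rewrite jpolyC derivC.
have := chain_rule (@derivD _) (@derivM _) DC p.
rewrite /= Fp derivC => /(congr1 (fun q : {poly J} => q.[0])).
rewrite horner0 horner_sum => /esym E.
have Ei i : (\sum_(j < k.+1) jpoly F (jD i j p) * (jpoly F (X i j))^`()).[0] =
    e`!%:R * (jD i e p * X i 0).
  rewrite horner_sum (bigD1 (Ordinal (ek : e < k.+1)%N)) //= big1 ?addr0 => [|j je].
    rewrite /jpoly jsubX // -/(jpoly F) /F hornerM F0 derivD derivM !derivC derivX.
    by rewrite mulr0 addr0 mul1r add0r hornerC ffactnn subnn mulrCA.
  have jk : (j <= k)%N by rewrite -ltnS.
  rewrite hornerM F0; case: (ltngtP j e) => [lt|gt|eq].
  - rewrite /jpoly jsubX // /F derivD derivM !derivC derivX mulr0 addr0 mul1r add0r.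
    by rewrite ffact_small // mul0r hornerC mulr0.
  - by rewrite pe // mul0r.
  - by rewrite -val_eqE /= eq eqxx in je.
apply: (mulfI (_ : (e`!%:R : J) != 0)).
  by rewrite -mpolyC_nat mpolyC_eq0 pnatr_eq0 -lt0n fact_gt0.
by rewrite mulr0 mulr_sumr -[RHS]E; apply: eq_bigr => i _; rewrite Ei.
Qed.

End Actions.

(** * Linear spans *)

Inductive lspan (K : pzRingType) (V : lmodType K) (P : V -> Prop) : V -> Prop :=
| lspan0 : lspan P 0
| lspanS a x y : P x -> lspan P y -> lspan P (a *: x + y).

Section Span.
Variables (K : pzRingType) (V : lmodType K).
Implicit Types (P Q : V -> Prop) (x y : V).

Lemma lspan_in P x : P x -> lspan P x.
Proof. by move=> Px; rewrite -[x]scale1r -[_ *: x]addr0; apply: lspanS => //; apply: lspan0. Qed.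

Lemma lspanD P x y : lspan P x -> lspan P y -> lspan P (x + y).
Proof.
by move=> + sy; elim=> [|a z t Pz _ IH]; rewrite ?add0r // -addrA; apply: lspanS.
Qed.

Lemma lspanZ P a x : lspan P x -> lspan P (a *: x).
Proof.
elim=> [|b z t Pz _ IH]; first by rewrite scaler0; apply: lspan0.
by rewrite scalerDr scalerA; apply: lspanS.
Qed.

Lemma lspan_trans P Q x : (forall y, P y -> lspan Q y) -> lspan P x -> lspan Q x.
Proof.
move=> PQ; elim=> [|a z t Pz _ IH]; first exact: lspan0.
by apply/lspanD/IH/lspanZ/PQ.
Qed.

Lemma lspan_closed P (C : V -> Prop) x : C 0 ->
  (forall a y z, C y -> C z -> C (a *: y + z)) -> (forall y, P y -> C y) ->
  lspan P x -> C x.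
Proof. by move=> C0 CL PC; elim=> // a z t Pz _ IH; apply: CL => //; apply: PC. Qed.

End Span.

(** * Shifting the first letters, and derivatives of top order *)

Section Shifts.
Variables (K : numFieldType) (L k : nat).
Local Notation J := (jet K L k).
Local Notation X := (@jX K L k).
Local Notation C := (@mpolyC (jet_dim L k) K).
Implicit Types (p q : J) (P : {poly K}) (i : 'I_L.+1).

Definition jshift_lt (m : nat) : J -> J := jshift (fun i => (i < m)%N).
HB.instance Definition _ m := GRing.RMorphism.on (jshift_lt m).

Lemma jshift_lt0 p : jshift_lt 0 p = p.
Proof.
rewrite -[RHS]/(idfun p); apply: jet_hom_ext => [c|i j jk] /=.
  exact: jshiftC.
by rewrite /jshift_lt jshiftX.
Qed.

Lemma jshift_lt_max p : jshift_lt L.+1 p = jshift predT p.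
Proof.
apply: jet_hom_ext => [c|i j jk] /=; first by rewrite /jshift_lt !jshiftC.
by rewrite /jshift_lt !jshiftX // ltn_ord.
Qed.

Lemma jshift_ltS i p : jshift_lt i.+1 p = jshift (pred1 i) (jshift_lt i p).
Proof.
rewrite -[RHS]/((jshift (pred1 i) \o jshift_lt i) p); apply: jet_hom_ext => [c|i' j jk] /=.
  by rewrite /jshift_lt !jshiftC.
rewrite /jshift_lt !jshiftX // ltnS.
case: (ltngtP i' i) => [lt|gt|eq] /=.
- by rewrite rmorphM rmorph_nat /= jshiftX ?(leq_trans (leq_pred _)) //= -val_eqE /= ltn_eqF.
- by rewrite jshiftX //= -val_eqE /= gtn_eqF.
- by rewrite (val_inj eq) jshiftX //= eqxx.
Qed.

(** The substitution [U] undoes the shift except that X_i^(0) is lost: the composite [Z] sets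
    X_i^(0) to 0. As p is congruent to [Z p] modulo X_i^(0), the kernel consists of multiples of
    this variable. *)
Lemma jshift1_kernel i p : jshift (pred1 i) p = 0 -> exists q, p = X i 0 * q.
Proof.
pose Z := @jsub K L k J C (fun i' j => if (i' == i) && (j == 0%N) then 0 else X i' j).
pose U := @jsub K L k J C (fun i' j => if i' == i then C (j.+1%:R)^-1 * X i j.+1 else X i' j).
have UZ : U \o jshift (pred1 i) =1 Z.
  apply: jet_hom_ext => [c|i' j jk] /=; first by rewrite jshiftC /U /Z !jsubC.
  rewrite jshiftX // /Z jsubX //=; case: (eqVneq i' i) => [->|ii'] /=; last first.
    by rewrite /U jsubX // (negPf ii').
  rewrite rmorphM rmorph_nat; case: j jk => [|j] jk; first by rewrite mul0r.
  rewrite /= /U jsubX ?(ltnW jk) //= eqxx mulrA -mpolyC_nat -mpolyCM divff ?mul1r //.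
  by rewrite pnatr_eq0.
move=> p0; have Zp : Z p = 0 by rewrite -UZ /= p0 /U rmorph0.
have: exists q, p = Z p + X i 0 * q.
  move: p {p0 Zp}; apply: jet_ind => [c|i' j jk|p q [a pa] [b qb]|p q [a pa] [b qb]].
  - by exists 0; rewrite /Z jsubC mulr0 addr0.
  - rewrite /Z jsubX //; case: andP => [[/eqP -> /eqP ->]|_].
      by exists 1; rewrite mulr1 add0r.
    by exists 0; rewrite mulr0 addr0.
  - by exists (a + b); rewrite /Z rmorphD -/Z /= {1}pa {1}qb mulrDr addrACA.
  - exists (Z p * b + a * q); rewrite /Z rmorphM -/Z /= {1}pa mulrDl {1}qb !mulrDr.
    by rewrite [Z p * (_ * _)]mulrCA !mulrA addrA.
by rewrite Zp => -[q ->]; exists q; rewrite add0r.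
Qed.

(** The shifted polynomial has degree d+1 as a quasi-invariant and X_i^(0) is scaled by P(0), so one
    factor P(0) cancels. *)
Lemma jinv_shift_quotient d i q : jinv d.+1 q -> jshift_lt i.+1 q = 0 ->
  exists2 q', jshift_lt i q = X i 0 * q' & jinv d q'.
Proof.
move=> Hq; rewrite jshift_ltS => /jshift1_kernel[q' qE]; exists q' => // P P0.
have := jinv_shift (fun j : 'I_L.+1 => (j < i)%N) Hq P0.
rewrite -/(jshift_lt i q) qE rmorphM /= jactX0 exprS -scalerA -!scalerAl.
move/(scalerI P0); rewrite scalerAr; apply/mulfI.
exact: jX_neq0.
Qed.

(** The action does not raise orders. Within order at most e, the variable X_i^(e) occurs only in
    the image of X_i^(e), with coefficient P(0); the derivative therefore loses exactly one factor
    P(0). *)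
Lemma jinv_top_deriv d e i p : (e <= k)%N -> jinv d.+1 p ->
  (forall i' j, (e < j)%N -> jD i' j p = 0) -> jinv d (jD i e p).
Proof.
move=> ek Hp pe P P0; apply: (scalerI P0); rewrite scalerA -exprS.
have DC c : jD i e (jact P (C c)) = 0 by rewrite jactC jDC.
have := chain_rule (raddfD (jD i e)) (@jDM K L k i e) DC p.
rewrite /= Hp // linearZ /= => ->.
have E i' j : (j <= k)%N -> (j <= e)%N ->
    jD i e (jact P (X i' j)) = C P.[0] * ((i == i') && (e == j))%:R.
  move=> jk je; rewrite jactX // linear_sum (bigD1 ord0) //= big1 ?addr0 => [|l l0].
    rewrite ffactn0 mul1r subn0 !jDM !jDC mul0r add0r jDX // horner_coef0 //.
  rewrite !jDM jD_nat jDC mul0r mulr0 addr0 mul0r add0r jDX; last first.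
    by rewrite (leq_trans (leq_subr _ _)).
  have [lj|jl] := leqP l j; last by rewrite ffact_small // !mul0r.
  rewrite (_ : (e == _) = false) ?andbF ?mulr0 //; apply/negbTE.
  by rewrite -val_eqE /= in l0; move: l0 lj je; clear; lia.
rewrite (bigD1 i) //= [X in _ + X]big1 ?addr0 => [|i' ii'].
  rewrite (bigD1 (Ordinal (ek : e < k.+1)%N)) //= [X in _ + X]big1 ?addr0 => [|j je].
    by rewrite E // !eqxx mulr1 mulrC mul_mpolyC.
  have jk : (j <= k)%N by rewrite -ltnS.
  case: (ltngtP j e) => [lt|gt|eq].
  - by rewrite E ?(ltnW lt) // gtn_eqF // andbF mulr0 mulr0.
  - by rewrite pe // rmorph0 mul0r.
  - by rewrite -val_eqE /= eq eqxx in je.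
rewrite big1 // => j _; have jk : (j <= k)%N by rewrite -ltnS.
have [je|ej] := leqP j e; last by rewrite pe // rmorph0 mul0r.
by rewrite E // eq_sym (negPf ii') mulr0 mulr0.
Qed.

End Shifts.

(** * Wronskians indexed by words *)

Section Words.
Variable L : nat.
Implicit Types (a : 'I_L.+1 -> seq nat) (i J : 'I_L.+1) (w : seq 'I_L.+1).

(** Made so that shifting the letters before [J] raises every offset of [a] by one and leaves
    [(J, 0)] as the only column of offset 0, which is the shape that [jW_row0] expands. *)
Definition lift_block J a : 'I_L.+1 -> seq nat := fun i =>
  if (i < J)%N then a i
  else if i == J then 0%N :: map succn (a i) else map succn (a i).

Definition ins_block J a : 'I_L.+1 -> seq nat := fun i =>
  if i == J then 0%N :: a i else a i.

Definition word_block w : 'I_L.+1 -> seq nat :=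
  foldr lift_block (fun=> [::]) w.

(* The first letter of [w] is the last block of [word_block w] containing 0. *)
Definition gt_head i w := if w is J :: _ then (J < i)%N else true.

Lemma enum_ord_split J : exists e1 e2, [/\ enum 'I_L.+1 = e1 ++ J :: e2,
  forall i, i \in e1 -> (i < J)%N & forall i, i \in e2 -> (J < i)%N].
Proof.
have := iota_ltn_sorted 0 L.+1; rewrite -val_enum_ord.
have /splitPr[e1 e2] := mem_enum 'I_L.+1 J; rewrite map_cat /= => s.
move: s; rewrite sorted_pairwise ?pairwise_cat /=; last exact: ltn_trans.
rewrite allrel_consr => /andP[/andP[/allP e1J _] /and3P[_ /allP e2J _]].
by exists e1, e2; split=> // i ie; [exact: (e1J _ (map_f val ie))|exact: (e2J _ (map_f val ie))].
Qed.

(** The new column [(J, 0)] stands right after the columns of the letters before [J], in the same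
    place for both insertions; only the sign of an expansion depends on it. *)
Lemma cols_split J a : exists s1 s2,
  [/\ wronsk_cols a = s1 ++ s2,
      wronsk_cols (ins_block J a) = s1 ++ (J, 0%N) :: s2 &
      [seq (c.1, (c.2 + (c.1 < J))%N) | c : 'I_L.+1 * nat <- wronsk_cols (lift_block J a)] =
      [seq (c.1, c.2.+1) | c <- s1] ++ (J, 0%N) :: [seq (c.1, c.2.+1) | c <- s2]].
Proof.
have [e1 [e2 [eE e1J e2J]]] := enum_ord_split J.
exists [seq (i, b) | i <- e1, b <- a i], ([seq (J, b) | b <- a J] ++ [seq (i, b) | i <- e2, b <- a i]).
have e1n i : i \in e1 -> (i == J) = false.
  by move=> /e1J iJ; rewrite -val_eqE /= ltn_eqF.
have e2n i : i \in e2 -> (i == J) = false.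
  by move=> /e2J iJ; rewrite -val_eqE /= gtn_eqF.
split; rewrite /wronsk_cols eE allpairs_cat allpairs_cons //.
- rewrite /ins_block eqxx /=; congr (_ ++ _ :: _ ++ _); congr flatten.
    by apply/eq_in_map => i /e1n ->.
  by apply/eq_in_map => i /e2n ->.
- rewrite !map_cat /lift_block ltnn eqxx /= ltnn addn0 -!map_comp.
  rewrite !map_flatten -!map_comp; congr (_ ++ _ :: _ ++ _).
  - congr flatten; apply/eq_in_map => i ie /=.
    by rewrite e1J // -!map_comp; apply/eq_map => b /=; rewrite e1J // addn1.
  - by apply/eq_map => b /=; rewrite ltnn addn0.
  - congr flatten; apply/eq_in_map => i ie /=.
    have iJ : (i < J)%N = false by rewrite ltnNge ltnW // e2J.
    by rewrite iJ e2n // -!map_comp; apply/eq_map => b /=; rewrite iJ addn0.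
Qed.

Lemma mem_cols a c : (c \in wronsk_cols a) = (c.2 \in a c.1).
Proof.
apply/allpairsPdep/idP => [[i [b [_ ba ->]]] //|ca].
by exists c.1, c.2; split; rewrite ?mem_enum -?surjective_pairing.
Qed.

Lemma word_block_gt i w : gt_head i w -> 0%N \notin word_block w i.
Proof.
case: w => [//|J w] /= Ji; rewrite /lift_block ltnNge ltnW // -val_eqE gtn_eqF //=.
by apply/mapP => -[].
Qed.

Lemma size_word_cols w : size (wronsk_cols (word_block w)) = size w.
Proof.
elim: w => [|J w IHw] /=.
  by rewrite /wronsk_cols; elim: (enum _) => //= i e; rewrite allpairs_cons.
have [s1 [s2 [E1 _ E2]]] := cols_split J (word_block w).
rewrite -(size_map (fun c : 'I_L.+1 * nat => (c.1, (c.2 + (c.1 < J))%N))) E2 size_cat /= !size_map.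
by rewrite addnS -size_cat -E1 IHw.
Qed.

Lemma size_ins_cols i w : size (wronsk_cols (ins_block i (word_block w))) = (size w).+1.
Proof.
have [s1 [s2 [E1 -> _]]] := cols_split i (word_block w).
by rewrite size_cat /= addnS -size_cat -E1 size_word_cols.
Qed.

End Words.

(** * Spanning by words, and reduction modulo the generators *)

Section WordWronskians.
Variables (K : numFieldType) (L k : nat).
Local Notation J := (jet K L k).
Local Notation X := (@jX K L k).
Local Notation C := (@mpolyC (jet_dim L k) K).
Implicit Types (p q : J) (i : 'I_L.+1) (w : seq 'I_L.+1).

Definition wordW w : J := jW K k (size w) (wronsk_cols (word_block w)).
(** When [gt_head i w] holds, these are the explicit generators, by [in_SigmaP]. *)
Definition wordG i w : J := jW K k (size w).+1 (wronsk_cols (ins_block i (word_block w))).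

Lemma wordW_inv w : (size w <= k.+1)%N -> jinv (size w) (wordW w).
Proof. by move=> wk; apply: jW_inv; rewrite ?size_word_cols. Qed.

Lemma wordG_inv i w : (size w <= k)%N -> jinv (size w).+1 (wordG i w).
Proof. by move=> wk; apply: jW_inv; rewrite ?size_ins_cols. Qed.

Lemma wordW_order w i e : (size w <= k.+1)%N -> (size w <= e)%N -> jD i e (wordW w) = 0.
Proof. by move=> wk we; apply: jD_jW_order; rewrite ?size_word_cols. Qed.

Lemma wordW_nil : wordW [::] = 1.
Proof. by rewrite /wordW jW.unlock det_mx00. Qed.

Lemma jshift_wordW i w : (size w <= k)%N ->
  exists2 c, c != 0 & jshift_lt i (wordW (i :: w)) = c *: (X i 0 * wordW w).
Proof.
move=> wk; have [s1 [s2 [E1 _ E2]]] := cols_split i (word_block w).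
exists ((-1) ^+ size s1 * (size w)`!%:R).
  by rewrite mulf_neq0 ?signr_eq0 // pnatr_eq0 -lt0n fact_gt0.
rewrite /wordW /jshift_lt jshift_jW //; last exact: (size_word_cols (i :: w)).
rewrite /= in E2 *; rewrite E2 jW_row0; last by rewrite -E1 size_word_cols.
rewrite -E1 -mul_mpolyC rmorphM /= mpolyC_nat rmorphXn /= rmorphN1.
by [].
Qed.

(** Before the shift, columns of offset 0 belong to letters up to [i], and these are all raised; so
    row 0 becomes zero. *)
Lemma jshift_wordW_eq0 m i w : (size w <= k)%N -> (i < m)%N ->
  jshift_lt m (wordW (i :: w)) = 0.
Proof.
move=> wk im; rewrite /wordW /jshift_lt jshift_jW //; last exact: (size_word_cols (i :: w)).
apply: jW_row0_eq0 => [|c]; first by rewrite size_map (size_word_cols (i :: w)).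
move=> /mapP[c' + -> /=]; rewrite mem_cols => c'w.
have [lt|] := ltnP c'.1 m; first by rewrite addn1.
rewrite addn0 => mc'; apply: contraTneq c'w => ->; apply: word_block_gt => /=.
exact: leq_trans im mc'.
Qed.

Lemma jD_wordG_top i w : (size w <= k)%N -> gt_head i w ->
  exists2 c, c != 0 & jD i (size w) (wordG i w) = c *: wordW w.
Proof.
move=> wk iw; have [s1 [s2 [E1 E2 _]]] := cols_split i (word_block w).
exists ((-1) ^+ (size w + size s1)); first by rewrite signr_eq0.
rewrite /wordG E2 jD_jW_top //; last by rewrite -E1 mem_cols word_block_gt.
  by rewrite -E1 -/(wordW w) -mul_mpolyC rmorphXn /= rmorphN1.
by rewrite -E1 size_word_cols.
Qed.

Lemma jD_wordG_top0 i j w : (size w <= k)%N -> gt_head j w -> j != i ->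
  jD j (size w) (wordG i w) = 0.
Proof.
move=> wk jw ji; apply: jD_jW_top0; rewrite ?size_ins_cols // mem_cols /=.
by rewrite /ins_block (negPf ji) word_block_gt.
Qed.

Definition is_wordW d (x : J) := exists2 w, size w = d & x = wordW w.

(** Let [i] be the last shifted letter. Just before [i] is shifted, [q] has become X_i^(0) times a
    quasi-invariant of degree d, which is a combination of words [w]. The same combination of the
    words [i :: w] has the same image, and the difference is killed one letter earlier. *)
Lemma jinv_span_vanishing d m : (d <= k)%N -> (m <= L.+1)%N ->
  (forall q, jinv d q -> lspan (is_wordW d) q) ->
  forall q, jinv d.+1 q -> jshift_lt m q = 0 ->
  lspan (fun x => exists i w, [/\ (i < m)%N, size w = d & x = wordW (i :: w)]) q.
Proof.
move=> dk + Sd; elim: m => [|m IHm] mL q Hq.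
  by rewrite jshift_lt0 => ->; apply: lspan0.
pose i := Ordinal mL; rewrite -[m.+1]/(i.+1) => q0.
have [q' qE Hq'] := jinv_shift_quotient Hq q0.
have [y sy yE] : exists2 y,
    lspan (fun x => exists i w, [/\ (i < m.+1)%N, size w = d & x = wordW (i :: w)]) y &
    jinv d.+1 y /\ jshift_lt i y = X i 0 * q'.
  elim: {q' qE Hq'}(Sd q' Hq') => [|a x z [w wd ->] _ [y sy [Hy yE]]].
    by exists 0; [exact: lspan0|split; [exact: jinv0|rewrite mulr0 rmorph0]].
  have wk : (size w <= k)%N by rewrite wd.
  have [c c0 cE] := jshift_wordW i wk; exists ((a / c) *: wordW (i :: w) + y).
    by apply: lspanS => //; exists i, w.
  split; first by apply: jinvD => //; apply: jinvZ; rewrite -wd; apply: wordW_inv.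
  rewrite rmorphD /= yE mulrDr; congr (_ + _).
  by rewrite /jshift_lt jshiftZ -/(jshift_lt i _) cE scalerA divfK // scalerAr.
rewrite -[q](subrK y); apply: lspanD => //.
apply: lspan_trans (IHm (ltnW mL) (q - y) _ _).
- by move=> x [j [w [jm wd ->]]]; apply: lspan_in; exists j, w; split=> //; apply: leqW.
- exact: jinvB Hq yE.1.
- by rewrite -[m]/(nat_of_ord i) rmorphB /= qE yE.2 subrr.
Qed.

Lemma jinv_span d : (d <= k.+1)%N -> forall q, jinv d q -> lspan (is_wordW d) q.
Proof.
elim: d => [_ q /jinv0_const[c ->]|d IHd dk q Hq].
  rewrite -[c%:MP]mulr1 mul_mpolyC; apply/lspanZ/lspan_in.
  by exists [::]; rewrite // wordW_nil.
apply: lspan_trans (jinv_span_vanishing dk (leqnn _) (IHd (ltnW dk)) Hq _).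
  by move=> x [i [w [_ wd ->]]]; apply: lspan_in; exists (i :: w); rewrite /= ?wd.
by rewrite jshift_lt_max (jinv_shift_all _ Hq).
Qed.

Lemma jinv_order d i e q : (d <= k.+1)%N -> jinv d q -> (d <= e)%N -> jD i e q = 0.
Proof.
move=> dk Hq de; elim: (jinv_span dk Hq) => [|a x y [w wd ->] _ IH].
  by rewrite linear0.
by rewrite linearP /= IH addr0 wordW_order ?scaler0 ?wd.
Qed.

Definition is_wordG d (x : J) := exists i w,
  [/\ size w = d, gt_head i w & x = wordG i w].

(** Induction on [m], where the derivatives of order [d] by the letters from [m] on already vanish:
    the derivative by the last remaining letter is removed with generators. *)
Lemma jinv_top_reduce d p : (0 < d <= k)%N -> jinv d.+1 p ->
  exists q, [/\ lspan (is_wordG d) q,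
    jinv d.+1 (p - q) & forall i e, (d <= e)%N -> jD i e (p - q) = 0].
Proof.
move=> /andP[d0 dk]; pose G := is_wordG d.
suff main m : (m <= L.+1)%N -> forall p, jinv d.+1 p ->
    (forall i, (m <= i)%N -> jD i d p = 0) ->
    exists q, [/\ lspan G q, jinv d.+1 (p - q) & forall i e, (d <= e)%N -> jD i e (p - q) = 0].
  by move=> Hp; apply: (main L.+1 (leqnn _) p Hp) => i; rewrite leqNgt ltn_ord.
elim: m => [_|m IHm mL] {}p Hp pm.
  exists 0; rewrite subr0; split=> // [|i e]; first exact: lspan0.
  rewrite leq_eqVlt => /predU1P[<-|de]; first exact: pm.
  by apply: jinv_order Hp _.
pose i0 := Ordinal mL.
have pe i j : (d < j)%N -> jD i j p = 0 by move=> dj; apply: jinv_order Hp _.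
have Hp0 : jinv d (jD i0 d p) by apply: jinv_top_deriv.
(* In the shifted syzygy the terms before [i0] die with X_i^(0), and those after [i0] vanish by
   hypothesis. *)
have vanish : jshift_lt i0 (jD i0 d p) = 0.
  have /(congr1 (jshift_lt i0)) := jinv_syzygy (introT andP (conj d0 dk)) Hp pe.
  rewrite rmorph0 rmorph_sum (bigD1 i0) //= big1 ?addr0 => [|i ii0].
    rewrite rmorphM /= [jshift_lt m (X _ _)]jshiftX // ltnn => /eqP.
    by rewrite mulf_eq0 (negPf (jX_neq0 _ _ _)) // orbF => /eqP.
  have [im|mi] := ltnP i m; last first.
    rewrite pm ?mul0r ?rmorph0 // ltn_neqAle mi andbT.
    by apply: contra ii0 => /eqP mi'; apply/eqP/val_inj.
  by rewrite rmorphM /= [jshift_lt m (X _ _)]jshiftX // im mul0r mulr0.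
case: d d0 dk => // d _ dk in G IHm Hp pm pe Hp0 vanish *.
have sp := jinv_span_vanishing (ltnW dk) (ltnW mL) (jinv_span (leqW (ltnW dk))) Hp0 vanish.
(* Hence the derivative is a combination of words starting before [i0]. Each such word is, up to a
   nonzero factor, the top derivative of a generator whose derivatives by later letters vanish. *)
have [q [sq Hq qE q0]] : exists q, [/\ lspan G q, jinv d.+2 q, jD i0 d.+1 q = jD i0 d.+1 p &
    forall i, (m < i)%N -> jD i d.+1 q = 0].
  elim: sp => [|a x z [i [w [im wd ->]]] _ [q [sq Hq qE q0]]].
    exists 0; split; rewrite ?linear0 //; [exact: lspan0|exact: jinv0|].
    by move=> i _; rewrite linear0.
  have wk : (size (i :: w) <= k)%N by rewrite /= wd.
  have gt : gt_head i0 (i :: w) by [].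
  have [c c0 cE] := jD_wordG_top wk gt; rewrite /= wd in cE.
  exists ((a / c) *: wordG i0 (i :: w) + q); split.
  - by apply: lspanS => //; exists i0, (i :: w); rewrite /= wd.
  - by apply/jinvD => //; apply: jinvZ; rewrite -wd; apply: (wordG_inv i0 wk).
  - by rewrite linearP /= cE scalerA divfK // qE.
  - move=> j mj; rewrite linearP /= q0 // addr0 -wd (jD_wordG_top0 wk) ?scaler0 //=.
      exact: ltn_trans im mj.
    by rewrite -val_eqE /= gtn_eqF.
have [q' [sq' Hq' q'0]] : exists q', [/\ lspan G q', jinv d.+2 (p - q - q') &
    forall i e, (d.+1 <= e)%N -> jD i e (p - q - q') = 0].
  apply: (IHm (ltnW mL)) => [|i]; first exact: jinvB.
  rewrite leq_eqVlt linearB /= => /predU1P[mi|mi]; last by rewrite pm // q0 // subrr.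
  by rewrite (_ : i = i0) ?qE ?subrr //; apply: val_inj.
by exists (q + q'); rewrite opprD addrA; split=> //; apply: lspanD.
Qed.

End WordWronskians.

(** * Linear independence of the word Wronskians and of the generators *)

Section Independence.
Variables (K : numFieldType) (L k : nat).
Local Notation J := (jet K L k).
Local Notation X := (@jX K L k).
Local Notation wordW := (@wordW K L k).
Local Notation wordG := (@wordG K L k).

Lemma sum_tuple_cons (V : nmodType) (T : finType) d (F : d.+1.-tuple T -> V) :
  \sum_t F t = \sum_x \sum_(t : d.-tuple T) F [tuple of x :: t].
Proof.
rewrite pair_big (reindex (fun p : T * d.-tuple T => [tuple of p.1 :: p.2])) //=.
exists (fun t => (thead t, [tuple of behead t])) => [[x t] _|t _] /=.
  by congr (_, _); apply: val_inj.
by rewrite -tuple_eta.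
Qed.

(** Triangularity in the first letter, treated from the largest down. Shifting the letters before
    [i] kills the words starting before [i], the words starting after [i] are already excluded, and
    the others become X_i^(0) times shorter words. *)
Lemma wordW_free d (c : d.-tuple 'I_L.+1 -> K) : (d <= k.+1)%N ->
  \sum_t c t *: wordW t = 0 -> forall t, c t = 0.
Proof.
elim: d c => [|d IHd] c dk c0 t.
  move: c0; rewrite (bigD1 t) //= big1 => [|t' /eqP[]]; last by rewrite (tuple0 t') (tuple0 t).
  rewrite addr0 (tuple0 t) wordW_nil => /eqP.
  by rewrite scaler_eq0 oner_eq0 orbF => /eqP.
rewrite sum_tuple_cons in c0.
suff H m (i : 'I_L.+1) (t' : d.-tuple 'I_L.+1) : (L.+1 <= i + m)%N -> c [tuple of i :: t'] = 0.
  by case/tupleP: t => i t'; apply: (H L.+1); rewrite leq_addl.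
elim: m i t' => [|m IHm] i t' im; first by rewrite addn0 leqNgt ltn_ord in im.
have uk (u : d.-tuple 'I_L.+1) : (size u <= k)%N by rewrite size_tuple.
have shift0 (j : 'I_L.+1) (u : d.-tuple 'I_L.+1) : j != i ->
    jshift_lt i (c [tuple of j :: u] *: wordW (j :: u)) = 0.
  move=> ji; rewrite /jshift_lt jshiftZ -/(jshift_lt i _); case: (ltngtP j i) => [lt|gt|eq].
  - by rewrite jshift_wordW_eq0 ?scaler0.
  - by rewrite IHm ?scale0r //; move: im gt; clear; lia.
  - by case/eqP: ji; apply: val_inj.
have [e e0 eE] := fin_all_exists2 (fun u : d.-tuple 'I_L.+1 => jshift_wordW K i (uk u)).
suff: c [tuple of i :: t'] * e t' = 0.
  by move/eqP; rewrite mulf_eq0 (negPf (e0 _)) orbF => /eqP.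
apply: (IHd (fun u => c [tuple of i :: u] * e u)); first exact: ltnW.
apply: (mulfI (jX_neq0 K i (leq0n k))); rewrite mulr0.
have := congr1 (jshift_lt i) c0; rewrite rmorph0 => E; rewrite -[RHS]E {E}.
rewrite (bigD1 i) //= rmorphD /= [X in _ + X]rmorph_sum [X in _ + X]big1 ?addr0 => [|j ji]; last first.
  by rewrite /= rmorph_sum big1 // => u _; apply: shift0.
rewrite rmorph_sum mulr_sumr; apply: eq_bigr => u _ /=.
by rewrite /jshift_lt jshiftZ -/(jshift_lt i _) eE scalerA scalerAr.
Qed.

(** The same descent on the distinguished letter, with the derivative by X_i^(d) in place of the
    shift; it reduces to [wordW_free]. *)
Lemma wordG_free d (c : 'I_L.+1 -> d.-tuple 'I_L.+1 -> K) : (d <= k)%N ->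
  (forall i (t : d.-tuple 'I_L.+1), ~~ gt_head i t -> c i t = 0) ->
  (forall j, jD j d (\sum_i \sum_t c i t *: wordG i t) = 0) ->
  forall i t, c i t = 0.
Proof.
move=> dk cv c0.
suff H m (i : 'I_L.+1) (t : d.-tuple 'I_L.+1) : (L.+1 <= i + m)%N -> c i t = 0.
  by move=> i t; rewrite (H L.+1) ?leq_addl.
elim: m i t => [|m IHm] i t im; first by rewrite addn0 leqNgt ltn_ord in im.
have [it|] := boolP (gt_head i t); last exact: cv.
have uk (u : d.-tuple 'I_L.+1) : (size u <= k)%N by rewrite size_tuple.
have D0 j (u : d.-tuple 'I_L.+1) : j != i -> jD i d (c j u *: wordG j u) = 0.
  move=> ji; rewrite linearZ /=; have [ju|/cv->] := boolP (gt_head j u); last by rewrite scale0r.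
  case: (ltngtP j i) => [lt|gt|eq].
  - rewrite -{1}(size_tuple u) jD_wordG_top0 ?scaler0 1?eq_sym //.
    by case: (tval u) ju => //= a w aj; apply: ltn_trans lt.
  - by rewrite IHm ?scale0r //; move: im gt; clear; lia.
  - by case/eqP: ji; apply: val_inj.
have DE (u : d.-tuple 'I_L.+1) : exists2 e, e != 0 & c i u *: jD i d (wordG i u) = (c i u * e) *: wordW u.
  have [iu|/cv->] := boolP (gt_head i u); last by exists 1; rewrite ?oner_eq0 // mul0r !scale0r.
  have [e e0 eE] := jD_wordG_top K (uk u) iu; exists e => //.
  by rewrite -scalerA -eE size_tuple.
have [e e0 eE] := fin_all_exists2 DE.
suff: c i t * e t = 0 by move/eqP; rewrite mulf_eq0 (negPf (e0 _)) orbF => /eqP.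
apply: (@wordW_free _ (fun u => c i u * e u)); first exact: leqW.
rewrite -[RHS](c0 i) linear_sum (bigD1 i) //= [X in _ + X]big1 ?addr0 => [|j ji].
  by rewrite linear_sum; apply: eq_bigr => u _; rewrite -eE linearZ.
by rewrite linear_sum big1 // => u _; apply: D0.
Qed.

Lemma wordG_sum d y (i0 : 'I_L.+1) (t0 : d.-tuple 'I_L.+1) :
  lspan (fun x => @is_wordG K L k d x /\ x <> wordG i0 t0) y ->
  exists c : 'I_L.+1 -> d.-tuple 'I_L.+1 -> K,
    [/\ forall i (t : d.-tuple 'I_L.+1), ~~ gt_head i t -> c i t = 0, c i0 t0 = 0 &
        y = \sum_i \sum_t c i t *: wordG i t].
Proof.
elim=> [|a x z [[i [w [wd iw ->]]] ne] _ [c [cv c0 ->]]].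
  exists (fun _ _ => 0); split=> //; rewrite big1 // => i _.
  by rewrite big1 // => t _; rewrite scale0r.
have wd' : size w == d by apply/eqP.
exists (fun j t => a * ((j == i) && (t == Tuple wd'))%:R + c j t); split.
- move=> j t /[dup] jt /cv ->; rewrite addr0; case: andP => [[/eqP ji /eqP tw]|_].
    by rewrite ji tw iw in jt.
  by rewrite mulr0.
- rewrite c0 addr0; case: andP => [[/eqP ji /eqP tw]|_]; last by rewrite mulr0.
  by case: ne; rewrite ji tw.
- have -> : a *: wordG i w = \sum_j \sum_t (a * ((j == i) && (t == Tuple wd'))%:R) *: wordG j t.
    rewrite (bigD1 i) //= [X in _ + X]big1 ?addr0 => [|j /negPf ji].
      rewrite (bigD1 (Tuple wd')) //= !eqxx mulr1 big1 ?addr0 // => t /negPf tw.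
      by rewrite tw andbF mulr0 scale0r.
    by rewrite big1 // => t _; rewrite ji mulr0 scale0r.
  rewrite -big_split; apply: eq_bigr => j _ /=; rewrite -big_split.
  by apply: eq_bigr => t _; rewrite scalerDl.
Qed.

(* A product of two quasi-invariants of positive degrees of sum [d.+1] has    *)
(* order [< d], so this is independence modulo decomposable elements.         *)
Lemma wordG_indep d y i w : (d <= k)%N -> size w = d -> gt_head i w ->
  lspan (fun x => @is_wordG K L k d x /\ x <> wordG i w) y ->
  ~ forall j, jD j d (wordG i w - y) = 0.
Proof.
move=> dk wd iw; have wd' : size w == d by apply/eqP.
rewrite -[w]/(tval (Tuple wd')) => /wordG_sum[c [cv c0 ->]] H.
pose c' j (t : d.-tuple 'I_L.+1) := ((j == i) && (t == Tuple wd'))%:R - c j t.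
suff /eqP : c' i (Tuple wd') = 0.
  by rewrite /c' c0 !eqxx subr0 oner_eq0.
apply: wordG_free => // [j t jt|j].
  rewrite /c' cv // subr0; case: andP => // -[/eqP ji /eqP tw].
  by rewrite ji tw /= iw in jt.
rewrite -[RHS](H j); congr (jD _ _ _).
under eq_bigr => l _ do (under eq_bigr => t _ do rewrite /c' scalerBl; rewrite sumrB).
rewrite sumrB; congr (_ - _).
rewrite (bigD1 i) //= [X in _ + X]big1 ?addr0 => [|l /negPf li].
  rewrite (bigD1 (Tuple wd')) //= !eqxx scale1r big1 ?addr0 // => t /negPf tw.
  by rewrite tw andbF scale0r.
by rewrite big1 // => t _; rewrite li scale0r.
Qed.

Lemma wordG_inj i w i' w' : (size w <= k)%N -> size w = size w' ->
  gt_head i w -> gt_head i' w' -> wordG i w = wordG i' w' -> i = i' /\ w = w'.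
Proof.
move=> wk ww' iw iw' E.
have s1 : size w == size w' by rewrite ww'.
have s2 : size w' == size w' by [].
pose t : (size w').-tuple 'I_L.+1 := Tuple s1.
pose t' : (size w').-tuple 'I_L.+1 := Tuple s2.
have [/andP[/eqP -> /eqP tt']|ne] := boolP ((i == i') && (t == t')).
  by split=> //; apply: (congr1 val tt').
pose c j (u : (size w').-tuple 'I_L.+1) : K := ((j == i) && (u == t))%:R - ((j == i') && (u == t'))%:R.
have delta j0 (u0 : (size w').-tuple 'I_L.+1) :
    \sum_j \sum_u ((j == j0) && (u == u0))%:R *: wordG j u = wordG j0 u0.
  rewrite (bigD1 j0) //= [X in _ + X]big1 ?addr0 => [|l /negPf li].
    rewrite (bigD1 u0) //= !eqxx scale1r big1 ?addr0 // => v /negPf vw.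
    by rewrite vw andbF scale0r.
  by rewrite big1 // => v _; rewrite li scale0r.
have cE : \sum_j \sum_u c j u *: wordG j u = 0.
  under eq_bigr => l _ do (under eq_bigr => v _ do rewrite scalerBl; rewrite sumrB).
  by rewrite sumrB !delta /= E subrr.
have /eqP : c i t = 0.
  apply: wordG_free => [|j u ju|j]; first by rewrite -ww'.
    rewrite /c; case: andP => [[/eqP ji /eqP uw]|_]; first by rewrite ji uw /= iw in ju.
    case: andP => [[/eqP ji /eqP uw]|_]; first by rewrite ji uw /= iw' in ju.
    by rewrite subrr.
  by rewrite cE linear0.
by rewrite /c !eqxx (negPf ne) subr0 oner_eq0.
Qed.

End Independence.

(** * Products of Wronskians and Tanisaki conditions *)

Lemma size_det_leq (R : idomainType) n (A : 'M[{poly R}]_n) (e : 'I_n -> nat) :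
  (forall i j, (size (A i j) <= (e j).+1)%N) ->
  (size (\det A) <= (\sum_j e j).+1)%N.
Proof.
move=> Ae; apply: leq_trans (size_sum _ _ _) _; apply/bigmax_leqP => s _.
rewrite size_Msign; apply: leq_trans (size_prod_leq _ _) _.
rewrite leq_subLR addnS ltnS card_ord.
rewrite -[X in (_ <= X + _)%N]muln1 -[X in (_ <= X * _ + _)%N]card_ord -sum_nat_const.
rewrite [X in (_ <= _ + X)%N](reindex_inj (@perm_inj _ s)) /= -big_split /=.
by apply: leq_sum => i _; rewrite add1n.
Qed.

Lemma sum_count_mem (T : finType) (P : pred T) (s : seq T) :
  (\sum_(y | P y) count_mem y s)%N = count P s.
Proof.
elim: s => [|x s IHs] /=; first by rewrite big1.
rewrite big_split /= IHs; congr (_ + _)%N.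
have [Px|nPx] := boolP (P x).
  rewrite (bigD1 x) //= eqxx big1 // => y /andP[_ /negPf yx].
  by rewrite eq_sym yx.
rewrite big1 // => y Py; rewrite (_ : (x == y) = false) //.
by apply: contraNF nPx => /eqP ->.
Qed.

Lemma map_poly_derivation (R : comNzRingType) (D : {additive R -> R}) :
  (forall x y, D (x * y) = D x * y + x * D y) ->
  forall p q : {poly R}, map_poly D (p * q) = map_poly D p * q + p * map_poly D q.
Proof.
move=> DM p q; apply/polyP => i; rewrite coefD !coefM coef_map coefM raddf_sum.
rewrite -big_split; apply: eq_bigr => j _ /=.
by rewrite DM !coef_map.
Qed.

(** * Polynomials free of a letter or linear in it *)

Section Multilinear.
Variables (K : numFieldType) (L k : nat).
Local Notation J := (jet K L k).
Local Notation X := (@jX K L k).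
Local Notation C := (@mpolyC (jet_dim L k) K).
Local Notation W := (@jW K L k).
Implicit Types (p q h : J) (x y : 'I_L.+1) (S U : {set 'I_L.+1}).
Implicit Types (s : seq ('I_L.+1 * nat)).

Definition jzero (A : pred 'I_L.+1) : J -> J :=
  jsub C (fun i j => if A i then 0 else X i j).
HB.instance Definition _ A := GRing.RMorphism.on (jzero A).

Lemma jzeroC A c : jzero A (C c) = C c. Proof. exact: jsubC. Qed.
Lemma jzeroX A i j : (j <= k)%N -> jzero A (X i j) = if A i then 0 else X i j.
Proof. exact: jsubX. Qed.
Lemma jzeroZ A c p : jzero A (c *: p) = c *: jzero A p.
Proof. by rewrite -!mul_mpolyC rmorphM /= jzeroC. Qed.

(** Absence of the letter [x], expressed as invariance under setting its variables to 0. *)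
Definition jfree x p := jzero (pred1 x) p = p.

Lemma jfree_prod I (r : seq I) (P : pred I) (F : I -> J) x :
  (forall i, P i -> jfree x (F i)) -> jfree x (\prod_(i <- r | P i) F i).
Proof. by move=> Fx; rewrite /jfree rmorph_prod; apply: eq_bigr => i /Fx. Qed.

Lemma jfreeM x p q : jfree x p -> jfree x q -> jfree x (p * q).
Proof. by rewrite /jfree rmorphM /= => -> ->. Qed.

Lemma jfreeX x i j : i != x -> jfree x (X i j).
Proof.
move=> ix; have [jk|kj] := leqP j k; last by rewrite jX_big // /jfree rmorph0.
by rewrite /jfree jzeroX //= (negPf ix).
Qed.

Lemma jfree_sum I (r : seq I) (P : pred I) (F : I -> J) x :
  (forall i, P i -> jfree x (F i)) -> jfree x (\sum_(i <- r | P i) F i).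
Proof. by move=> Fx; rewrite /jfree rmorph_sum; apply: eq_bigr => i /Fx. Qed.

Lemma jfreeL x a p q : jfree x p -> jfree x q -> jfree x (a *: p + q).
Proof. by rewrite /jfree rmorphD /= jzeroZ => -> ->. Qed.

Lemma jfree0 x : jfree x 0. Proof. exact: rmorph0. Qed.

Lemma jfree_det n (A : 'M[J]_n) x : (forall i j, jfree x (A i j)) -> jfree x (\det A).
Proof.
by move=> Ax; rewrite /jfree -det_map_mx; congr (\det _); apply/matrixP => i j; rewrite mxE; exact: Ax.
Qed.

Lemma jfree_jE x c r : c.1 != x -> jfree x (jE K k c r).
Proof. by move=> cx; apply: jfreeM; [rewrite /jfree rmorph_nat|apply: jfreeX]. Qed.

Lemma jfree_W x n s : size s = n -> x \notin unzip1 s -> jfree x (W n s).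
Proof.
move=> sn xs; rewrite jW.unlock; apply: jfree_det => r l; rewrite mxE.
apply: jfree_jE; apply: contraNneq xs => <-; apply: map_f.
by rewrite mem_nth ?sn.
Qed.

Lemma jD_jzero x y b p : jD y b (jzero (pred1 x) p) =
  if y == x then 0 else jzero (pred1 x) (jD y b p).
Proof.
have DC c : jD y b (jzero (pred1 x) (C c)) = 0 by rewrite jzeroC jDC.
have := chain_rule (raddfD (jD y b)) (@jDM K L k y b) DC p => /= ->.
have E i (j : 'I_k.+1) : jD y b (jzero (pred1 x) (X i j)) =
    ((i != x) && (y == i) && (b == j))%:R.
  have jk : (j <= k)%N by rewrite -ltnS.
  rewrite jzeroX //=; case: (i == x); first by rewrite linear0.
  by rewrite jDX.
under eq_bigr => i _ do under eq_bigr => j _ do rewrite E.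
case: eqVneq => [->|yx].
  rewrite big1 // => i _; rewrite big1 // => j _.
  by rewrite [x == i]eq_sym; case: (i == x); rewrite mulr0.
rewrite (bigD1 y) //= [X in _ + X]big1 ?addr0 => [|i iy]; last first.
  by rewrite big1 // => j _; rewrite [y == i]eq_sym (negPf iy) andbF mulr0.
have [bk|kb] := leqP b k.
  rewrite (bigD1 (Ordinal (bk : b < k.+1)%N)) //= yx !eqxx mulr1 big1 ?addr0 // => j jb.
  by rewrite eq_sym -val_eqE /= in jb; rewrite (negPf jb) andbF mulr0.
rewrite /jD leqNgt kb rmorph0 big1 // => j _.
by rewrite gtn_eqF ?andbF ?mulr0 // (leq_trans (ltn_ord j)).
Qed.

Lemma jD_free x b p : jfree x p -> jD x b p = 0.
Proof. by move=> <-; rewrite jD_jzero eqxx. Qed.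

Lemma jfree_jD x y b p : jfree x p -> jfree x (jD y b p).
Proof.
move=> px; case: (eqVneq y x) => [->|yx]; first by rewrite jD_free //; apply: jfree0.
by rewrite /jfree -[in RHS]px jD_jzero (negPf yx).
Qed.

Lemma jzero_free (A : pred 'I_L.+1) p : (forall x, A x -> jfree x p) -> jzero A p = p.
Proof.
move=> pf; suff H (r : seq 'I_L.+1) : all A r -> jzero (fun i => i \in r) p = p.
  rewrite -[RHS](H (enum A)); last by apply/allP => x; rewrite mem_enum.
  apply: jet_hom_ext => [c|i j jk]; first by rewrite /= !jzeroC.
  by rewrite /= !jzeroX // mem_enum.
elim: r => [_|x r IHr /= /andP[Ax Ar]].
  rewrite -[RHS]/(idfun p); apply: jet_hom_ext => [c|i j jk]; first exact: jzeroC.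
  by rewrite /= jzeroX.
transitivity ((jzero (pred1 x) \o jzero (fun i => i \in r)) p); last by rewrite /= IHr // pf.
apply: jet_hom_ext => [c|i j jk] /=; first by rewrite !jzeroC.
rewrite !jzeroX // in_cons; case: (i \in r); first by rewrite orbT rmorph0.
by rewrite orbF jzeroX.
Qed.

Lemma jfree_const p : (forall x, jfree x p) -> exists c, p = C c.
Proof.
move=> pf; have zp : jzero predT p = p by apply: jzero_free => x _.
rewrite -zp; move: p {pf zp}; apply: jet_ind => [c|i j jk|p q [a pa] [b qb]|p q [a pa] [b qb]].
- by exists c; rewrite jzeroC.
- by exists 0; rewrite jzeroX // mpolyC0.
- by exists (a + b); rewrite rmorphD /= pa qb mpolyCD.
- by exists (a * b); rewrite rmorphM /= pa qb mpolyCM.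
Qed.

(** Homogeneity of degree one in the letter [x]: the Euler relation, with coefficients free of
    [x]. *)
Definition jlin x p := (forall b, jfree x (jD x b p)) /\
  p = \sum_(b < k.+1) X x b * jD x b p.

Lemma jlinL x a p q : jlin x p -> jlin x q -> jlin x (a *: p + q).
Proof.
move=> [pf pE] [qf qE]; split=> [b|].
  by rewrite linearP /=; apply: jfreeL; [exact: pf|exact: qf].
rewrite {1}pE {1}qE scaler_sumr -big_split; apply: eq_bigr => b _ /=.
by rewrite linearP /= mulrDr scalerAr.
Qed.

Lemma jlin0 x : jlin x 0.
Proof.
split=> [b|]; first by rewrite linear0; apply: jfree0.
by rewrite big1 // => b _; rewrite linear0 mulr0.
Qed.

Lemma jlin_sum I (r : seq I) (P : pred I) (F : I -> J) x :
  (forall i, P i -> jlin x (F i)) -> jlin x (\sum_(i <- r | P i) F i).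
Proof.
move=> Fx; elim/big_ind: _ => [|p q|//]; first exact: jlin0.
by move=> Hp Hq; have := jlinL 1 Hp Hq; rewrite scale1r.
Qed.

Lemma jlinM x p q : jlin x p -> jfree x q -> jlin x (p * q).
Proof.
move=> [pf pE] qf; have DE b : jD x b (p * q) = jD x b p * q.
  by rewrite jDM (jD_free b qf) mulr0 addr0.
split=> [b|]; first by rewrite DE; apply: jfreeM.
by rewrite {1}pE mulr_suml; apply: eq_bigr => b _; rewrite DE mulrA.
Qed.

Lemma jlinX x j : jlin x (X x j).
Proof.
have [jk|kj] := leqP j k; last by rewrite jX_big //; apply: jlin0.
split=> [b|]; first by rewrite jDX // /jfree rmorph_nat.
rewrite (bigD1 (Ordinal (jk : j < k.+1)%N)) //= jDX // !eqxx mulr1 big1 ?addr0 // => b bj.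
by rewrite jDX // -val_eqE in bj *; rewrite (negPf bj) andbF mulr0.
Qed.

Lemma jlin_jD x y b p : y != x -> jlin x p -> jlin x (jD y b p).
Proof.
move=> yx [pf pE]; split=> [c|]; first by rewrite jD_comm; apply: jfree_jD.
rewrite {1}pE linear_sum; apply: eq_bigr => c _ /=.
have Xf : jfree y (X x c) by apply: jfreeX; rewrite eq_sym.
by rewrite jDM (jD_free b Xf) mul0r add0r jD_comm.
Qed.

Lemma jlin_W x b n s1 s2 : (n <= k)%N -> size (s1 ++ s2) = n -> x \notin unzip1 (s1 ++ s2) ->
  jlin x (W n.+1 (s1 ++ (x, b) :: s2)).
Proof.
move=> nk sn xs; have sl : (size s1 < n.+1)%N by rewrite ltnS -sn size_cat leq_addr.
rewrite (@jW_expand_col K L k n s1 (x, b) s2 (Ordinal sl)) //; apply: jlin_sum => r _.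
have E : jE K k (x, b) r = X x (r - b) * (r ^_ b)%:R by rewrite mulrC.
rewrite E -mulrA; apply: jlinM; first exact: jlinX.
apply: jfreeM; first by rewrite /jfree rmorph_nat.
apply: jfreeM; first by rewrite /jfree rmorph_sign.
apply: jfree_det => i j; rewrite mxE; apply: jfree_jE.
by apply: contraNneq xs => <-; apply: map_f; rewrite mem_nth ?sn.
Qed.

End Multilinear.

(** * The operators 1 + t J on a set of letters *)

Section Theta.
Variables (K : numFieldType) (L k : nat).
Local Notation J := (jet K L k).
Local Notation X := (@jX K L k).
Local Notation C := (@mpolyC (jet_dim L k) K).
Local Notation W := (@jW K L k).
Implicit Types (p q h : J) (x y : 'I_L.+1) (S U : {set 'I_L.+1}).
Implicit Types (s : seq ('I_L.+1 * nat)).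

(** On a polynomial multilinear in the letters of [S], the coefficient of t^m is the m-th elementary
    symmetric function of the operators J on these letters. *)
Definition jth S : J -> {poly J} := jtheta (fun i => i \in S).
HB.instance Definition _ S := GRing.RMorphism.on (jth S).

Lemma jthC S c : jth S (C c) = (C c)%:P. Proof. exact: jthetaC. Qed.
Lemma jthX S i j : (j <= k)%N ->
  jth S (X i j) = (X i j)%:P + 'X * ((i \in S)%:R * (j%:R * X i j.-1))%:P.
Proof. exact: jthetaX. Qed.

Lemma jthZ S c p : jth S (c *: p) = (C c) *: jth S p.
Proof. by rewrite -!mul_mpolyC rmorphM /= jthC mul_polyC. Qed.

Lemma size_jthL S a p q m : (size (jth S p) <= m)%N -> (size (jth S q) <= m)%N ->
  (size (jth S (a *: p + q)) <= m)%N.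
Proof.
move=> pm qm; rewrite rmorphD /= jthZ (leq_trans (size_polyD _ _)) // geq_max qm andbT.
exact: leq_trans (size_scale_leq _ _) pm.
Qed.

Lemma jth_free x S q : jfree x q -> jth (x |: S) q = jth S q.
Proof.
move=> qf; rewrite -qf -[LHS]/((jth (x |: S) \o jzero (pred1 x)) q).
rewrite -[RHS]/((jth S \o jzero (pred1 x)) q); apply: jet_hom_ext => [c|i j jk] /=.
  by rewrite jzeroC !jthC.
rewrite (@jzeroX K L k _ _ _ jk) [pred1 _ _]/=; case: eqVneq => [_|ix]; first by rewrite !rmorph0.
by rewrite !(jthX _ _ jk) in_setU1 (negPf ix).
Qed.

Lemma horner0_jth S q : (jth S q).[0] = q.
Proof.
rewrite -[LHS]/((horner_eval 0 \o jth S) q) -[RHS]/(idfun q).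
apply: jet_hom_ext => [c|i j jk] /=; first by rewrite jthC /horner_eval hornerC.
by rewrite jthX // /horner_eval hornerD hornerM hornerX mul0r addr0 hornerC.
Qed.

Definition mD y b : {poly J} -> {poly J} := map_poly (jD y b).
HB.instance Definition _ y b := GRing.Additive.on (mD y b).

Lemma mDM y b (u v : {poly J}) : mD y b (u * v) = mD y b u * v + u * mD y b v.
Proof. exact: (map_poly_derivation (@jDM K L k y b)). Qed.

Lemma mDC y b p : mD y b p%:P = (jD y b p)%:P.
Proof. exact: map_polyC. Qed.

Lemma mDX y b : mD y b 'X = 0.
Proof. by apply/polyP => i; rewrite coef_map coefX coef0 /= jD_nat. Qed.

Lemma size_mD y b (u : {poly J}) : (size (mD y b u) <= size u)%N.
Proof. exact: size_poly. Qed.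

Lemma sum_delta (F : nat -> {poly J}) b : (forall j, (k < j)%N -> F j = 0) ->
  \sum_(j < k.+1) F j * (b == j :> nat)%:R = F b.
Proof.
move=> F0; have [bk|kb] := leqP b k.
  rewrite (bigD1 (Ordinal (bk : b < k.+1)%N)) //= eqxx mulr1 big1 ?addr0 // => j jb.
  by rewrite -val_eqE /= eq_sym in jb; rewrite (negPf jb) mulr0.
rewrite F0 // big1 // => j _; rewrite gtn_eqF ?mulr0 //.
by rewrite (leq_trans (ltn_ord j)).
Qed.

(** Only the images of X_x^(b) and of X_x^(b+1) involve X_x^(b), the latter with coefficient (b+1)
    t, and only if x is in S. *)
Lemma mD_jth x b S q : mD x b (jth S q) = jth S (jD x b q) +
  'X * ((x \in S)%:R * (b.+1)%:R) * jth S (jD x b.+1 q).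
Proof.
have DC c : mD x b (jth S (C c)) = 0 by rewrite jthC mDC jDC.
have := chain_rule (raddfD (mD x b)) (@mDM x b) DC q => /= ->.
have E i (j : 'I_k.+1) : mD x b (jth S (X i j)) = (x == i)%:R * ((b == j :> nat)%:R +
    'X * ((x \in S)%:R * (b.+1)%:R) * (b.+1 == j :> nat)%:R).
  have jk : (j <= k)%N by rewrite -ltnS.
  rewrite jthX // raddfD /= mDM mDX mul0r add0r !mDC jDX //.
  rewrite jDM jD_nat mul0r add0r jDM jD_nat mul0r add0r jDX ?(leq_trans (leq_pred _)) //.
  case: eqVneq => [->|_]; last by rewrite /= !mulr0n !mulr0 polyC0 addr0 mul0r.
  rewrite /= mulr1n mul1r !polyCM !polyC_natr -!mulrA.
  congr (_ + _ * (_ * _)); case: (nat_of_ord j) => [|j']; first by rewrite mul0r mulr0.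
  by rewrite eqSS /=; case: eqVneq => [->|_]; rewrite ?mulr1 ?mulr0.
rewrite (bigD1 x) //= [X in _ + X]big1 ?addr0 => [|i ix]; last first.
  by rewrite big1 // => j _; rewrite E eq_sym (negPf ix) mul0r mulr0.
under eq_bigr => j _ do rewrite E eqxx mul1r mulrDr.
rewrite big_split /=; have jD0 j : (k < j)%N -> jth S (jD x j q) = 0.
  by move=> kj; rewrite /jD leqNgt kj rmorph0.
congr (_ + _); first exact: (@sum_delta (fun j => jth S (jD x j q))).
rewrite -[in RHS](@sum_delta (fun j => jth S (jD x j q))) // mulr_sumr.
by apply: eq_bigr => j _; rewrite mulrCA.
Qed.

Lemma mD_jth_notin x b S q : x \notin S -> mD x b (jth S q) = jth S (jD x b q).
Proof. by move=> xS; rewrite mD_jth (negPf xS) mul0r mulr0 mul0r addr0. Qed.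

Lemma mD_jth_lin x b S q : jlin x q ->
  mD x b (jth (x |: S) q) = jth S (jD x b q) + 'X * (b.+1)%:R * jth S (jD x b.+1 q).
Proof.
by move=> [qf _]; rewrite mD_jth in_setU1 eqxx /= mul1r !jth_free.
Qed.

Lemma size_Xnat b (u : {poly J}) : u != 0 -> size ('X * (b.+1)%:R * u) = (size u).+1.
Proof.
move=> u0; have b0 : ((b.+1)%:R : J) != 0 by rewrite -mpolyC_nat mpolyC_eq0 pnatr_eq0.
rewrite -mulrA mulrC size_mulX; last by rewrite mulf_neq0 // -polyC_natr polyC_eq0.
by rewrite -polyC_natr size_Cmul.
Qed.

(** All the letters of the Wronskian undergo the same unit 1 + t J, of constant term 1. *)
Lemma jthW_all S n s : (n <= k.+1)%N -> size s = n -> (forall c, c \in s -> c.1 \in S) ->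
  jth S (W n s) = (W n s)%:P.
Proof.
move=> nk sn sS.
pose a l : {poly J} := if l is l'.+1 then (l' == 0%N)%:R * 'X else 1.
rewrite (@jW_transform K L k _ (jth S) polyC a) // ?expr1n ?mul1r //.
move=> c cs j jk /=; rewrite jthX // sS // mul1r.
rewrite big_ord_recl /= ffactn0 !mul1r subn0; congr (_ + _).
case: k jk => [|k'] jk.
  by rewrite big_ord0; move: jk; rewrite leqn0 => /eqP ->; rewrite mul0r mulr0.
rewrite big_ord_recl /= ffactn1 big1 ?addr0 => [|l _]; last by rewrite mul0r mulr0 mul0r.
by rewrite mul1r subn1 polyCM polyC_natr mulrA [_ * 'X]mulrC.
Qed.

Lemma size_jthW S n s : (n <= k.+1)%N -> size s = n ->
  (size (jth S (W n s)) <= (count (fun c : 'I_L.+1 * nat => c.1 \in S) s).+1)%N.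
Proof.
move=> nk sn; rewrite jW.unlock -det_map_mx.
have <- : (\sum_(l < n) ((nth (ord0, 0%N) s l).1 \in S) =
    count (fun c : 'I_L.+1 * nat => c.1 \in S) s)%N.
  rewrite -[RHS]sum1_count [RHS]big_mkcond [RHS](big_nth (ord0, 0%N)) sn [RHS]big_mkord.
  by apply: eq_bigr => l _; case: (_ \in S).
apply: size_det_leq => r l; rewrite !mxE; set c := nth _ _ _.
have rk : (r <= k)%N by rewrite -ltnS (leq_trans (ltn_ord r)).
rewrite rmorphM rmorph_nat /= -polyC_natr mul_polyC.
apply: leq_trans (size_scale_leq _ _) _.
rewrite (jthX S c.1 (leq_trans (leq_subr _ _) rk)).
apply: leq_trans (size_polyD _ _) _; rewrite geq_max.
rewrite (leq_trans (size_polyC_leq1 _)) //=.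
case: (c.1 \in S); last by rewrite mul0r mulr0 size_poly0.
by rewrite mulrC mul_polyC (leq_trans (size_scale_leq _ _)) // size_polyX.
Qed.

End Theta.

Definition noninc (c : nat -> nat) := forall m, (c m.+1 <= c m)%N.
Definition psum (c : nat -> nat) j := (\sum_(m < j) c m)%N.

Lemma noninc_le c i j : noninc c -> (i <= j)%N -> (c j <= c i)%N.
Proof.
move=> cn /subnK <-; elim: (j - i)%N => [//|m IHm].
exact: leq_trans (cn _) IHm.
Qed.

Lemma psumS c j : psum c j.+1 = (psum c j + c j)%N.
Proof. exact: big_ord_recr. Qed.

Lemma psum_mono c i j : (i <= j)%N -> (psum c i <= psum c j)%N.
Proof.
move=> /subnK <-; elim: (j - i)%N => [//|m IHm].
by rewrite addSn psumS (leq_trans IHm) ?leq_addr.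
Qed.

Lemma psum_subset c (Q : pred nat) M : noninc c ->
  (\sum_(m < M | Q m) c m <= psum c (\sum_(m < M) Q m))%N.
Proof.
move=> cn; elim: M => [|M IHM]; first by rewrite !big_ord0.
rewrite big_mkcond big_ord_recr /= -big_mkcond big_ord_recr /=.
case: (Q M); last by rewrite !addn0.
rewrite addn1 psumS leq_add //; apply: noninc_le => //.
rewrite -[X in (_ <= X)%N]card_ord -sum1_card; apply: leq_sum => m _.
by case: (Q m).
Qed.

(** Either the first [j] parts are all positive, or they already include every positive part. *)
Lemma psum_ge c M j : noninc c -> (forall m, (M <= m)%N -> c m = 0%N) ->
  (j <= psum c M)%N -> (j <= psum c j)%N.
Proof.
move=> cn c0 jM; have [cj|cj] := posnP (c j).
  apply: leq_trans jM _; have [/(psum_mono c)//|jM] := leqP M j.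
  rewrite -(subnK (ltnW jM)); elim: (M - j)%N => [//|m IHm].
  rewrite addSn psumS -[X in (_ <= X)%N]addn0 leq_add // leqn0.
  by rewrite -leqn0 -cj noninc_le // leq_addl.
rewrite /psum -[X in (X <= _)%N]card_ord -sum1_card; apply: leq_sum => m _.
by rewrite (leq_trans cj) // noninc_le // ltnW.
Qed.

Section Decompose.
Variables (K : numFieldType) (L k : nat).
Local Notation J := (jet K L k).
Local Notation X := (@jX K L k).
Local Notation C := (@mpolyC (jet_dim L k) K).
Local Notation W := (@jW K L k).
Implicit Types (p q h : J) (x y : 'I_L.+1) (S U : {set 'I_L.+1}).
Implicit Types (s : seq ('I_L.+1 * nat)) (c : nat -> nat).

Definition multilinear U h :=
  (forall x, x \in U -> jlin x h) /\ (forall x, x \notin U -> jfree x h).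

(* The Tanisaki conditions of the partition with columns [c 0], [c 1], ...:   *)
(* the elementary symmetric functions of the copies of the operator [J]       *)
(* acting on the letters of [S] annihilate [h] in large degree.               *)
Definition tanisaki c U h := forall S, S \subset U ->
  (size (jth S h) + #|U :\: S| <= (psum c #|U :\: S|).+1)%N.

Definition wronskian_product M c U h := exists s : nat -> seq ('I_L.+1 * nat),
  [/\ forall m, (m < M)%N -> size (s m) = c m,
      forall y, (\sum_(m < M) count_mem y (unzip1 (s m)) = (y \in U))%N &
      h = \prod_(m < M) W (c m) (s m)].

Lemma multilinearL U a p q : multilinear U p -> multilinear U q -> multilinear U (a *: p + q).
Proof.
move=> [pl pf] [ql qf]; split=> x xU; first by apply: jlinL; [apply: pl|apply: ql].
by apply: jfreeL; [apply: pf|apply: qf].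
Qed.

Lemma tanisakiL c U a p q : tanisaki c U p -> tanisaki c U q -> tanisaki c U (a *: p + q).
Proof.
move=> pT qT S SU; have um := leq_trans (leq_addl _ _) (pT S SU).
rewrite addnC -leq_subRL //.
by apply: size_jthL; rewrite leq_subRL // addnC; [apply: pT|apply: qT].
Qed.

Lemma wronskian_product_multilinear M c U h : (forall m, (c m <= k.+1)%N) ->
  wronskian_product M c U h -> multilinear U h.
Proof.
move=> ck [s [ss sU ->]]; split=> x xU.
  have s1 : (\sum_(m < M) count_mem x (unzip1 (s m)) = 1)%N by rewrite sU xU.
  have [m0 xm0] : exists m0 : 'I_M, count_mem x (unzip1 (s m0)) != 0%N.
    apply/existsP; apply: contra_eqT s1; rewrite negb_exists => /forallP H.
    by rewrite big1 // => m _; apply/eqP; rewrite -[_ == _]negbK.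
  move: s1; rewrite (bigD1 m0) //= => s1.
  have others (m : 'I_M) : m != m0 -> x \notin unzip1 (s m).
    move=> mm0; move: s1; rewrite (bigD1 m) //= -has_pred1 has_count -eqn0Ngt => s1.
    move: s1 xm0; case: (count_mem x (unzip1 (s m0))) => // a.
    by rewrite addSn => -[/eqP]; rewrite !addn_eq0 => /and3P[].
  have xs : x \in unzip1 (s m0) by rewrite -has_pred1 has_count lt0n.
  have [[y b] /= /splitPr sm xy] := mapP xs; rewrite (bigD1 m0) //=.
  case: sm s1 (ss m0 (ltn_ord m0)) => s1 s2; rewrite -xy.
  rewrite /unzip1 map_cat count_cat /= eqxx => s1x sz.
  apply: jlinM; last first.
    by apply: jfree_prod => m mm0; apply: jfree_W; rewrite ?ss ?others.
  rewrite -sz size_cat /= addnS; apply: jlin_W.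
  - by have := ck m0; rewrite -sz size_cat /= addnS.
  - by rewrite size_cat.
  - rewrite /unzip1 map_cat mem_cat negb_or -!has_pred1 !has_count -!eqn0Ngt.
    rewrite -addn_eq0; move: s1x; rewrite addSn addnS addSn => -[/eqP].
    by rewrite addn_eq0 => /andP[].
apply: jfree_prod => m _; apply: jfree_W; first by rewrite ss.
rewrite -has_pred1 has_count -eqn0Ngt.
have /eqP : (\sum_(m < M) count_mem x (unzip1 (s m)) = 0)%N by rewrite sU (negPf xU).
by rewrite (bigD1 m) //= addn_eq0 => /andP[].
Qed.

(** A factor with all its letters in [S] is fixed. Any other factor contributes at most its number
    of letters in [S], hence its whole size once its letters outside [S] are added. There are at
    most #|U :\: S| such factors, so their sizes add up to at most that many of the largest
    parts. *)
Lemma wronskian_product_tanisaki M c U h : noninc c -> (forall m, (c m <= k.+1)%N) ->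
  wronskian_product M c U h -> tanisaki c U h.
Proof.
move=> cn ck [s [ss sU ->]] S SU; rewrite rmorph_prod /=.
pose P (a : 'I_L.+1 * nat) := a.1 \in S.
pose f m := count (predC P) (s m).
pose e m := if f m == 0%N then 0%N else count P (s m).
have fE : #|U :\: S| = (\sum_(m < M) f m)%N.
  rewrite -sum1_card big_mkcond /=.
  transitivity (\sum_(y | y \notin S) \sum_(m < M) count_mem y (unzip1 (s m)))%N.
    rewrite [RHS]big_mkcond; apply: eq_bigr => y _; rewrite finset.in_setD sU.
    by case: (y \in S); case: (y \in U).
  rewrite exchange_big; apply: eq_bigr => m _.
  by rewrite (sum_count_mem (fun y => y \notin S)) count_map.
have le_e (m : 'I_M) : (size (jth S (W (c m) (s m))) <= (e m).+1)%N.
  have sm := ss m (ltn_ord m); rewrite /e; case: eqP => [f0|_]; last first.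
    exact: size_jthW.
  rewrite jthW_all // ?size_polyC_leq1 // => a /[dup] as_ /splitPr; move: f0.
  move=> /eqP; rewrite -leqn0 leqNgt -has_count => /hasPn/(_ a as_).
  by rewrite /= negbK.
have szP : (size (\prod_(m < M) jth S (W (c m) (s m)))%R <= (\sum_(m < M) e m).+1)%N.
  apply: leq_trans (size_prod_leq _ _) _.
  rewrite leq_subLR addnS ltnS card_ord.
  rewrite -[X in (_ <= X + _)%N]muln1 -[X in (_ <= X * _ + _)%N]card_ord -sum_nat_const.
  by rewrite -big_split /=; apply: leq_sum => m _; rewrite add1n le_e.
rewrite fE; apply: leq_trans (leq_add szP (leqnn _)) _; rewrite addSn ltnS -big_split /=.
apply: leq_trans (_ : psum c (\sum_(m < M) (f m != 0%N)) <= _)%N; last first.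
  by apply/psum_mono/leq_sum => m _; case: (f m).
apply: leq_trans (psum_subset (fun m => f m != 0%N) M cn).
rewrite [X in (_ <= X)%N]big_mkcond; apply: leq_sum => m _; rewrite /e.
case: eqP => [->//|_] /=; rewrite -(ss m (ltn_ord m)).
by rewrite /f count_predC.
Qed.

End Decompose.

(** * The Garsia-Procesi induction *)

Section Span.
Variables (K : numFieldType) (L k : nat).
Local Notation J := (jet K L k).
Local Notation X := (@jX K L k).
Local Notation C := (@mpolyC (jet_dim L k) K).
Local Notation W := (@jW K L k).
Implicit Types (p q h : J) (x y : 'I_L.+1) (S U : {set 'I_L.+1}).
Implicit Types (s : seq ('I_L.+1 * nat)) (c : nat -> nat).

Lemma cardsDD1 U x S : S \subset U :\ x -> x \in U ->
  (#|U :\: S| = #|(U :\ x) :\: S|.+1)%N /\ #|U :\: (x |: S)| = #|(U :\ x) :\: S|.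
Proof.
move=> SU xU; split; last by rewrite finset.setDDl.
have xS : x \notin S by apply: contraTN xU => /(fintype.subsetP SU); rewrite !inE eqxx.
rewrite (cardsD1 x (U :\: S)) finset.in_setD xS xU add1n; congr (#|pred_of_set _|.+1).
by apply/finset.setP => y; rewrite !inE andbCA.
Qed.

(** Without higher orders in [x], the derivative by X_x^(a) turns [jth (x |: S) h] into [jth S] of
    the top coefficient, and the complement of [x |: S] in [U] is that of [S] in [U :\ x]. *)
Lemma jth_top_bound c U h x a S : tanisaki c U h -> x \in U -> jlin x h ->
  (forall b, (a < b)%N -> jD x b h = 0) -> S \subset U :\ x ->
  (size (jth S (jD x a h)) + #|(U :\ x) :\: S| <= (psum c #|(U :\ x) :\: S|).+1)%N.
Proof.
move=> hT xU hx ha SU; have [_ <-] := cardsDD1 SU xU.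
have xSU : x |: S \subset U.
  by rewrite finset.subUset finset.sub1set xU (fintype.subset_trans SU) // finset.subsetDl.
apply: leq_trans (hT _ xSU); rewrite leq_add2r.
have := size_mD x a (jth (x |: S) h).
by rewrite mD_jth_lin // (ha a.+1) // rmorph0 mulr0 addr0.
Qed.

(* The coefficients of [h] along the letter [x] satisfy a recursion in the    *)
(* order, through which a top coefficient of maximal degree would force the   *)
(* one of order 0 to have too large a degree.                                 *)
Lemma jth_top_bound_strict c U h x a S (j := #|(U :\ x) :\: S|) :
  tanisaki c U h -> x \in U -> jlin x h ->
  (forall b, (a < b)%N -> jD x b h = 0) -> S \subset U :\ x ->
  (c j <= a)%N -> (j <= psum c j)%N ->
  (size (jth S (jD x a h)) + j <= psum c j)%N.
Proof.
move=> hT xU hx ha SU cj jc; have := jth_top_bound hT xU hx ha SU.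
rewrite -/j leq_eqVlt => /predU1P[szE|]; last by rewrite ltnS.
have [cS cxS] := cardsDD1 SU xU.
have xSU : x |: S \subset U.
  by rewrite finset.subUset finset.sub1set xU (fintype.subset_trans SU) // finset.subsetDl.
have xS : x \notin S by apply/negP => /(fintype.subsetP SU); rewrite !inE eqxx.
pose B := size (jth S (jD x a h)).
have B0 : (0 < B)%N by rewrite -(ltn_add2r j) /B szE add0n ltnS.
have KB b : (size (jth S (jD x b h) + 'X * (b.+1)%:R * jth S (jD x b.+1 h))%R <= B)%N.
  rewrite -mD_jth_lin // (leq_trans (size_mD _ _ _)) //.
  by have := hT _ xSU; rewrite cxS -/j -szE leq_add2r.
(* In [KB] the second summand is one larger than the coefficient of order b+1, too large for the
   bound [B]. The first summand must cancel its top, so sizes grow with each step down. *)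
have Hi i : (i <= a)%N -> (B + i <= size (jth S (jD x (a - i) h)))%N.
  elim: i => [|i IHi] ia; first by rewrite addn0 subn0.
  have {IHi} IH := IHi (ltnW ia); have E : (a - i = (a - i.+1).+1)%N by rewrite subnSK.
  rewrite E in IH; set b := (a - i.+1)%N in IH *.
  set G := jth S (jD x b.+1 h) in IH *; set H := jth S (jD x b h).
  have G0 : G != 0 by rewrite -size_poly_gt0 (leq_trans _ IH) // ltn_addr.
  have : (size ('X * (b.+1)%:R * G)%R <= maxn B (size H))%N.
    rewrite -[_ * G](addKr H) [- H + _]addrC (leq_trans (size_polyD _ _)) // size_polyN.
    by rewrite geq_max !leq_max KB leqnn orbT.
  rewrite size_Xnat // leq_max => /orP[GB|]; last first.
    by apply: leq_trans; rewrite addnS ltnS.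
  by have := leq_trans GB (leq_addr i B); rewrite ltnNge IH.
have SU' : S \subset U by rewrite (fintype.subset_trans SU) // finset.subsetDl.
have := hT S SU'; rewrite cS -/j addnS ltnS psumS => bound.
have := Hi a (leqnn _); rewrite subnn -mD_jth_notin // => Ba.
have := leq_trans Ba (size_mD _ _ _); rewrite -(leq_add2r j) => {}Ba.
have := leq_trans Ba bound; rewrite addnAC szE addSn -addnS leq_add2l.
by rewrite ltnNge cj.
Qed.

(** With offset n - a, the variable X_x^(a) stands in the last row, whose minor is the Wronskian of
    the other columns; a higher order would fall below the matrix. *)
Lemma jD_jW_head_top n x a s : (n <= k)%N -> size s = n -> (a <= n)%N ->
  (forall e, e \in s -> e.1 != x) ->
  jD x a (W n.+1 ((x, (n - a)%N) :: s)) = (n ^_ (n - a))%:R * (-1) ^+ n * W n s.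
Proof.
move=> nk sn an sx; rewrite jD_jW_head // subnKC //.
have n1 : (n < n.+1)%N by [].
rewrite (insubT (fun i => i < n.+1)%N n1) /= -mulrA; congr (_ * (_ * _)).
rewrite jW.unlock; congr (\det _); apply/matrixP => i j; rewrite !mxE /bump.
by rewrite leqNgt ltn_ord.
Qed.

Lemma jD_jW_head_gt n x a b s : (n <= k)%N -> size s = n -> (a <= n)%N -> (a < b)%N ->
  (forall e, e \in s -> e.1 != x) ->
  jD x b (W n.+1 ((x, (n - a)%N) :: s)) = 0.
Proof.
move=> nk sn an ab sx; rewrite jD_jW_head // insubN //.
by rewrite -leqNgt -{1}(subnKC an) ltn_add2r.
Qed.

(** Insert [x] into the factor [m0] with the offset that puts X_x^(a) in its last row, and
    normalise. *)
Lemma wronskian_product_lift M c U x a m0 q : (forall m, (c m <= k.+1)%N) ->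
  (m0 < M)%N -> x \in U -> (a < c m0)%N ->
  wronskian_product M (fun m => (c m - (m == m0))%N) (U :\ x) q ->
  exists z, [/\ lspan (wronskian_product M c U) z, jD x a z = q &
    forall b, (a < b)%N -> jD x b z = 0].
Proof.
move=> ck m0M xU am0 [s [ss sU ->]].
set n := (c m0).-1; have cn : c m0 = n.+1 by rewrite /n prednK // (leq_trans _ am0).
have an : (a <= n)%N by rewrite -ltnS -cn.
have nk : (n <= k)%N by rewrite -ltnS -cn ck.
have sm0 : size (s m0) = n by rewrite ss // eqxx subn1.
pose s' m := if m == m0 then (x, (n - a)%N) :: s m else s m.
have xs m : (m < M)%N -> x \notin unzip1 (s m).
  move=> mM; rewrite -has_pred1 has_count -eqn0Ngt.
  have /eqP : (\sum_(m < M) count_mem x (unzip1 (s m)) = 0)%N by rewrite sU !inE eqxx.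
  by rewrite (bigD1 (Ordinal mM)) //= addn_eq0 => /andP[].
pose R := \prod_(m < M | m != Ordinal m0M) W (c m) (s m).
have Rf : jfree x R.
  apply: jfree_prod => m mm0; apply: jfree_W; last exact: xs.
  by rewrite ss // -val_eqE /= in mm0 *; rewrite (negPf mm0) subn0.
have zE : \prod_(m < M) W (c m) (s' m) = W n.+1 ((x, (n - a)%N) :: s m0) * R.
  rewrite (bigD1 (Ordinal m0M)) //= {1}/s' eqxx cn; congr (_ * _).
  by apply: eq_bigr => m; rewrite -val_eqE /= => mm0; rewrite /s' (negPf mm0).
have qE : \prod_(m < M) W (c m - (m == m0 :> nat))%N (s m) = W n (s m0) * R.
  rewrite (bigD1 (Ordinal m0M)) //= eqxx subn1 -/n; congr (_ * _).
  by apply: eq_bigr => m; rewrite -val_eqE /= => mm0; rewrite (negPf mm0) subn0.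
have s'P : wronskian_product M c U (\prod_(m < M) W (c m) (s' m)).
  exists s'; split=> // [m mM|y].
    rewrite /s'; case: eqVneq => [->|mm0]; first by rewrite /= sm0 cn.
    by rewrite ss // (negPf mm0) subn0.
  rewrite (bigD1 (Ordinal m0M)) //= {1}/s' eqxx /=.
  have := sU y; rewrite (bigD1 (Ordinal m0M)) //= => E.
  transitivity ((x == y) + (y \in U :\ x))%N.
    rewrite -E -addnA; congr (_ + (_ + _))%N; apply: eq_bigr => m.
    by rewrite -val_eqE /= => mm0; rewrite /s' (negPf mm0).
  by rewrite !inE eq_sym; case: eqVneq => [->|_]; rewrite /= ?xU.
have fs e : e \in s m0 -> e.1 != x.
  by move=> es; apply: contraNneq (xs _ m0M) => <-; apply: map_f.
have DW b : jD x b (W n.+1 ((x, (n - a)%N) :: s m0) * R) =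
    jD x b (W n.+1 ((x, (n - a)%N) :: s m0)) * R.
  by rewrite jDM (jD_free b Rf) mulr0 addr0.
pose d : K := (n ^_ (n - a))%:R * (-1) ^+ n.
have d0 : d != 0.
  by rewrite mulf_neq0 ?signr_eq0 // pnatr_eq0 -lt0n ffact_gt0 leq_subr.
exists (d^-1 *: (W n.+1 ((x, (n - a)%N) :: s m0) * R)); split.
- by rewrite -zE; apply/lspanZ/lspan_in.
- rewrite linearZ /= DW jD_jW_head_top // qE -mul_mpolyC.
  have -> : (n ^_ (n - a))%:R * (-1) ^+ n = C d.
    by rewrite /d mpolyCM mpolyC_nat rmorphXn /= rmorphN1.
  by rewrite !mulrA -mpolyCM mulVf // mpolyC1 mul1r.
- by move=> b ab; rewrite linearZ /= DW jD_jW_head_gt // mul0r scaler0.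
Qed.

Lemma lspan_product_multilinear M c U h : (forall m, (c m <= k.+1)%N) ->
  lspan (wronskian_product M c U) h -> multilinear U h.
Proof.
move=> ck; apply: lspan_closed => [|a p q|p].
- by split=> x _; [apply: jlin0|apply: jfree0].
- exact: multilinearL.
- exact: wronskian_product_multilinear.
Qed.

Lemma lspan_product_tanisaki M c U h : noninc c -> (forall m, (c m <= k.+1)%N) ->
  (#|U| <= psum c M)%N -> (forall m, (M <= m)%N -> c m = 0%N) ->
  lspan (wronskian_product M c U) h -> tanisaki c U h.
Proof.
move=> cn ck UM c0; apply: lspan_closed => [|a p q|p].
- move=> S SU; rewrite rmorph0 size_poly0 add0n leqW // (psum_ge cn c0) //.
  by rewrite (leq_trans _ UM) // subset_leq_card // finset.subsetDl.
- exact: tanisakiL.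
- exact: wronskian_product_tanisaki.
Qed.

Lemma last_large_column c a M : noninc c -> (forall m, (M <= m)%N -> c m = 0%N) ->
  (a < c 0)%N -> exists m0, [/\ (m0 < M)%N, (a < c m0)%N & (c m0.+1 <= a)%N].
Proof.
move=> cn c0; case: M c0 => [c0|M c0 ca]; first by rewrite c0.
have : exists m, (c m <= a)%N by exists M.+1; rewrite c0.
case/ex_minnP => [[|m]]; first by rewrite leqNgt ca.
move=> cm min; have am : (a < c m)%N.
  by rewrite ltnNge; apply/negP => /min; rewrite ltnn.
exists m; split=> //; rewrite ltnNge; apply/negP => /c0 cm0.
by rewrite cm0 in am.
Qed.

Lemma multilinear_jD U x a h : x \in U -> multilinear U h -> multilinear (U :\ x) (jD x a h).
Proof.
move=> xU [hl hf]; split=> y; rewrite !inE; first by case/andP=> yx yU; apply: jlin_jD; [rewrite eq_sym|apply: hl].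
case: eqVneq => [-> _|yx /= yU]; first by have [] := hl x xU.
by apply/jfree_jD/hf.
Qed.

(** Remove a letter [x]. Its coefficient of top order [a] satisfies the conditions of a partition
    with one box less, hence is a combination of products. These lift to products containing [x]
    with the same top coefficient, and subtracting them lowers the order in [x]. *)
Lemma tanisaki_span M n : forall U c h, #|U| = n -> noninc c ->
  (forall m, (M <= m)%N -> c m = 0%N) -> psum c M = n -> (forall m, (c m <= k.+1)%N) ->
  multilinear U h -> tanisaki c U h -> lspan (wronskian_product M c U) h.
Proof.
elim: n => [|n IHn] U c h Un cn c0 cM ck hml hT.
  have U0 x : x \notin U by apply: contra_eqN Un => xU; rewrite -lt0n (cardD1 x) xU.
  have [b ->] := jfree_const (fun x => hml.2 x (U0 x)).
  rewrite -[C b]mulr1 mul_mpolyC; apply/lspanZ/lspan_in; exists (fun=> [::]).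
  have cm0 m : (m < M)%N -> c m = 0%N.
    move=> mM; have /eqP := cM; rewrite /psum (bigD1 (Ordinal mM)) //= addn_eq0.
    by case/andP=> /eqP.
  split=> [m /cm0 -> //|y|]; first by rewrite (negPf (U0 y)) big1.
  by rewrite big1 // => m _; rewrite cm0 // jW.unlock det_mx00.
have [x xU] : exists x, x \in U by apply/set0Pn; rewrite -cards_eq0 Un.
have Ux : #|U :\ x| = n by apply/eqP; rewrite -eqSS -Un (cardsD1 x U) xU.
suff main a : forall h, multilinear U h -> tanisaki c U h ->
    (forall b, (a <= b)%N -> jD x b h = 0) -> lspan (wronskian_product M c U) h.
  apply: (main k.+1) => // b kb; by rewrite /jD leqNgt kb.
elim: a => [|a IHa] {}h {}hml {}hT ha.
  rewrite (hml.1 x xU).2 big1 => [|b _]; first exact: lspan0.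
  by rewrite ha // mulr0.
have hx := hml.1 x xU.
have UM : (#|U| <= psum c M)%N by rewrite Un cM.
have jc S : (#|(U :\ x) :\: S| <= psum c #|(U :\ x) :\: S|)%N.
  apply: (psum_ge cn c0); rewrite cM -Ux leqW // subset_leq_card //.
  exact: finset.subsetDl.
(* If [a] is at least the largest part, the strict bound for the full set [U :\ x] leaves size 0:
   the coefficient vanishes. *)
have [ca|ca] := leqP (c 0%N) a.
  apply: IHa => // b; rewrite leq_eqVlt => /predU1P[<-|ab]; last exact: ha.
  have := jth_top_bound_strict hT xU hx ha (fintype.subxx _).
  rewrite finset.setDv cards0 /psum big_ord0 addn0 leqn0 => /(_ ca isT).
  rewrite leqn0 size_poly_eq0 => /eqP g0.
  by rewrite -[jD x a h](horner0_jth (U :\ x)) g0 horner0.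
have [m0 [m0M am0 am1]] := last_large_column cn c0 ca.
(* The box leaves the last part larger than [a], so the parts stay nonincreasing. The partial sums
   drop exactly beyond [m0], where the parts are at most [a] and the strict bound applies. *)
pose nu m := (c m - (m == m0))%N.
have nuE j : (psum nu j + (m0 < j) = psum c j)%N.
  elim: j => [|j IHj]; first by rewrite /psum !big_ord0.
  rewrite !psumS -IHj {2}/nu ltnS leq_eqVlt eq_sym.
  case: eqVneq => [<-|_] /=; last by rewrite subn0 addnAC.
  by rewrite ltnn addn0 -addnA subnK // (leq_trans _ am0).
have nun : noninc nu.
  move=> m; rewrite /nu; case: (eqVneq m m0) => [->|mm0] /=.
    rewrite gtn_eqF // subn0 subn1 -ltnS prednK; last by rewrite (leq_trans _ am0).
    exact: leq_ltn_trans am1 am0.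
  by rewrite subn0 (leq_trans (leq_subr _ _)).
have nu0 m : (M <= m)%N -> nu m = 0%N by move=> /c0 cm; rewrite /nu cm.
have nuM : psum nu M = n.
  by apply/eqP; rewrite -eqSS -cM -nuE m0M addn1.
have nuk m : (nu m <= k.+1)%N by rewrite (leq_trans (leq_subr _ _)).
have gT : tanisaki nu (U :\ x) (jD x a h).
  move=> S SU; have := nuE #|(U :\ x) :\: S|; set j := #|_|.
  case: ltnP => m0j; rewrite ?addn1 ?addn0 => E.
    rewrite E; apply: jth_top_bound_strict hT xU hx ha SU _ (jc S).
    exact: leq_trans (noninc_le cn m0j) am1.
  by rewrite E; apply: jth_top_bound hT xU hx ha SU.
have gspan := IHn _ _ _ Ux nun nu0 nuM nuk (multilinear_jD a xU hml) gT.
have [z [zs zE z0]] : exists z, [/\ lspan (wronskian_product M c U) z,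
    jD x a z = jD x a h & forall b, (a < b)%N -> jD x b z = 0].
  elim: gspan => [|b y t yP _ [z [zs zE z0]]].
    by exists 0; split=> [||b _]; rewrite ?linear0 //; apply: lspan0.
  have [z' [zs' zE' z0']] := wronskian_product_lift ck m0M xU am0 yP.
  exists (b *: z' + z); split=> [||e ae]; first by apply/lspanD/zs/lspanZ.
    by rewrite linearP /= zE' zE.
  by rewrite linearP /= z0' // z0 // scaler0 addr0.
have zml := lspan_product_multilinear ck zs.
have zT := lspan_product_tanisaki cn ck UM c0 zs.
rewrite -[h](subrK z); apply: lspanD => //.
have hz : h - z = (-1) *: z + h by rewrite scaleN1r addrC.
apply: IHa => [||b].
- by rewrite hz; apply: multilinearL.
- by rewrite hz; apply: tanisakiL.
rewrite leq_eqVlt linearB /= => /predU1P[<-|ab]; first by rewrite zE subrr.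
by rewrite ha // z0 // subrr.
Qed.

End Span.

(** * Polarisation *)

Inductive galg (K : pzRingType) (A : lalgType K) (G : A -> Prop) : A -> Prop :=
| galg_in x : G x -> galg G x
| galg1 : galg G 1
| galgL a x y : galg G x -> galg G y -> galg G (a *: x + y)
| galgM x y : galg G x -> galg G y -> galg G (x * y).

Section Galg.
Variables (K : pzRingType) (A : lalgType K) (G : A -> Prop).

Lemma galg0 : galg G 0.
Proof. by rewrite -(subrr 1) -scaleN1r addrC; apply: galgL; apply: galg1. Qed.

Lemma galgZ a x : galg G x -> galg G (a *: x).
Proof. by move=> Gx; rewrite -[_ *: x]addr0; apply: galgL => //; apply: galg0. Qed.

Lemma galg_lspan (P : A -> Prop) x :
  (forall y, P y -> galg G y) -> lspan P x -> galg G x.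
Proof.
move=> PG; apply: lspan_closed => //; first exact: galg0.
by move=> a y z; apply: galgL.
Qed.

Lemma galg_prod I (r : seq I) (Q : pred I) (F : I -> A) :
  (forall i, Q i -> galg G (F i)) -> galg G (\prod_(i <- r | Q i) F i).
Proof. by move=> GF; elim/big_ind: _ => //; [apply: galg1|apply: galgM]. Qed.

Lemma galg_sum I (r : seq I) (Q : pred I) (F : I -> A) :
  (forall i, Q i -> galg G (F i)) -> galg G (\sum_(i <- r | Q i) F i).
Proof.
move=> GF; elim/big_ind: _ => //; first exact: galg0.
by move=> x y Gx Gy; rewrite -[x]scale1r; apply: galgL.
Qed.

End Galg.

Lemma galg_trans (K : pzRingType) (A : lalgType K) (G G' : A -> Prop) x :
  (forall y, G y -> galg G' y) -> galg G x -> galg G' x.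
Proof.
move=> GG'; elim=> [y /GG' //||a y z _ ? _ ?|y z _ ? _ ?].
- exact: galg1.
- exact: galgL.
- exact: galgM.
Qed.

Section Polarization.
Variables (K : numFieldType) (k : nat).
Local Notation X := (@jX K _ k).
Local Notation C := (@mpolyC (jet_dim _ k) K).
Local Notation W := (@jW K _ k).

Definition is_wronskian L m (x : jet K L k) :=
  exists n s, [/\ (n <= m)%N, size s = n & x = W n s].

Section Fixed.
Variable L : nat.
Local Notation J := (jet K L k).
Implicit Types (p q h : J) (x y : 'I_L.+1) (S U : {set 'I_L.+1}).

Lemma size_Xnat_leq b (u : {poly J}) : (size ('X * (b.+1)%:R * u)%R <= (size u).+1)%N.
Proof.
by have [->|u0] := eqVneq u 0; [rewrite mulr0 size_poly0|rewrite size_Xnat].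
Qed.

(** Removing a letter from the set raises the degree by at most [kap]. The top coefficient in that
    letter keeps the previous bound, and by [mD_jth_lin] each lower order costs at most one more. *)
Lemma size_jth_order kap U h : (kap <= k)%N -> (forall x, x \in U -> jlin x h) ->
  (forall x b, (kap < b)%N -> jD x b h = 0) -> jth U h = h%:P ->
  forall n S, S \subset U -> #|U :\: S| = n -> (size (jth S h) <= (n * kap).+1)%N.
Proof.
move=> kapk hl ho hU; elim=> [|n IHn] S SU USn.
  have -> : S = U.
    apply/eqP; rewrite finset.eqEsubset SU -finset.setD_eq0 -cards_eq0.
    by rewrite USn.
  by rewrite hU size_polyC_leq1.
have [x] : exists x, x \in U :\: S by apply/set0Pn; rewrite -cards_eq0 USn.
rewrite finset.in_setD => /andP[xS xU].
have xSU : x |: S \subset U by rewrite finset.subUset finset.sub1set xU.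
have US' : #|U :\: (x |: S)| = n.
  have SUx : S \subset U :\ x.
    by apply/fintype.subsetP => y yS; rewrite !inE (fintype.subsetP SU) // andbT; apply: contraNneq xS => <-.
  by have [E ->] := cardsDD1 SUx xU; apply/eqP; rewrite -eqSS -E USn.
have hx := hl x xU.
have KB b : (size (jth S (jD x b h) + 'X * (b.+1)%:R * jth S (jD x b.+1 h))%R <= (n * kap).+1)%N.
  by rewrite -mD_jth_lin // (leq_trans (size_mD _ _ _)) // IHn.
have Hi i : (i <= kap)%N -> (size (jth S (jD x (kap - i) h)) <= (n * kap + i).+1)%N.
  elim: i => [|i IHi] ik.
    by have := KB kap; rewrite (ho x kap.+1) // rmorph0 mulr0 addr0 subn0 addn0.
  have E : (kap - i = (kap - i.+1).+1)%N by rewrite subnSK.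
  have := IHi (ltnW ik); rewrite E; set b := (kap - i.+1)%N => IH.
  rewrite -[jth S (jD x b h)](addrK ('X * (b.+1)%:R * jth S (jD x b.+1 h))).
  rewrite (leq_trans (size_polyD _ _)) // size_polyN geq_max.
  rewrite (leq_trans (KB b)) ?ltnS ?leq_addr //=.
  by rewrite (leq_trans (size_Xnat_leq _ _)) // addnS ltnS.
rewrite {1}hx.2 rmorph_sum /= (leq_trans (size_sum _ _ _)) //.
apply/bigmax_leqP => b _; have bk : (b <= k)%N by rewrite -ltnS.
rewrite rmorphM /= (jthX K S x bk) (negPf xS) mul0r mulr0 addr0 mul_polyC.
apply: leq_trans (size_scale_leq _ _) _.
have [bkap|] := leqP b kap; last by move=> kb; rewrite ho // rmorph0 size_poly0.
rewrite -(subKn bkap); apply: leq_trans (Hi _ (leq_subr _ _)) _.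
by rewrite ltnS mulSn addnC leq_add2r leq_subr.
Qed.

Lemma size_jth_card n : forall S h, #|S| = n -> (forall x, x \in S -> jlin x h) ->
  (size (jth S h) <= n.+1)%N.
Proof.
elim: n => [|n IHn] S h Sn hl.
  have -> : jth S h = h%:P; last exact: size_polyC_leq1.
  apply: jet_hom_ext => [c|i j jk]; first exact: jthC.
  rewrite [LHS](jthX K S i jk) [_ \in _](_ : _ = false) ?mul0r ?mulr0 ?addr0 //.
  by apply: contra_eqF Sn => iS; rewrite (cardD1 i) iS.
have [x xS] : exists x, x \in S by apply/set0Pn; rewrite -cards_eq0 Sn.
have Sx : #|S :\ x| = n by apply/eqP; rewrite -eqSS -Sn (cardsD1 x S) xS.
rewrite {1}(hl x xS).2 rmorph_sum /= (leq_trans (size_sum _ _ _)) //.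
apply/bigmax_leqP => b _; have bk : (b <= k)%N by rewrite -ltnS.
rewrite rmorphM /= -{2}(finset.setD1K xS) jth_free; last exact: (hl x xS).1.
apply: leq_trans (size_polyMleq _ _) _; rewrite -subn1 leq_subLR add1n.
have : (size (jth (S :\ x) (jD x b h)) <= n.+1)%N.
  apply: IHn => // y; rewrite !inE => /andP[yx yS].
  by apply: jlin_jD; [rewrite eq_sym|exact: hl].
move=> H; rewrite -[n.+3]/(2 + n.+1)%N leq_add // (jthX K S x bk).
rewrite (leq_trans (size_polyD _ _)) // geq_max (leq_trans (size_polyC_leq1 _)) //=.
by rewrite mulrC mul_polyC (leq_trans (size_scale_leq _ _)) // size_polyX.
Qed.

Lemma multilinear_galg kap U h : (kap <= k)%N -> multilinear U h ->
  (forall x b, (kap < b)%N -> jD x b h = 0) -> jth U h = h%:P ->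
  galg (is_wronskian kap.+1) h.
Proof.
move=> kapk [hl hf] ho hU; set n := #|U|.
(* The parts are kap+1, ..., kap+1 and a remainder. The minimum of j (kap+1) and n as partial sum
   matches the two degree bounds: [size_jth_order], and at most one factor t for each letter. *)
pose c m := minn kap.+1 (n - m * kap.+1)%N.
have cE j : psum c j = minn (j * kap.+1) n.
  elim: j => [|j IHj]; first by rewrite /psum big_ord0 min0n.
  rewrite psumS IHj /c mulSn; clear; move: (j * kap.+1)%N => a; lia.
have cn : noninc c.
  by move=> m; rewrite /c mulSn; clear; move: (m * kap.+1)%N => a; lia.
have ck m : (c m <= k.+1)%N by rewrite geq_min ltnS kapk.
have c0 m : (n <= m)%N -> c m = 0%N.
  move=> nm; rewrite /c (_ : (n - m * kap.+1 = 0)%N) ?minn0 //.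
  by apply/eqP; rewrite subn_eq0 (leq_trans nm) // mulnS leq_addr.
have cM : psum c n = n by rewrite cE; apply/minn_idPr; rewrite mulnS leq_addr.
have hT : tanisaki c U h.
  move=> S SU; rewrite cE; have := size_jth_order kapk hl ho hU SU erefl.
  have := @size_jth_card #|S| S h erefl (fun x xS => hl x (fintype.subsetP SU x xS)).
  have Sn : (#|S| + #|U :\: S| = n)%N.
    by rewrite /n -(cardsID S U) (finset.setIidPr SU).
  rewrite -Sn; move: #|S| #|U :\: S| => a b; move: (size _) => z; clear.
  by rewrite mulnS; lia.
apply: galg_lspan (tanisaki_span erefl cn c0 cM ck (conj hl hf) hT).
move=> _ [s [ss _ ->]]; apply: galg_prod => m _; apply: galg_in.
by exists (c m), (s m); split; rewrite ?ss // /c geq_minl.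
Qed.

End Fixed.
End Polarization.

(** * Renaming letters and reduction to the multilinear case *)

Section Renaming.
Variables (K : numFieldType) (k : nat).
Local Notation X := (@jX K _ k).
Local Notation W := (@jW K _ k).

Definition jren L L' (w : 'I_L.+1 -> 'I_L'.+1) : jet K L k -> jet K L' k :=
  jsub (@mpolyC (jet_dim L' k) K) (fun i j => X (w i) j).
HB.instance Definition _ L L' w := GRing.RMorphism.on (@jren L L' w).

Lemma jrenC L L' (w : 'I_L.+1 -> 'I_L'.+1) c : jren w c%:MP = c%:MP.
Proof. exact: jsubC. Qed.

Lemma jrenX L L' (w : 'I_L.+1 -> 'I_L'.+1) i j : (j <= k)%N -> jren w (X i j) = X (w i) j.
Proof. exact: jsubX. Qed.

Lemma jrenZ L L' (w : 'I_L.+1 -> 'I_L'.+1) c p : jren w (c *: p) = c *: jren w p.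
Proof. by rewrite -!mul_mpolyC rmorphM /= jrenC. Qed.

Lemma jrenW L L' (w : 'I_L.+1 -> 'I_L'.+1) n s : (n <= k.+1)%N -> size s = n ->
  jren w (W n s) = W n [seq (w c.1, c.2) | c <- s].
Proof.
move=> nk sn; rewrite !jW.unlock -det_map_mx; congr (\det _).
apply/matrixP => r l; rewrite !mxE (nth_map (ord0, 0%N)) ?sn // /jE /=.
set c := nth _ _ _; have rk : (r - c.2 <= k)%N.
  by rewrite (leq_trans (leq_subr _ _)) // -ltnS (leq_trans (ltn_ord r)).
by rewrite rmorphM rmorph_nat /= (jrenX _ _ rk).
Qed.

Lemma jren_galg L L' (w : 'I_L.+1 -> 'I_L'.+1) m p : (m <= k.+1)%N ->
  galg (@is_wronskian K k L m) p -> galg (@is_wronskian K k L' m) (jren w p).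
Proof.
move=> mk; elim=> [_ [n [s [nm sn ->]]]||a x y _ Hx _ Hy|x y _ Hx _ Hy].
- rewrite jrenW // ?(leq_trans nm) //; apply: galg_in; exists n, [seq (w c.1, c.2) | c <- s].
  by rewrite size_map.
- by rewrite rmorph1; apply: galg1.
- by rewrite rmorphD /= jrenZ; apply: galgL.
- by rewrite rmorphM; apply: galgM.
Qed.

Section Fixed.
Variable L : nat.
Local Notation J := (jet K L k).
Local Notation C := (@mpolyC (jet_dim L k) K).
Implicit Types (p q h : J) (x y m i : 'I_L.+1) (S U O F : {set 'I_L.+1}).

(** The polarisation operator: the derivation replacing the letter [i] by [m], one occurrence at a
    time. *)
Definition jpol m i q : J := \sum_(b < k.+1) X m b * jD i b q.

Lemma jpol_is_linear m i : linear (jpol m i).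
Proof.
move=> a p q; rewrite /jpol scaler_sumr -big_split; apply: eq_bigr => b _ /=.
by rewrite linearP /= mulrDr scalerAr.
Qed.
HB.instance Definition _ m i := GRing.isLinear.Build K J J _ (jpol m i) (jpol_is_linear m i).

Lemma jpolM m i p q : jpol m i (p * q) = jpol m i p * q + p * jpol m i q.
Proof.
rewrite /jpol mulr_suml mulr_sumr -big_split; apply: eq_bigr => b _ /=.
by rewrite jDM mulrDr mulrA; congr (_ + _); rewrite mulrCA.
Qed.

Lemma jpolC m i c : jpol m i (C c) = 0.
Proof. by rewrite /jpol big1 // => b _; rewrite jDC mulr0. Qed.

Lemma jpol_nat m i n : jpol m i n%:R = 0.
Proof. by rewrite -mpolyC_nat jpolC. Qed.

Lemma jpolX m i i' j : (j <= k)%N -> jpol m i (X i' j) = (i == i')%:R * X m j.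
Proof.
move=> jk; rewrite /jpol (bigD1 (Ordinal (jk : j < k.+1)%N)) //= jDX // eqxx andbT.
rewrite big1 ?addr0 => [|b bj]; first by rewrite mulrC.
by rewrite -val_eqE /= in bj; rewrite jDX // (negPf bj) andbF mulr0.
Qed.

Lemma jth_jpol m i q : jth [set: 'I_L.+1] q = q%:P -> jth [set: 'I_L.+1] (jpol m i q) = (jpol m i q)%:P.
Proof.
move=> qE; pose D : {poly J} -> {poly J} := map_poly (jpol m i).
have DM : forall u v, D (u * v) = D u * v + u * D v.
  exact: (map_poly_derivation (@jpolM m i)).
have DC (u : J) : D u%:P = (jpol m i u)%:P by apply: map_polyC.
have DX : D 'X = 0.
  by apply/polyP => j; rewrite coef_map coefX coef0 /= jpol_nat.
have DD : forall u v, D (u + v) = D u + D v by move=> u v; rewrite /D raddfD.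
have D0 c : D (jth [set: 'I_L.+1] (C c)) = 0 by rewrite jthC DC jpolC.
have E i' b : (b <= k)%N -> D (jth [set: 'I_L.+1] (X i' b)) =
    ((i == i')%:R)%:P * jth [set: 'I_L.+1] (X m b).
  move=> bk; have bk' := leq_trans (leq_pred b) bk.
  rewrite (jthX K _ i' bk) (jthX K _ m bk) !finset.in_setT !mul1r DD DM DX mul0r add0r !DC.
  rewrite jpolM jpol_nat mul0r add0r (jpolX m i i' bk) (jpolX m i i' bk').
  by rewrite mulrDr polyCM; congr (_ + _); rewrite [RHS]mulrCA -polyCM mulrCA.
have := chain_rule DD DM D0 q; rewrite /= qE DC => ->.
rewrite (bigD1 i) //= [X in _ + X]big1 ?addr0 => [|i' ii'].
  rewrite /jpol rmorph_sum; apply: eq_bigr => b _; have bk : (b <= k)%N by rewrite -ltnS.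
  rewrite rmorphM /= mulrC; congr (_ * _).
  by rewrite E // eqxx mul1r.
rewrite big1 // => b _; have bk : (b <= k)%N by rewrite -ltnS.
by rewrite (E i' b bk) eq_sym (negPf ii') mulr0n polyC0 mul0r mulr0.
Qed.

(** The exponent of t records the total degree in the letters of [O]. *)
Definition jscale O : J -> {poly J} :=
  jpoly (fun i j => if i \in O then 'X * (X i j)%:P else (X i j)%:P).
HB.instance Definition _ O := GRing.RMorphism.on (jscale O).

Lemma jscaleC O c : jscale O (C c) = (C c)%:P. Proof. exact: jpolyC. Qed.
Lemma jscaleX O i j : (j <= k)%N ->
  jscale O (X i j) = if i \in O then 'X * (X i j)%:P else (X i j)%:P.
Proof. exact: jsubX. Qed.

Lemma mD_jscale O i b q : i \in O -> mD i b (jscale O q) = 'X * jscale O (jD i b q).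
Proof.
move=> iO; have D0 c : mD i b (jscale O (C c)) = 0 by rewrite jscaleC mDC jDC.
have := chain_rule (raddfD (mD i b)) (@mDM K L k i b) D0 q => /= ->.
have E i' (j : 'I_k.+1) : mD i b (jscale O (X i' j)) = 'X * ((i == i')%:R * (b == j :> nat)%:R).
  have jk : (j <= k)%N by rewrite -ltnS.
  rewrite (jscaleX O i' jk); case: eqVneq => [<-|ii'].
    by rewrite iO mDM mDX mul0r add0r mDC jDX // eqxx mul1r polyC_natr.
  case: ifP => _; first rewrite mDM mDX mul0r add0r.
    by rewrite mDC jDX // (negPf ii') mulr0n polyC0 mul0r.
  by rewrite mDC jDX // (negPf ii') mulr0n polyC0 mul0r mulr0.
under eq_bigr => i' _ do under eq_bigr => j _ do rewrite E.
rewrite (bigD1 i) //= [X in _ + X]big1 ?addr0 => [|i' ii'].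
  under eq_bigr => j _ do rewrite eqxx mul1r mulrCA.
  rewrite -mulr_sumr (sum_delta (F := fun j => jscale O (jD i j q))) // => j kj.
  by rewrite /jD leqNgt kj rmorph0.
by rewrite big1 // => j _; rewrite eq_sym (negPf ii') mul0r !mulr0.
Qed.

Lemma jscale_jD O i b e q : i \in O -> jscale O q = 'X^(e.+1) * q%:P ->
  jscale O (jD i b q) = 'X^e * (jD i b q)%:P.
Proof.
move=> iO qE; have D0 : @mD K L k i b 'X^(e.+1) = 0.
  by apply/polyP => j; rewrite coef_map coefXn coef0 /= jD_nat.
apply: (mulfI (negbT (polyX_eq0 J))); rewrite -(mD_jscale b q iO) qE.
rewrite (mDM i b 'X^(e.+1) q%:P) D0 mul0r add0r mDC.
by rewrite (exprS 'X e) -mulrA.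
Qed.

(** Euler's identity: differentiate by t at t = 1. *)
Lemma jscale_euler O e q : jscale O q = 'X^e * q%:P ->
  \sum_(i in O) jpol i i q = e%:R *: q.
Proof.
move=> qE; have D0 c : (jscale O (C c))^`() = 0 by rewrite jscaleC derivC.
have := chain_rule (@derivD _) (@derivM _) D0 q.
rewrite /= qE derivM derivC mulr0 addr0 derivXn => /(congr1 (fun u : {poly J} => u.[1])).
have s1 r : (jscale O r).[1] = r.
  rewrite -[LHS]/((horner_eval 1 \o jscale O) r) -[RHS]/(idfun r).
  apply: jet_hom_ext => [c|i j jk] /=; first by rewrite jscaleC /horner_eval hornerC.
  by rewrite (jscaleX O i jk) /horner_eval; case: ifP; rewrite ?hornerM ?hornerX hornerC ?mul1r.
rewrite hornerM hornerMn hornerXn expr1n hornerC -mul_mpolyC mpolyC_nat => ->.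
rewrite horner_sum big_mkcond; apply: eq_bigr => i _; rewrite horner_sum /jpol.
case: ifP => iO; last first.
  rewrite big1 // => b _; have bk : (b <= k)%N by rewrite -ltnS.
  by rewrite (jscaleX O i bk) iO derivC mulr0 horner0.
apply: eq_bigr => b _; have bk : (b <= k)%N by rewrite -ltnS.
by rewrite (jscaleX O i bk) iO derivM derivX derivC mulr0 addr0 mul1r hornerM s1 hornerC mulrC.
Qed.

Lemma jscale_free O x q : x \in O -> jscale O q = q%:P -> jfree x q.
Proof.
move=> xO qE; have q0 : jzero (fun i => i \in O) q = q.
  transitivity (jscale O q).[0]; last by rewrite qE hornerC.
  rewrite -[RHS]/((horner_eval 0 \o jscale O) q); apply: jet_hom_ext => [c|i j jk].
    by rewrite /= jzeroC jscaleC /horner_eval hornerC.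
  rewrite /= (jscaleX O i jk) (jzeroX K _ i jk) /horner_eval.
  by case: ifP; rewrite ?hornerM ?hornerX hornerC ?mul0r.
rewrite /jfree -{1}q0 -[LHS]/((jzero (pred1 x) \o jzero (fun i => i \in O)) q) -[RHS]q0.
apply: jet_hom_ext => [c|i j jk] /=; first by rewrite !jzeroC.
rewrite (jzeroX K _ i jk); case: ifP => [_|iO]; first exact: rmorph0.
rewrite (jzeroX K _ i jk) /=; case: eqVneq => // ix.
by rewrite ix xO in iO.
Qed.

Lemma jren_free (w : 'I_L.+1 -> 'I_L.+1) x q : jfree x q ->
  (forall y, y != x -> w y = y) -> jren w q = q.
Proof.
move=> qf wE; rewrite -{1}qf -[LHS]/((jren w \o jzero (pred1 x)) q) -[RHS]qf.
apply: jet_hom_ext => [c|i j jk] /=; first by rewrite jzeroC jrenC.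
rewrite (jzeroX K _ i jk) /=; case: eqVneq => [_|ix]; first exact: rmorph0.
by rewrite jrenX ?wE.
Qed.

Lemma polarized_galg kap e : (kap <= k)%N -> forall O U F q,
  (forall x, [|| x \in O, x \in U | x \in F]) ->
  (forall x, x \in F -> (x \notin O) && (x \notin U)) ->
  (forall x, x \in U -> x \notin O) -> (e <= #|F|)%N ->
  (forall x, x \in U -> jlin x q) -> (forall x, x \in F -> jfree x q) ->
  jscale O q = 'X^e * q%:P -> jth [set: 'I_L.+1] q = q%:P ->
  (forall x b, (kap < b)%N -> jD x b q = 0) -> galg (@is_wronskian K k L kap.+1) q.
Proof.
move=> kapk; elim: e => [|e IHe] O U F q cov dF dU eF ql qf qE qth qo.
  rewrite expr0 mul1r in qE.
  have qU x : x \notin U -> jfree x q.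
    move=> xU; have := cov x; rewrite (negPf xU) /= => /orP[xO|xF]; last exact: qf.
    exact: jscale_free xO qE.
  have z0 : jzero (fun x => x \notin U) q = q by apply: jzero_free.
  have hU : jth U q = q%:P.
    rewrite -qth -z0 -[LHS]/((jth U \o jzero (fun x => x \notin U)) q).
    rewrite -[RHS]/((jth [set: 'I_L.+1] \o jzero (fun x => x \notin U)) q).
    apply: jet_hom_ext => [c|i j jk] /=; first by rewrite jzeroC (jthC k U) (jthC k [set: 'I_L.+1]).
    rewrite (jzeroX K _ i jk); case: (boolP (i \in U)) => [iU|_] /=.
      by rewrite (jthX K U i jk) (jthX K [set: 'I_L.+1] i jk) iU finset.in_setT.
    by rewrite (rmorph0 (jth U)) (rmorph0 (jth [set: 'I_L.+1])).
  exact: (multilinear_galg kapk (conj ql qU) qo hU).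
have [m mF] : exists m, m \in F by apply/set0Pn; rewrite -cards_eq0 -lt0n (leq_trans _ eF).
have /andP[mO mU] := dF m mF.
have step i : i \in O -> galg (@is_wronskian K k L kap.+1) (jpol m i q).
  move=> iO; have im : i != m by apply: contraNneq mO => <-.
  apply: (IHe O (m |: U) (F :\ m)) => [x|x|x||x|x||| x b kb].
  - by rewrite !inE; case: eqVneq => _ /=; [rewrite orbT|exact: cov].
  - by rewrite !inE => /andP[xm /dF/andP[-> xU]]; rewrite (negPf xm) (negPf xU).
  - by rewrite !inE => /predU1P[->//|]; apply: dU.
  - by rewrite -ltnS (leq_trans eF) // (cardsD1 m F) mF.
  - rewrite !inE => /predU1P[->|xU].
      apply: jlin_sum => b _; apply: jlinM; first exact: jlinX.
      by apply/jfree_jD/qf.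
    apply: jlin_sum => b _; rewrite mulrC; apply: jlinM.
      apply: jlin_jD; last exact: ql.
      by apply: contraTneq iO => ->; apply: dU.
    by apply: jfreeX; apply: contraNneq mU => ->.
  - rewrite !inE => /andP[xm xF]; apply: jfree_sum => b _; apply: jfreeM.
      by apply: jfreeX; rewrite eq_sym.
    by apply/jfree_jD/qf.
  - rewrite /jpol rmorph_sum (rmorph_sum (@polyC J)) mulr_sumr; apply: eq_bigr => b _.
    have bk : (b <= k)%N by rewrite -ltnS.
    by rewrite !rmorphM /= (jscaleX O m bk) (negPf mO) (jscale_jD _ iO qE) mulrCA.
  - exact: jth_jpol.
  - rewrite linear_sum big1 // => c _; have ck : (c <= k)%N by rewrite -ltnS.
    rewrite /= jDM (jDX K x b m ck) jD_comm (qo x b kb) linear0 mulr0 addr0.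
    have [bc|bc] := eqVneq b c; last by rewrite andbF mul0r.
    by rewrite -bc (qo i b kb) mulr0.
pose w i y := if y == m then i else y.
have wE i : i \in O -> jren (w i) (jpol m i q) = jpol i i q.
  move=> iO; rewrite rmorph_sum; apply: eq_bigr => b _; have bk : (b <= k)%N by rewrite -ltnS.
  rewrite rmorphM /= (jrenX _ _ bk) {1}/w eqxx; congr (_ * _).
  apply: (@jren_free _ m); first by apply/jfree_jD/qf.
  by move=> y ym; rewrite /w (negPf ym).
have -> : q = (e.+1%:R)^-1 *: \sum_(i in O) jpol i i q.
  by rewrite (jscale_euler qE) scalerA mulVf ?scale1r // pnatr_eq0.
apply/galgZ/galg_sum => i iO; rewrite -wE //.
by apply: jren_galg; [rewrite ltnS|apply: step].
Qed.

End Fixed.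

Lemma jinv_galg L d kap (p : jet K L k) : (kap <= k)%N -> jinv d p ->
  (forall x b, (kap < b)%N -> jD x b p = 0) -> galg (@is_wronskian K k L kap.+1) p.
Proof.
move=> kapk Hp po.
(* One fresh letter is added for each unit of degree; [r] is a retraction onto the original
   letters. *)
have LL : (L.+1 <= (L + d).+1)%N by rewrite ltnS leq_addr.
pose w : 'I_L.+1 -> 'I_(L + d).+1 := widen_ord LL.
pose r (i : 'I_(L + d).+1) : 'I_L.+1 := inord i.
have wK i : r (w i) = i by exact: inord_val.
have winj : injective w by move=> i j E; rewrite -(wK i) E wK.
have -> : p = jren r (jren w p).
  rewrite -[LHS]/(idfun p) -[RHS]/((jren r \o jren w) p).
  apply: jet_hom_ext => [c|i j jk] /=; first by rewrite !jrenC.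
  by rewrite !jrenX // wK.
apply: jren_galg; first by rewrite ltnS.
pose O : {set 'I_(L + d).+1} := [set w i | i : 'I_L.+1]%SET.
have wO i : w i \in O by apply: imset_f.
apply: (@polarized_galg (L + d) kap d kapk O finset.set0 (~: O)) => [x|x|x||x|x|||x b kb].
- by rewrite !inE /=; case: (x \in O).
- by rewrite !inE => ->.
- by rewrite !inE.
- by rewrite -(leq_add2l #|O|) cardsC card_imset // !card_ord addSn.
- by rewrite !inE.
- rewrite !inE => xO; rewrite /jfree -[LHS]/((jzero (pred1 x) \o jren w) p).
  apply: jet_hom_ext => [c|i j jk] /=; first by rewrite jrenC jzeroC.
  rewrite (jrenX _ _ jk) (jzeroX K _ _ jk) /=.
  by case: eqVneq => // wx; rewrite -wx wO in xO.
- have -> : 'X^d * (jren w p)%:P = map_poly (jren w) (p%:P * 'X^d).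
    by rewrite rmorphM /= map_polyC map_polyXn mulrC.
  rewrite -(jinv_scale Hp).
  rewrite -[LHS]/((jscale O \o jren w) p) -[RHS]/((map_poly (jren w) \o jpoly _) p).
  apply: jet_hom_ext => [c|i j jk] /=; first by rewrite jrenC jscaleC jpolyC map_polyC /= jrenC.
  rewrite (jrenX _ _ jk) (jscaleX O _ jk) wO /jpoly jsubX // rmorphM /= map_polyX map_polyC /=.
  by rewrite (jrenX _ _ jk).
- have -> : (jren w p)%:P = map_poly (jren w) p%:P by rewrite map_polyC.
  rewrite -(jinv_theta Hp).
  rewrite -[LHS]/((jth [set: 'I_(L + d).+1] \o jren w) p) -[RHS]/((map_poly (jren w) \o jtheta predT) p).
  apply: jet_hom_ext => [c|i j jk] /=; first by rewrite jrenC jthC jthetaC map_polyC /= jrenC.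
  rewrite (jrenX _ _ jk) (jthX K _ _ jk) (jthetaX K _ _ jk) finset.in_setT rmorphD rmorphM /=.
  rewrite map_polyX !map_polyC /= (jrenX _ _ jk) !rmorphM !rmorph_nat /=.
  by rewrite (jrenX _ _ (leq_trans (leq_pred _) jk)).
- have D0 c : jD x b (jren w (c%:MP)) = 0 by rewrite jrenC jDC.
  have := chain_rule (raddfD (jD x b)) (@jDM K _ k x b) D0 p => /= ->.
  rewrite big1 // => i _; rewrite big1 // => j _; have jk : (j <= k)%N by rewrite -ltnS.
  have [jkap|kj] := leqP j kap; last by rewrite po // rmorph0 mul0r.
  by rewrite (jrenX _ _ jk) jDX // gtn_eqF ?andbF ?mulr0 // (leq_ltn_trans jkap).
Qed.

End Renaming.

(** * Generation and minimality *)

Section Generators.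
Variables (K : numFieldType) (L k : nat).
Local Notation J := (jet K L k).
Local Notation X := (@jX K L k).
Local Notation C := (@mpolyC (jet_dim L k) K).
Local Notation W := (@jW K L k).
Local Notation wordW := (@wordW K L k).
Local Notation wordG := (@wordG K L k).
Implicit Types (p q : J).

Definition is_gen (x : J) := exists2 e, (e <= k)%N & is_wordG e x.

Lemma wordW1 i : wordW [:: i] = wordG i [::].
Proof.
congr (jW K k _ _); congr (wronsk_cols _); apply/funext => j.
rewrite /= /lift_block /ins_block; case: eqVneq => [->|_]; first by rewrite ltnn.
by case: ifP.
Qed.

(** Modulo generators a Wronskian of size e+2 has order at most e, so [jinv_galg] expresses the
    difference through Wronskians of size at most e+1, and induction applies. *)
Lemma wronskian_galg n s : (n <= k.+1)%N -> size s = n -> galg is_gen (W n s).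
Proof.
elim/ltn_ind: n s => n IHn s nk sn; have Hp := @jW_inv K L k n s nk sn.
case: n IHn nk sn Hp => [|[|e]] IHn nk sn Hp.
- by rewrite jW.unlock det_mx00; apply: galg1.
- apply: galg_lspan (jinv_span nk Hp) => _ [[|i [|//]] // _ ->].
  by rewrite wordW1; apply: galg_in; exists 0%N => //; exists i, [::].
have [q [sq Hpq pq]] := @jinv_top_reduce K L k e.+1 _ nk Hp.
rewrite -[W _ _](subrK q) -[_ - q]scale1r; apply: galgL.
  have := @jinv_galg K k L e.+2 e (W e.+2 s - q) (ltnW nk) Hpq.
  move=> /(_ (fun x b eb => pq x b eb)); apply: galg_trans => _ [m [t [me tm ->]]].
  by apply: IHn; rewrite ?(leq_trans me) // ltnW.
by apply: galg_lspan sq => x xG; apply: galg_in; exists e.+1.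
Qed.

Lemma jinv_galg_gen d p : jinv d p -> galg is_gen p.
Proof.
move=> Hp; have := @jinv_galg K k L d k p (leqnn k) Hp.
have po x b : (k < b)%N -> jD x b p = 0 by rewrite /jD ltnNge => /negPf ->.
move=> /(_ po); apply: galg_trans => _ [m [t [mk tm ->]]].
exact: wronskian_galg.
Qed.

Lemma is_wordG_inv e (x : J) : (e <= k)%N -> is_wordG e x -> jinv e.+1 x.
Proof. by move=> ek [i [w [we _ ->]]]; rewrite -we; apply: wordG_inv; rewrite we. Qed.

(** The coefficient of t^d is the homogeneous component of degree d. *)
Definition jgrade : J -> {poly J} := jpoly (fun i j => 'X * (X i j)%:P).
HB.instance Definition _ := GRing.RMorphism.on jgrade.

Lemma jgradeZ a p : jgrade (a *: p) = C a *: jgrade p.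
Proof. by rewrite -!mul_mpolyC rmorphM /= /jgrade jpolyC mul_polyC. Qed.

Lemma jgrade_inv d p : jinv d p -> jgrade p = p%:P * 'X^d.
Proof. exact: jinv_scale. Qed.

Lemma jgrade_galg x : galg is_gen x -> forall d, jinv d (jgrade x)`_d.
Proof.
elim=> [{}x [d dk xG] d'||a {}x y _ ix _ iy d|{}x y _ ix _ iy d].
- rewrite (jgrade_inv (is_wordG_inv dk xG)) coefCM coefXn.
  case: eqVneq => [->|_]; first by rewrite mulr1; apply: is_wordG_inv.
  by rewrite mulr0; apply: jinv0.
- move=> d; rewrite rmorph1 coef1; case: eqVneq => [->|_]; last exact: jinv0.
  by rewrite -mpolyC1; apply: jinvC.
- by rewrite rmorphD /= jgradeZ coefD coefZ mul_mpolyC; apply: jinvD => //; apply: jinvZ.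
- rewrite rmorphM coefM; apply: (big_ind (jinv d)) => [||j _]; [exact: jinv0|exact: jinvD|].
  by rewrite -[X in jinv X](subnKC (ltn_ord j : (j <= d)%N)); apply: jinvM.
Qed.

Lemma jgrade_sum x : x = \sum_(d < size (jgrade x)) (jgrade x)`_d.
Proof.
transitivity (jgrade x).[1].
  rewrite -[LHS]/(idfun x) -[RHS]/((horner_eval 1 \o jgrade) x).
  apply: jet_hom_ext => [c|i j jk] /=.
    by rewrite /jgrade jpolyC /horner_eval hornerC.
  by rewrite /jgrade /jpoly jsubX // /horner_eval hornerM hornerX mul1r hornerC.
by rewrite horner_coef; apply: eq_bigr => d _; rewrite expr1n mulr1.
Qed.

(** For every element generated by [H], the component of degree e+1 agrees with a combination of the
    members of [H] of that degree, up to terms whose derivatives of order [e] vanish. For [g] itself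
    this contradicts [wordG_indep]. *)
Lemma galg_minimal (H : J -> Prop) g : (forall x, H x -> is_gen x) ->
  is_gen g -> ~ H g -> ~ galg H g.
Proof.
move=> HG [e ek gG] Hg.
pose P x := H x /\ is_wordG e x.
have low d p j : (0 < d <= e)%N -> jinv d p -> jD j e p = 0.
  by move=> /andP[_ de] Hp; exact: (jinv_order j (leq_trans de (leqW ek)) Hp de).
have graded x : galg H x -> forall d, jinv d (jgrade x)`_d.
  by move=> xH; apply/jgrade_galg/galg_trans/xH => y /HG; apply: galg_in.
suff good x : galg H x ->
    exists2 y, lspan P y & forall j, jD j e ((jgrade x)`_e.+1 - y) = 0.
  move=> /good[y yP yg]; have Hg' := is_wordG_inv ek gG.
  rewrite (jgrade_inv Hg') coefCM coefXn eqxx mulr1 in yg.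
  case: gG => [i [w [we iw gE]]]; rewrite gE in yg Hg.
  apply: (wordG_indep ek we iw _ yg); apply: lspan_trans yP => x [Hx xG].
  by apply: lspan_in; split=> // xE; apply: Hg; rewrite -xE.
elim=> [{}x Hx||a {}x y _ [u uP ux] _ [v vP vy]|{}x y xH [u uP ux] yH [v vP vy]].
- have [d dk xG] := HG x Hx; rewrite (jgrade_inv (is_wordG_inv dk xG)).
  have [de|de] := eqVneq d e.
    exists x => [|j]; first by apply: lspan_in; split=> //; rewrite -de.
    by rewrite de coefCM coefXn eqxx mulr1 subrr linear0.
  exists 0 => [|j]; first exact: lspan0.
  by rewrite coefCM coefXn eqSS eq_sym (negPf de) mulr0 subrr linear0.
- exists 0 => [|j]; first exact: lspan0.
  by rewrite rmorph1 coef1 subrr linear0.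
- exists (a *: u + v) => [|j]; first by apply: lspanD => //; apply: lspanZ.
  rewrite rmorphD /= jgradeZ coefD coefZ mul_mpolyC opprD addrACA linearD /= vy addr0.
  by rewrite -scalerBr linearZ /= ux scaler0.
- have ix := graded x xH; have iy := graded y yH.
  have [a aE] := jinv0_const (ix 0%N); have [b bE] := jinv0_const (iy 0%N).
  exists (a *: v + b *: u) => [|j].
    by apply: lspanD; apply: lspanZ.
  rewrite rmorphM coefM big_ord_recl big_ord_recr /= subn0 subnn aE bE mul_mpolyC.
  rewrite [_ * C b]mulrC mul_mpolyC addrCA opprD -addrA.
  (* Both factors of a middle term have degree between 1 and e, hence order < e; the two extreme
     terms have a constant factor. *)
  rewrite linearD linear_sum /= big1 ?add0r => [|l _]; last first.
    have l1 : (0 < bump 0 l <= e)%N by rewrite /bump add1n ltn_ord.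
    have l2 : (0 < e.+1 - bump 0 l <= e)%N.
      by have := ltn_ord l; rewrite /bump /= add1n; clear; lia.
    by rewrite jDM (low _ _ _ l1) ?(low _ _ _ l2) ?mul0r ?mulr0 ?addr0.
  have -> : a *: (jgrade y)`_e.+1 + b *: (jgrade x)`_e.+1 + (- (a *: v) - b *: u) =
      a *: ((jgrade y)`_e.+1 - v) + b *: ((jgrade x)`_e.+1 - u).
    by rewrite addrACA !scalerBr.
  by rewrite linearD !linearZ /= ux vy !scaler0 addr0.
Qed.

End Generators.

(** * The index sets *)

Lemma sorted_ltn_le_last s b : sorted ltn s -> b \in s -> (b <= last 0 s)%N.
Proof.
case: s => [//|x s] /= xs; rewrite inE => /predU1P[->|bs].
  elim: s x xs => //= y s IHs x /andP[xy ys]; exact: leq_trans (ltnW xy) (IHs _ ys).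
elim: s x xs bs => //= y s IHs x /andP[xy ys]; rewrite inE => /predU1P[->|]; last exact: IHs ys.
case: s ys {IHs} => //= z s /andP[yz]; elim: s z yz => [|t s IHs] z yz /=; first by rewrite ltnW.
by move=> /andP[zt ts]; apply: IHs ts; apply: ltn_trans zt.
Qed.

Lemma map_succnK s : 0%N \notin s -> map succn (map predn s) = s.
Proof.
move=> s0; rewrite -map_comp -[RHS]map_id; apply/eq_in_map => b bs /=.
by rewrite prednK // lt0n; apply: contraNneq s0 => <-.
Qed.

Lemma sorted_ltn0 s : sorted ltn (0%N :: s) -> 0%N \notin s.
Proof.
rewrite /= path_sortedE; last exact: ltn_trans.
by case/andP=> /allP s0 _; apply/negP => /s0.
Qed.

Lemma sorted_ltn_head0 s : sorted ltn s -> 0%N \in s -> s = 0%N :: behead s.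
Proof.
case: s => [//|x s] xs; rewrite inE => /predU1P[<-//|s0].
move: xs; rewrite /= path_sortedE; last exact: ltn_trans.
by case/andP=> /allP/(_ _ s0).
Qed.

Section Sigma.
Variable L : nat.
Implicit Types (a : 'I_L.+1 -> seq nat) (i J : 'I_L.+1) (w : seq 'I_L.+1).

Definition block_sum a i := (\sum_(l < L.+1 | l <= i) size (a l))%N.

(* Conditions (1)-(3) of the definition of the index set [in_Sigma].          *)
Definition block_seq d a :=
  [/\ forall i, sorted ltn (a i), forall i b, b \in a i -> (b < block_sum a i)%N &
      (\sum_i size (a i) = d)%N].

Lemma block_sumD a a' J i : (forall l, size (a l) = size (a' l) + (l == J))%N ->
  block_sum a i = (block_sum a' i + (J <= i))%N.
Proof.
move=> E; rewrite /block_sum; under eq_bigr do rewrite E.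
rewrite big_split /=; congr (_ + _)%N; have [Ji|iJ] := leqP J i.
  rewrite (bigD1 J) //= eqxx big1 // => l /andP[_ /negPf ->] //.
rewrite big1 // => l li; case: eqVneq => // lJ.
by rewrite lJ leqNgt iJ in li.
Qed.

Lemma sum_sizeD a a' J : (forall l, size (a l) = size (a' l) + (l == J))%N ->
  (\sum_l size (a l) = (\sum_l size (a' l)).+1)%N.
Proof.
move=> E; under eq_bigr do rewrite E.
rewrite big_split /= -[RHS]addn1; congr (_ + _)%N.
by rewrite (bigD1 J) //= eqxx big1 // => l /negPf ->.
Qed.

Lemma size_lift_block J a l : size (lift_block J a l) = (size (a l) + (l == J))%N.
Proof.
rewrite /lift_block; case: ltnP => [lJ|_].
  by rewrite -val_eqE /= ltn_eqF // addn0.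
by case: eqP => [->|_]; rewrite /= size_map ?addn1 ?addn0.
Qed.

Lemma size_ins_block J a l : size (ins_block J a l) = (size (a l) + (l == J))%N.
Proof. by rewrite /ins_block; case: eqP => _; rewrite /= ?addn1 ?addn0. Qed.

Lemma block_seq_lift d J a : block_seq d a <-> block_seq d.+1 (lift_block J a).
Proof.
have sE := size_lift_block J a.
have succ_sorted s : sorted ltn (map succn s) = sorted ltn s.
  by rewrite sorted_map; apply: eq_sorted.
have zsorted s : sorted ltn (0%N :: map succn s) = sorted ltn s.
  rewrite /= path_sortedE; last exact: ltn_trans.
  by rewrite succ_sorted all_map /= (@eq_all _ _ predT) ?all_predT.
split=> -[so bo sd]; split.
- move=> i; rewrite /lift_block; case: ltnP => _; first exact: so.
  by case: eqP => _; rewrite ?zsorted ?succ_sorted so.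
- move=> i b; rewrite (block_sumD i sE) /lift_block; case: ltnP => [iJ|Ji].
    by rewrite addn0; apply: bo.
  rewrite addn1 ltnS; case: eqP => _; last by move=> /mapP[b' /bo b'i ->].
  by rewrite inE => /predU1P[->//|/mapP[b' /bo b'i ->]].
- by rewrite (sum_sizeD sE) sd.
- move=> i; have := so i; rewrite /lift_block; case: ltnP => _ //.
  by case: eqP => _; rewrite ?zsorted ?succ_sorted.
- move=> i b ba; have := bo i; rewrite (block_sumD i sE) /lift_block.
  case: ltnP => [iJ|Ji]; first by rewrite addn0; apply.
  have bs : b.+1 \in map succn (a i) by apply: map_f.
  by case: eqP => _ /(_ b.+1); rewrite ?inE bs ?orbT addn1 ltnS; apply.
- by apply: succn_inj; rewrite -(sum_sizeD sE).
Qed.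

Lemma block_seq_word w : block_seq (size w) (word_block w).
Proof.
elim: w => [|J w IHw] /=; last exact: (proj1 (block_seq_lift _ _ _) IHw).
by split=> [//|i b|]; [rewrite in_nil|rewrite big1].
Qed.

(** The first nonempty block consists of distinct numbers smaller than its own length, so 0 is among
    them. *)
Lemma block_seq_zero d a : block_seq d.+1 a -> exists i, 0%N \in a i.
Proof.
move=> [so bo sd]; have [l0 l0P] : exists l, (0 < size (a l))%N.
  apply/existsP; rewrite -[[exists _, _]]negbK negb_exists; apply/negP => /forallP H.
  by move: sd; rewrite big1 // => l _; apply/eqP; rewrite -leqn0 leqNgt.
have [l lP lmin] := @arg_minnP _ l0 (fun l => 0 < size (a l))%N (@nat_of_ord L.+1) l0P.
exists l; have sl : block_sum a l = size (a l).
  rewrite /block_sum (bigD1 l) //= big1 ?addn0 // => l' /andP[l'l ne].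
  apply/eqP; rewrite -leqn0 leqNgt; apply/negP => /lmin ll'.
  by case/eqP: ne; apply: val_inj; apply/eqP; rewrite eqn_leq l'l.
apply/negPn/negP => n0.
have : (size (a l) <= size (iota 1 (size (a l)).-1))%N.
  apply: uniq_leq_size; first exact: (sorted_uniq ltn_trans ltnn (so l)).
  move=> b bl; rewrite mem_iota add1n prednK // -sl bo // andbT lt0n.
  by apply: contraNneq n0 => <-.
by rewrite size_iota -ltnS prednK // ltnn.
Qed.

(** The first letter of the word is recovered as the last block containing 0. Deleting this 0 and
    lowering the other offsets from that block on inverts [lift_block]. *)
Lemma block_seqP d a : block_seq d a -> exists2 w, size w = d & a = word_block w.
Proof.
elim: d a => [|d IHd] a ad.
  exists [::] => //; apply/funext => i; apply/eqP; rewrite -size_eq0.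
  have [_ _ /eqP] := ad; rewrite sum_nat_eq0 => /forallP/(_ i)/implyP; exact.
have [l lP] := block_seq_zero ad.
have [J J0 Jmax] := @arg_maxnP _ l (fun l => 0%N \in a l) (@nat_of_ord L.+1) lP.
have [so bo sd] := ad.
pose a' i := if (i < J)%N then a i else map predn (if i == J then behead (a i) else a i).
have aE : a = lift_block J a'.
  apply/funext => i; rewrite /lift_block /a'; case: ltnP => // Ji.
  case: eqVneq => [->|iJ].
    have aJ := sorted_ltn_head0 (so J) J0.
    by rewrite map_succnK -?aJ //; apply: sorted_ltn0; rewrite -aJ.
  rewrite map_succnK //; apply/negP => /Jmax /= iJ'.
  by case/eqP: iJ; apply: val_inj; apply/eqP; rewrite eqn_leq Ji iJ'.
have [w wd wE] : exists2 w, size w = d & a' = word_block w.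
  by apply: IHd; apply/(block_seq_lift _ J); rewrite -aE.
by exists (J :: w); rewrite /= ?wd // -wE.
Qed.

(** Let [i] be the last block containing 0. Condition (4) says that deleting this 0 leaves a
    sequence still satisfying the bounds, hence the block sequence of a word [w]. By the choice of
    [i], 0 occurs afterwards only in earlier blocks, so [w] starts before [i]. *)
Lemma in_SigmaP d a : in_Sigma d.+1 a <->
  exists i w, [/\ size w = d, gt_head i w & a = ins_block i (word_block w)].
Proof.
split=> [[c1 sd [i0 [r0 h0 c41 c42]]]|[i [w [wd iw aE]]]].
- have so i : sorted ltn (a i).
    by case: (posnP (size (a i))) => [/size0nil -> //|/c1[]].
  have bo i b : b \in a i -> (b <= last 0%N (a i))%N by apply: sorted_ltn_le_last.
  have z0 : 0%N \in a i0 by case: (a i0) r0 h0 => //= x s _ ->; rewrite inE eqxx.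
  have [i iz imax] := @arg_maxnP _ i0 (fun l => 0%N \in a l) (@nat_of_ord L.+1) z0.
  have ai := sorted_ltn_head0 (so i) iz.
  have i0i : (i0 <= i)%N by apply: imax.
  pose a' l := if l == i then behead (a l) else a l.
  have aE : a = ins_block i a'.
    by apply/funext => l; rewrite /ins_block /a'; case: eqP => [->|].
  have sE l : size (a l) = (size (a' l) + (l == i))%N by rewrite {1}aE size_ins_block.
  have a'a l b : b \in a' l -> b \in a l.
    by rewrite /a'; case: eqP => // _; apply: mem_behead.
  have a'd : block_seq d a'.
    split=> [l|l b bl|].
    + by rewrite /a'; case: eqP => // ->; have := so i; rewrite ai => /path_sorted.
    + have bal := a'a _ _ bl; have al0 : (1 <= size (a l))%N by case: (a l) bal.
      have := block_sumD l sE; have [il|li] := leqP i l; last first.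
        by rewrite addn0 => <-; apply: leq_ltn_trans (bo _ _ bal) (c1 l al0).2.
      rewrite addn1 => E; rewrite -[block_sum a' l]succnK -E -subn1.
      apply: leq_ltn_trans (bo _ _ bal) _.
      (* Here i0 <= i <= l, so l = i0 forces i = i0; a further entry in that block brings in the
         condition for r_i > 1. *)
      have [l0|ll0] := eqVneq l i0; last first.
        apply: c42 => //; rewrite ltn_neqAle (leq_trans i0i) // andbT.
        by apply: contra ll0 => /eqP/val_inj ->.
      rewrite l0; apply: c41; move: bl; rewrite /a' -l0 (_ : l == i).
        by case: (a l) => // x [].
      by apply/eqP/val_inj/eqP; rewrite eqn_leq il {1}l0 i0i.
    + by apply: succn_inj; rewrite -(sum_sizeD sE).
  have [w wd wE] := block_seqP a'd; exists i, w; split=> //; last by rewrite -wE.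
  case: w wd wE => [//|J w] wd wE /=.
  have J0 : 0%N \in a' J by rewrite wE /= /lift_block ltnn eqxx inE eqxx.
  rewrite ltnNge; apply/negP => iJ; have Ji : J = i.
    by apply/val_inj/eqP; rewrite eqn_leq iJ andbT; apply: imax; apply: a'a.
  by move: J0; apply/negP; rewrite /a' Ji eqxx sorted_ltn0 // -ai.
have [so bo sd] := block_seq_word w.
have sE := size_ins_block i (word_block w).
have so' l : sorted ltn (a l).
  rewrite aE /ins_block; case: eqP => [->|_]; last exact: so.
  rewrite /= path_sortedE ?so ?andbT; last exact: ltn_trans.
  apply/allP => b bi /=; rewrite lt0n; apply: contraNneq (word_block_gt iw) => <-.
  exact: bi.
have bE (l : 'I_L.+1) : (\sum_(l' < L.+1 | l' <= l) size (a l') = block_sum (word_block w) l + (i <= l))%N.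
  by rewrite aE -(block_sumD l sE).
have lastb l : (1 < size (a l))%N || (l != i) && (1 <= size (a l))%N ->
    (last 0%N (a l) < block_sum (word_block w) l)%N.
  rewrite aE /ins_block; case: eqP => [->|_] /=.
    rewrite orbF; case E: (word_block w i) => [|x s] //= _.
    by apply: bo; rewrite E; apply: mem_last.
  by case E: (word_block w l) => [|x s] //= _; apply: bo; rewrite E; apply: mem_last.
split.
- move=> l al; split; first exact: so'; rewrite bE.
  have [->|li] := eqVneq l i; last by rewrite ltn_addr // lastb // li al orbT.
  rewrite leqnn addn1 ltnS; have [ai|] := ltnP 1 (size (a i)).
    by rewrite ltnW // lastb // ai.
  by rewrite aE /ins_block eqxx; case: (word_block w i).
- by rewrite aE (sum_sizeD sE) sd wd.
- exists i; split.
  + by rewrite aE sE eqxx addn1.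
  + by rewrite aE /ins_block eqxx.
  + by move=> ai; rewrite bE leqnn addn1 subn1 /= lastb // ai.
  + move=> l il al; rewrite bE (ltnW il) addn1 subn1 /= lastb //.
    by rewrite al andbT orbC -val_eqE /= gtn_eqF.
Qed.

End Sigma.

(** * The symmetric algebra *)

Lemma galg_map (K : pzRingType) (A B : lalgType K) (phi : {rmorphism A -> B})
    (G : A -> Prop) (G' : B -> Prop) x :
  (forall a y, phi (a *: y) = a *: phi y) ->
  (forall y, G y -> G' (phi y)) -> galg G x -> galg G' (phi x).
Proof.
move=> phiZ GG'; elim=> [y /GG' ?||a y z _ ? _ ?|y z _ ? _ ?].
- exact: galg_in.
- by rewrite rmorph1; apply: galg1.
- by rewrite rmorphD /= phiZ; apply: galgL.
- by rewrite rmorphM; apply: galgM.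
Qed.

Lemma gen_subalgP (K : fieldType) (A : algType K) (G : set A) p :
  gen_subalg G p <-> galg (fun x => G x) p.
Proof.
split=> [|Gp M [[M1 ML MM] GM]].
  apply: smallest_sub p => [|x Gx]; last exact: galg_in.
  split=> [|a u v|u v]; rewrite !inE; [exact: galg1|exact: galgL|exact: galgM].
elim: Gp => [x /GM//||a x y _ Mx _ My|x y _ Mx _ My].
- exact: set_mem M1.
- by apply/set_mem/ML; apply: mem_set.
- by apply/set_mem/MM; apply: mem_set.
Qed.

Section Transport.
Variables (K : numFieldType) (N k : nat) (F : vectType K) (T : 'End(F)).
Variable f : k.+1.-tuple F.
Hypothesis fT : adapted_basis T f.
Local Notation V := (copies F N).
Local Notation S := (sym_alg K V).
Local Notation J := (jet K N k).
Local Notation X := (@jX K N k).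

Let fB : basis_of {:F} f. Proof. by case: fT. Qed.

(** As [f] is a basis, its copies form a basis of [V]: this is the isomorphism onto the symmetric
    algebra, with inverse [sym_jet]. *)
Definition jet_sym : J -> S := jsub (@mpolyC _ K) (fun i j => X_ f i j).
HB.instance Definition _ := GRing.RMorphism.on jet_sym.

Definition vec_jet (v : V) : J :=
  \sum_i \sum_(j < k.+1) coord f j (v i) *: X i j.

Definition sym_jet : S -> J := mmap (@mpolyC _ K) (fun l => vec_jet (vbasis {:V})`_l).

Lemma sym_jet_monoid_morphism : monoid_morphism sym_jet.
Proof.
have [gM g1] := mmap_is_multiplicative (fun l : 'I_(\dim {:V}) => vec_jet (vbasis {:V})`_l)
  (@mpolyC (jet_dim N k) K).
by split=> [|p q]; [exact: g1|exact: gM].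
Qed.
HB.instance Definition _ := GRing.isZmodMorphism.Build S J sym_jet (mmapB _ _).
HB.instance Definition _ := GRing.isMonoidMorphism.Build S J sym_jet sym_jet_monoid_morphism.

Lemma jet_symZ a p : jet_sym (a *: p) = a *: jet_sym p.
Proof. by rewrite -!mul_mpolyC rmorphM /= /jet_sym jsubC. Qed.

Lemma sym_jetZ a p : sym_jet (a *: p) = a *: sym_jet p.
Proof. by rewrite /sym_jet mmapZ mul_mpolyC. Qed.

Lemma vec_jet_is_linear : linear vec_jet.
Proof.
move=> a u v; rewrite /vec_jet scaler_sumr -big_split; apply: eq_bigr => i _ /=.
rewrite scaler_sumr -big_split; apply: eq_bigr => j _ /=.
by rewrite !ffunE linearP scalerDl scalerA.
Qed.
HB.instance Definition _ := GRing.isLinear.Build K V J _ vec_jet vec_jet_is_linear.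

Lemma sym_jet_in v : sym_jet (sym_in v) = vec_jet v.
Proof.
rewrite [in RHS](coord_vbasis (memvf v)) linear_sum /sym_in rmorph_sum.
apply: eq_bigr => l _; rewrite linearZ /= sym_jetZ; congr (_ *: _).
by rewrite /sym_jet mmapX mmap1U.
Qed.

Definition copy_vec i x : V := [ffun l => if l == i then x else 0].

Lemma copy_vec_is_linear i : linear (copy_vec i).
Proof.
move=> a u v; apply/ffunP => l; rewrite !ffunE.
by case: eqP => _; rewrite ?scaler0 ?addr0.
Qed.
HB.instance Definition _ i := GRing.isLinear.Build K F V _ (copy_vec i) (copy_vec_is_linear i).

Lemma X_E i j : X_ f i j = sym_in (copy_vec i f`_j) :> S. Proof. by []. Qed.

Lemma jet_symX i j : jet_sym (X i j) = X_ f i j.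
Proof.
have [jk|kj] := leqP j k; first exact: jsubX.
by rewrite jX_big // rmorph0 X_E nth_default ?size_tuple // !linear0.
Qed.

Lemma jet_sym_vec v : jet_sym (vec_jet v) = sym_in v.
Proof.
have {2}-> : v = \sum_i \sum_(j < k.+1) coord f j (v i) *: copy_vec i f`_j.
  apply/ffunP => l; rewrite sum_ffunE (bigD1 l) //= [X in _ + X]big1 ?addr0 => [|i il].
    rewrite sum_ffunE {1}(coord_basis fB (memvf (v l))); apply: eq_bigr => j _.
    by rewrite !ffunE eqxx.
  by rewrite sum_ffunE big1 // => j _; rewrite !ffunE eq_sym (negPf il) scaler0.
rewrite /vec_jet rmorph_sum linear_sum; apply: eq_bigr => i _ /=.
rewrite rmorph_sum linear_sum; apply: eq_bigr => j _ /=.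
by rewrite jet_symZ linearZ jet_symX X_E.
Qed.

Lemma vec_jet_copy i j : (j <= k)%N -> vec_jet (copy_vec i f`_j) = X i j.
Proof.
move=> jk; rewrite /vec_jet (bigD1 i) //= [X in _ + X]big1 ?addr0 => [|l li].
  have fj (j' : 'I_k.+1) : coord f j' f`_j = (j' == j :> nat)%:R.
    have -> : f`_j = f`_(Ordinal (jk : j < k.+1)%N) by [].
    by rewrite coord_free ?(basis_free fB) // eq_sym -val_eqE.
  rewrite (bigD1 (Ordinal (jk : j < k.+1)%N)) //= /copy_vec ffunE eqxx fj eqxx scale1r.
  rewrite big1 ?addr0 // => j' jj'; rewrite fj.
  by rewrite -val_eqE /= in jj'; rewrite (negPf jj') scale0r.
by rewrite big1 // => j' _; rewrite /copy_vec ffunE (negPf li) linear0 scale0r.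
Qed.

Lemma jet_symK : cancel jet_sym sym_jet.
Proof.
move=> p; rewrite -[RHS]/(idfun p) -[LHS]/((sym_jet \o jet_sym) p).
apply: jet_hom_ext => [c|i j jk] /=.
  by rewrite /jet_sym jsubC /sym_jet mmapC.
by rewrite jet_symX X_E sym_jet_in vec_jet_copy.
Qed.

Lemma sym_in_vbasis (l : 'I_(\dim {:V})) : sym_in (vbasis {:V})`_l = 'X_l.
Proof.
rewrite /sym_in (bigD1 l) //= coord_free ?(basis_free (vbasisP _)) //.
rewrite eqxx scale1r big1 ?addr0 // => l' /negPf ll'.
by rewrite coord_free ?(basis_free (vbasisP _)) // eq_sym ll' scale0r.
Qed.

Lemma sym_jetK : cancel sym_jet jet_sym.
Proof.
move=> p; elim/mpoly_ring_ind: p => [c|l|p q Hp Hq|p q Hp Hq].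
- by rewrite /sym_jet mmapC /jet_sym jsubC.
- by rewrite {1}/sym_jet mmapX mmap1U jet_sym_vec sym_in_vbasis.
- by rewrite !rmorphD /= Hp Hq.
- by rewrite !rmorphM /= Hp Hq.
Qed.

Lemma diag_act_is_linear P : linear (@diag_act K F N (poly_end T P)).
Proof.
have TL l a u v : iter l T (a *: u + v) = a *: iter l T u + iter l T v.
  by elim: l => //= l ->; rewrite linearP.
move=> a u v; apply/ffunP => i; rewrite !ffunE /poly_end scaler_sumr -big_split.
apply: eq_bigr => l _ /=; rewrite TL scalerDr !scalerA.
by rewrite [P`_l * a]mulrC.
Qed.
HB.instance Definition _ P :=
  GRing.isLinear.Build K V V _ (@diag_act K F N (poly_end T P)) (diag_act_is_linear P).

Lemma iter_basis l j : (j <= k)%N -> iter l T f`_j = (j ^_ l)%:R *: f`_(j - l).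
Proof.
have [_ T0 TS] := fT => jk; elim: l => [|l IHl]; first by rewrite subn0 scale1r.
rewrite iterS IHl linearZ ffactnSr /=; have [jl|lj] := leqP j l.
  by rewrite (eqP (jl : j - l == 0)%N) T0 muln0 scaler0 scale0r.
rewrite TS ?subn_gt0 ?lj ?(leq_trans (leq_subr _ _)) // scalerA natrM.
by rewrite -subnS.
Qed.

(** Reconciles the sum over the coefficients of P in [poly_end] with the sum over orders up to k in
    [jact]. *)
Lemma sum_ord_support (W : nmodType) m m' (G : nat -> W) :
  (forall l, (m <= l)%N -> G l = 0) -> (forall l, (m' <= l)%N -> G l = 0) ->
  \sum_(l < m) G l = \sum_(l < m') G l.
Proof.
have E n M : (n <= M)%N -> (forall l, (n <= l)%N -> G l = 0) ->
    \sum_(l < n) G l = \sum_(l < M) G l.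
  move=> nM Gn; rewrite (big_ord_widen M G nM) big_mkcond; apply: eq_bigr => l _.
  by case: ifPn => //; rewrite -leqNgt => /Gn.
by move=> Gm Gm'; rewrite (E m (maxn m m')) ?leq_maxl // (E m' (maxn m m')) ?leq_maxr.
Qed.

Lemma poly_end_basis P j : (j <= k)%N ->
  poly_end T P f`_j = \sum_(l < k.+1) ((j ^_ l)%:R * P`_l) *: f`_(j - l).
Proof.
move=> jk; rewrite /poly_end.
under eq_bigr => l _ do rewrite (iter_basis l jk) scalerA mulrC.
apply: (sum_ord_support (G := fun l => ((j ^_ l)%:R * P`_l) *: f`_(j - l))) => l ml.
  by rewrite nth_default ?mulr0 ?scale0r.
by rewrite ffact_small ?mul0r ?scale0r // (leq_trans _ ml).
Qed.

Lemma sym_map_jet P q :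
  sym_map (diag_act (poly_end T P)) (jet_sym q) = jet_sym (jact P q).
Proof.
rewrite /sym_map -[LHS]/((comp_mpoly _ \o jet_sym) q) -[RHS]/((jet_sym \o jact P) q).
apply: jet_hom_ext => [c|i j jk] /=; first by rewrite jactC /jet_sym jsubC comp_mpolyC.
rewrite -/(sym_map (diag_act (poly_end T P)) (jet_sym (X i j))).
rewrite jet_symX X_E sym_map_in jactX // rmorph_sum /=.
have -> : diag_act (poly_end T P) (copy_vec i f`_j) =
    \sum_(l < k.+1) ((j ^_ l)%:R * P`_l) *: copy_vec i f`_(j - l).
  apply/ffunP => i'; rewrite sum_ffunE /diag_act ffunE /copy_vec ffunE.
  case: eqP => ii'; first by rewrite poly_end_basis //; apply: eq_bigr => l _; rewrite !ffunE ii' eqxx.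
  rewrite /poly_end !big1 // => l _; first by rewrite !ffunE; case: eqP ii' => // _ _; rewrite scaler0.
  by rewrite (_ : iter l T 0 = 0) ?scaler0 //; elim: (nat_of_ord l) => //= n ->; rewrite linear0.
rewrite linear_sum; apply: eq_bigr => l _ /=.
rewrite linearZ /= -X_E !rmorphM rmorph_nat /= jet_symX /jet_sym jsubC.
by rewrite -mul_mpolyC mpolyCM mpolyC_nat.
Qed.

Lemma quasi_invariantP d q : quasi_invariant T N d (jet_sym q) <-> jinv d q.
Proof.
split=> Hq P P0; last by rewrite sym_map_jet Hq // jet_symZ.
by apply: (can_inj jet_symK); rewrite -sym_map_jet Hq // jet_symZ.
Qed.

Lemma quasi_invariantsP p : quasi_invariants T N p <-> galg (@is_gen K N k) (sym_jet p).
Proof.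
split=> [[n [q [Hq ->]]]|Hp].
  rewrite rmorph_sum; apply: galg_sum => d _; apply: (@jinv_galg_gen _ _ _ d).
  by apply/quasi_invariantP; rewrite sym_jetK.
exists (size (jgrade (sym_jet p))), (fun d => jet_sym (jgrade (sym_jet p))`_d).
split=> [d|]; first by apply/quasi_invariantP/jgrade_galg.
by rewrite -[LHS]sym_jetK {1}(jgrade_sum (sym_jet p)) rmorph_sum.
Qed.

Lemma jet_symW d a : (d <= k.+1)%N -> jet_sym (jW K k d (wronsk_cols a)) = wronsk f d a.
Proof.
move=> dk; rewrite jW.unlock -det_map_mx; congr (\det _).
apply/matrixP => r l; rewrite !mxE /wronsk_entry /jE; set c := nth _ _ _.
rewrite rmorphM rmorph_nat /= jet_symX; case: leqP => // rc.
by rewrite ffact_small // mul0r.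
Qed.

Lemma gensP d p : (d <= k)%N -> gens N f d.+1 p <-> @is_wordG K N k d (sym_jet p).
Proof.
move=> dk; split=> [[a /in_SigmaP[i [w [wd iw ->]]] <-]|[i [w [wd iw pE]]]].
  by exists i, w; split=> //; rewrite -jet_symW ?jet_symK /wordG ?wd.
exists (ins_block i (word_block w)); first by apply/in_SigmaP; exists i, w.
by rewrite -jet_symW // -wd -/(wordG K k i w) -pE sym_jetK.
Qed.

End Transport.

(** * Cardinalities of the sets of generators *)

Local Open Scope classical_set_scope.
Local Open Scope card_scope.

Lemma card_eq_finType_image (T : finType) (P : pred T) (U : Type) (g : T -> U) :
  {in P &, injective g} -> [set u | exists2 x, P x & u = g x] #= `I_#|P|.
Proof.
move=> gI; case: (pickP P) => [x0 Px0|P0]; last first.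
  rewrite eq_card0 // II0 (_ : [set u | _] = set0) //.
  by apply/seteqP; split=> // u [x]; rewrite P0.
pose phi m := g (nth x0 (enum P) m).
have nthP m : (m < #|P|)%N -> P (nth x0 (enum P) m).
  by move=> mP; have := mem_nth x0 (_ : m < size (enum P))%N; rewrite -cardE mem_enum => /(_ mP).
have -> : [set u | exists2 x, P x & u = g x] = phi @` `I_#|P|.
  apply/seteqP; split=> [u [x Px ->]|_ [m mP <-]]; last by exists (nth x0 (enum P) m) => //; apply: nthP.
  by exists (index x (enum P)); rewrite /phi /= ?cardE ?index_mem ?nth_index // mem_enum.
apply: inj_card_eq => m m'; rewrite !inE /= => mP mP' /gI E.
have /eqP := E (nthP _ mP) (nthP _ mP').
by rewrite nth_uniq ?enum_uniq -?cardE // => /eqP.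
Qed.

(** There are i choices for a first letter below i and N+1 for each of the d others; the sum of all
    i is N(N+1)/2. *)
Lemma card_word_gens N d :
  #|[pred p : 'I_N.+1 * d.+1.-tuple 'I_N.+1 | (thead p.2 < p.1)%N]| =
  ((N * N.+1) %/ 2 * N.+1 ^ d)%N.
Proof.
rewrite -sum1_card big_mkcond -(pair_bigA _ (fun (i : 'I_N.+1) (t : d.+1.-tuple 'I_N.+1) => if (thead t < i)%N then 1%N else 0%N)) /=.
have E (i : 'I_N.+1) :
    (\sum_(t : d.+1.-tuple 'I_N.+1) (if thead t < i then 1 else 0) = i * N.+1 ^ d)%N.
  rewrite (@sum_tuple_cons nat) /=.
  transitivity (\sum_(x < N.+1) (if (x < i)%N then N.+1 ^ d else 0))%N.
    apply: eq_bigr => x _.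
    under eq_bigr do rewrite theadE.
    by rewrite sum_nat_const card_tuple card_ord; case: ifP; rewrite ?muln1 ?muln0.
  rewrite -big_mkcond sum_nat_const; congr (_ * _)%N.
  by rewrite -[RHS]card_ord -sum1_card -sum1_card (big_ord_widen_cond N.+1 xpredT (fun=> 1%N)) // ltnW.
under eq_bigr do rewrite E.
rewrite -big_distrl /=; congr (_ * _)%N.
by rewrite -(big_mkord xpredT (fun i => i)) bin2_sum bin2 mulnC divn2.
Qed.

Section Cardinals.
Variables (K : numFieldType) (N k : nat) (F : vectType K) (T : 'End(F)).
Variable f : k.+1.-tuple F.
Hypothesis fT : adapted_basis T f.

Lemma card_gens1 : gens N f 1 #= `I_N.+1.
Proof.
pose g (i : 'I_N.+1) := jet_sym f (wordG K k i [::]).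
have -> : gens N f 1 = [set u | exists2 i : 'I_N.+1, predT i & u = g i].
  apply/seteqP; split=> p.
    case/(gensP fT p (leq0n k)) => i [w [/size0nil -> _ pE]].
    by exists i => //; rewrite /g -pE (sym_jetK fT).
  move=> [i _ ->]; apply/(gensP fT _ (leq0n k)).
  by exists i, [::]; rewrite /g (jet_symK fT).
rewrite -[X in `I_X]card_ord; apply: card_eq_finType_image => i j _ _.
move=> /(can_inj (jet_symK fT)) E.
by have [] := @wordG_inj _ _ _ i [::] j [::] (leq0n k) erefl erefl erefl E.
Qed.

Lemma card_gens d : (d.+1 <= k)%N ->
  gens N f d.+2 #= `I_((N * N.+1) %/ 2 * N.+1 ^ d).
Proof.
move=> dk.
pose g (p : 'I_N.+1 * d.+1.-tuple 'I_N.+1) := jet_sym f (wordG K k p.1 p.2).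
have thE (i : 'I_N.+1) (t : d.+1.-tuple 'I_N.+1) : (thead t < i)%N = gt_head i t.
  by case/tupleP: t => x t; rewrite theadE.
have -> : gens N f d.+2 =
    [set u | exists2 p : 'I_N.+1 * d.+1.-tuple 'I_N.+1, (thead p.2 < p.1)%N & u = g p].
  apply/seteqP; split=> p.
    case/(gensP fT p dk) => i [w [/eqP wd iw pE]].
    by exists (i, Tuple wd); rewrite /= ?thE // /g /= -pE (sym_jetK fT).
  move=> [[i t] /= it ->]; apply/(gensP fT _ dk).
  exists i, t; rewrite /g /= (jet_symK fT) size_tuple; split=> //.
  by rewrite -thE.
rewrite -card_word_gens; apply: card_eq_finType_image => -[i t] [i' t'].
rewrite /in_mem /= !thE => it it' /(can_inj (jet_symK fT)) E.
have tk : (size t <= k)%N by rewrite size_tuple.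
have tt' : size t = size t' by rewrite !size_tuple.
by have [-> /val_inj ->] := wordG_inj tk tt' it it' E.
Qed.

End Cardinals.

(** * Quasi-invariants over the complex numbers *)

Local Open Scope complex_scope.

Theorem theorem0p0p3 (R : realType) (N k : nat) (F : vectType R[i])
    (J : 'End(F)) (f : k.+1.-tuple F) :
  (1 <= N)%N ->
  \dim {:F} = k.+1 ->
  (exists m, forall v, iter m J v = 0) ->
  (exists v, iter k J v != 0) ->
  adapted_basis J f ->
  let G := \bigcup_(d in [set d | (1 <= d <= k.+1)%N]) gens N f d in
  [/\ finite_set G,
      gen_subalg G = quasi_invariants J N,
      forall H, H `<` G -> gen_subalg H <> quasi_invariants J N,
      gens N f 1 #= `I_N.+1 &
      forall i, (2 <= i <= k.+1)%N ->
        gens N f i #= `I_((N * N.+1) %/ 2 * N.+1 ^ (i - 2))].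
Proof.
move=> _ _ _ _ fJ G.
have card_ge2 i : (2 <= i <= k.+1)%N ->
    gens N f i #= `I_((N * N.+1) %/ 2 * N.+1 ^ (i - 2)).
  case: i => [|[|d]] // /andP[_ dk]; rewrite subn2.
  exact: (@card_gens _ N k F J f fJ d dk).
have GP p : G p <-> @is_gen _ N k (sym_jet f p).
  split=> [[[|d] //= dk pG]|[d dk pG]].
    by exists d; last exact/(gensP fJ p dk).
  by exists d.+1; last exact/(gensP fJ p dk).
have genE p : gen_subalg G p <-> quasi_invariants J N p.
  split=> [/gen_subalgP pG|/(quasi_invariantsP fJ) pG].
    apply/(quasi_invariantsP fJ); apply: galg_map pG => [a y|y /GP//].
    exact: sym_jetZ.
  apply/gen_subalgP; rewrite -[p](sym_jetK fJ); apply: galg_map pG => [a y|y yG].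
    exact: jet_symZ.
  by apply/GP; rewrite (jet_symK fJ).
split=> //.
- apply: bigcup_finite => [|d /andP[d1 dk]].
    by apply: sub_finite_set (finite_II k.+2) => d /andP[_ dk].
  apply/finite_setP; case: d d1 dk => [|[|d]] // _ dk.
    by exists N.+1; apply: card_gens1 fJ.
  by eexists; apply: card_ge2.
- by apply/seteqP; split=> p /genE.
- move=> H [HG GH] HE; apply: GH => g gG.
  have : gen_subalg H g by rewrite HE; apply/genE; apply: sub_gen_smallest.
  move=> /gen_subalgP gH; have [//|ngH] := pselect (H g).
  exfalso; apply: (@galg_minimal _ N k (fun x => H (jet_sym f x)) (sym_jet f g)).
  + by move=> x /HG/GP; rewrite (jet_symK fJ).
  + exact/GP.
  + by rewrite (sym_jetK fJ).
  + apply: galg_map gH => [a y|y yH]; first exact: sym_jetZ.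
    by rewrite (sym_jetK fJ).
- exact: card_gens1 fJ.
Qed.
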